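(* Let $Q:\mathbb{R}^d\to\mathbb{R}$ be continuous such that $|Q|$ is positive homogeneous with homogeneous order $\mu=\mu_{|Q|}$, and for $\tau>0$ let $\mathcal O_\tau=\{\xi\in\mathbb{R}^d:|Q(\xi)|<\tau\}$. Suppose $\mu<1$. Then: (1) For every $t>0$ and $x\in\mathbb{R}^d$ the limit $H_{iQ}^t(x):=\frac{1}{(2\pi)^d}\lim_{\tau\to\infty}\int_{\mathcal O_\tau}e^{-itQ(\xi)-ix\cdot\xi}\,d\xi$ exists, and $(t,x)\mapsto H^t_{iQ}(x)$ is continuous on $(0,\infty)\times\mathbb{R}^d$. (2) For each $t_0>0$ and compact $K\subseteq\mathbb{R}^d$, this limit is uniform for $t\ge t_0$, $x\in K$: for every $\epsilon>0$ there is $\tau_0$ with $\left|(2\pi)^dH^t_{iQ}(x)-\int_{\mathcal O_\tau}e^{-itQ(\xi)-ix\cdot\xi}d\xi\right|<\epsilon$ for all $\tau\ge\tau_0$, $t\ge t_0$, $x\in K$. (3) For every $E\in\mathrm{Exp}(Q)$, $H^t_{iQ}(x)=t^{-\mu}H^1_{iQ}(t^{-E^*}x)$ for all $t>0$, $x\in\mathbb{R}^d$. (4) For all $t>0$, $\mathrm{Re}\,H^t_{iQ}(0)=\frac{t^{-\mu}}{(2\pi)^d}m(B_{|Q|})\Gamma(1+\mu)\cos(\mu\pi/2)>0$, where $B_{|Q|}=\{\xi:|Q(\xi)|<1\}$, $m$ is Lebesgue measure and $\Gamma$ is Euler's Gamma function.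
   Context: For $E\in\mathrm{End}(\mathbb{R}^d)$, $t>0$, $t^E:=\exp(\log(t)E)$, and $E^*$ is the adjoint. $P:\mathbb{R}^d\to\mathbb{C}$ is homogeneous w.r.t. $E$ if $P(t^E\xi)=tP(\xi)$ for all $t>0,\xi$; $\mathrm{Exp}(P)$ is the set of such $E$. A real $P$ is positive definite if $P\ge0$ and vanishes only at $0$. $P:\mathbb{R}^d\to\mathbb{R}$ is positive homogeneous if continuous, positive definite, $\mathrm{Exp}(P)\ne\emptyset$, and $S_P=\{P=1\}$ compact; its homogeneous order $\mu_P$ is the common value $\mathrm{tr}E$, $E\in\mathrm{Exp}(P)$. (For continuous real $Q$ with $|Q|$ positive homogeneous, $\mathrm{Exp}(Q)=\mathrm{Exp}(|Q|)$.) *)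

(* Defs.v *)
From HB Require Import structures.
From mathcomp Require Import all_boot all_order all_algebra.
From mathcomp Require Import all_classical all_reals all_analysis.
Set Implicit Arguments. Unset Strict Implicit. Unset Printing Implicit Defensive.
Import Order.TTheory GRing.Theory Num.Theory.
Import numFieldNormedType.Exports.
Local Open Scope classical_set_scope.
Local Open Scope ring_scope.

Section Defs.
Variable R : realType.

(* Vectors of R^d are represented as row vectors 'rV[R]_d.  A matrix A acts
   on the (column) vector xi as usual; in row-vector form: xi *m A^T. *)
Definition mact d (A : 'M[R]_d) (xi : 'rV[R]_d) : 'rV[R]_d := xi *m A^T.

Definition dotp d (x xi : 'rV[R]_d) : R := \sum_(i < d) x 0 i * xi 0 i.

Definition mexp d (A : 'M[R]_d) : 'M[R]_d :=
  limn (fun n => \sum_(k < n) (k`!%:R)^-1 *: A ^+ k).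

Definition mpow d (t : R) (E : 'M[R]_d) : 'M[R]_d := mexp (ln t *: E).

Definition hom_exp d (P : 'rV[R]_d -> R) (E : 'M[R]_d) : Prop :=
  forall t : R, 0 < t -> forall xi, P (mact (mpow t E) xi) = t * P xi.

Definition pos_definite d (P : 'rV[R]_d -> R) : Prop :=
  (forall xi, 0 <= P xi) /\ (forall xi, P xi = 0 <-> xi = 0).

Definition pos_homogeneous d (P : 'rV[R]_d -> R) : Prop :=
  [/\ continuous P, pos_definite P, (exists E, hom_exp P E)
    & compact [set xi | P xi = 1]].

(* d-dimensional Lebesgue integral, realised as the iterated Lebesgue integral
   over the coordinates (first coordinate outermost). *)
Fixpoint leb_int (d : nat) : ('rV[R]_d -> \bar R) -> \bar R :=
  match d return ('rV[R]_d -> \bar R) -> \bar R with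
  | 0 => fun f => f 0
  | d'.+1 => fun f =>
      (\int[@lebesgue_measure R]_(s in [set: R])
         leb_int (fun v : 'rV[R]_d' => f (row_mx (s%:M : 'M[R]_1) v)))%E
  end.

Definition leb_measure d (A : set 'rV[R]_d) : \bar R :=
  leb_int (fun xi => (\1_A xi)%:E).

Definition Oset d (Q : 'rV[R]_d -> R) (tau : R) : set 'rV[R]_d :=
  [set xi | `|Q xi| < tau].

(* real and imaginary parts of  int_{O_tau} e^{-i t Q(xi) - i x.xi} dxi
   = int_{O_tau} cos(tQ(xi) + x.xi) dxi - i int_{O_tau} sin(tQ(xi) + x.xi) dxi *)
Definition trunc_re d (Q : 'rV[R]_d -> R) (tau t : R) (x : 'rV[R]_d) : R :=
  fine (leb_int (fun xi => (\1_(Oset Q tau) xi * cos (t * Q xi + dotp x xi))%:E)).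
Definition trunc_im d (Q : 'rV[R]_d -> R) (tau t : R) (x : 'rV[R]_d) : R :=
  fine (leb_int (fun xi => (- (\1_(Oset Q tau) xi * sin (t * Q xi + dotp x xi)))%:E)).

Definition H_re d (Q : 'rV[R]_d -> R) (t : R) (x : 'rV[R]_d) : R :=
  ((2 * pi) ^+ d)^-1 * lim ((fun tau => trunc_re Q tau t x) @ +oo).
Definition H_im d (Q : 'rV[R]_d -> R) (t : R) (x : 'rV[R]_d) : R :=
  ((2 * pi) ^+ d)^-1 * lim ((fun tau => trunc_im Q tau t x) @ +oo).

Definition cmod (a b : R) : R := Num.sqrt (a ^+ 2 + b ^+ 2).

Definition Gamma (s : R) : R :=
  let g := fun x : R => (x `^ (s - 1) * expR (- x))%R in
  fine (\int[@lebesgue_measure R]_(x in [set x : R | (0 < x)%R]) (g x)%:E)%E.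

End Defs.

(* Main.v *)
(* Fix E in Exp(|Q|), mu = tr E, and let G_s = exp(s E); then Q(G_s xi) = e^s Q(xi)
   (the sign of Q is constant along orbits) and G_s multiplies Lebesgue measure by
   e^{mu s}.  The set {|Q| <= 1} is bounded, so exp(-s E) is bounded for s >= 0; its
   inverse is its adjugate divided by its determinant e^{-mu s}, whence
   |xi| = O(|Q(xi)|^mu) where |Q| >= 1.

   Integration by parts along the flow on a shell {T1 <= |Q| < T2}: if
   h = O(c / |Q|) and k is the derivative of h along the flow, then the integral of
   k + mu h is a boundary term, of size O(c T1^{mu-1}).  For the phase
   phi = t Q + x.xi + theta with flow derivative D phi one takes
   h = sin(phi) / D phi.  Since mu < 1, the term t Q dominates D phi and D^2 phi, and
   the integral of cos(phi) over the shell is O(T1^{mu-1} / t).  This gives existence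
   and uniformity of the limits, hence their continuity; the scaling relation is a
   linear change of variables.

   At the origin, the integral of cos|Q| over {|Q| < T} has derivative
   m(B) mu T^{mu-1} cos T in T.  Rotating the contour from the imaginary to the real
   axis identifies its limit with m(B) Gamma(1+mu) cos(mu pi/2). *)

Require Import Defs.
From HB Require Import structures.
From mathcomp Require Import all_boot all_order fingroup perm all_algebra.
From mathcomp Require Import all_classical all_reals all_analysis.
From mathcomp Require Import measurable_realfun ring lra.
Import Order.TTheory GRing.Theory Num.Theory.
Import numFieldNormedType.Exports.
Local Open Scope classical_set_scope.
Local Open Scope ring_scope.
Set Implicit Arguments.
Unset Strict Implicit.
Unset Printing Implicit Defensive.

(** * Lebesgue measure on row vectors *)

(** [Q] is merely continuous and its level sets carry no regularity, so neither the divergence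
    theorem nor polar coordinates over {|Q| = 1} can be invoked. What can be differentiated is any
    quantity along the flow, where Q is an explicit exponential, and the flow carries shells to
    shells. Integration by parts therefore rests on linear changes of variables alone, and the
    radial derivative at the origin on the known measure of thin shells. The adjugate enters because
    compactness of {|Q| = 1} controls only the contracting direction; the expanding one is reached
    through the determinant. The resulting exponent mu < 1 makes the linear phase of lower order,
    uniformly for x in a bounded set. The offset theta treats both parts of the integral at once:
    theta = 0 gives the cosine, theta = pi / 2 gives minus the sine. The statement integrates
    coordinate by coordinate, whereas the flow mixes coordinates. Hence a genuine measure on row
    vectors is built; it agrees with the iterated integral for bounded integrands supported in a
    cube, and the sets {|Q| < b} are bounded. *)

Section RowVectorMeasurable.
Variables (R : realType) (n : nat).

Let coors : 'I_n -> 'rV[R]_n -> R := fun i x => x 0 i.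

Let rv_set0 : g_sigma_preimage coors set0.
Proof. exact: sigma_algebra0. Qed.

Let rv_setC A : g_sigma_preimage coors A -> g_sigma_preimage coors (~` A).
Proof. exact: sigma_algebraC. Qed.

Let rv_bigcup (F : nat -> set 'rV[R]_n) : (forall i, g_sigma_preimage coors (F i)) ->
  g_sigma_preimage coors (\bigcup_i (F i)).
Proof. exact: sigma_algebra_bigcup. Qed.

(** Generated by the coordinates, so that gluing and splitting rows are measurable one coordinate at
    a time; [measurable_open] shows that it contains the open sets. *)
HB.instance Definition _ := @isMeasurable.Build default_measure_display
  'rV[R]_n (g_sigma_preimage coors) rv_set0 rv_setC rv_bigcup.

Lemma measurable_coord (i : 'I_n) :
  measurable_fun [set: 'rV[R]_n] (fun x : 'rV[R]_n => x 0 i).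
Proof.
move=> _ Y mY; rewrite setTI; apply: sub_sigma_algebra => /=.
rewrite -bigcup_seq/=; exists i => /=; first by rewrite mem_index_enum.
by exists Y => //; rewrite setTI.
Qed.

(** The preimage of a generated sigma-algebra is generated by the preimages of the generators, so
    coordinates suffice. *)
Lemma measurable_rowP d (T : measurableType d) (f : T -> 'rV[R]_n) :
  (forall i, measurable_fun [set: T] (fun t => f t 0 i)) ->
  measurable_fun [set: T] f.
Proof.
move=> mf.
suff : (g_sigma_preimage (fun i => coors i \o f) `<=` measurable).
  rewrite g_sigma_preimage_comp => prefS.
  by move=> _ A mA; apply: prefS; exists A.
apply: smallest_sub; first exact: sigma_algebra_measurable.
move: mf; rewrite /coors; case: (n) f => [|k] f mf; first by rewrite big_ord0.
rewrite -bigcup_mkord_ord; apply: bigcup_sub => i Ii.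
by move=> A [B mB <-]; exact: mf.
Qed.

End RowVectorMeasurable.

Section LevelSets.
Context d (T : measurableType d) (R : realType).
Implicit Types f g : T -> R.

Lemma measurable_lt_set f g : measurable_fun setT f -> measurable_fun setT g ->
  measurable [set x | f x < g x].
Proof.
move=> mf mg.
have := measurable_fun_ltr mf mg measurableT (Y := [set true]) I.
rewrite setTI; congr measurable.
Qed.

Lemma measurable_le_set f g : measurable_fun setT f -> measurable_fun setT g ->
  measurable [set x | f x <= g x].
Proof.
move=> mf mg; rewrite (_ : [set x | f x <= g x] = ~` [set x | g x < f x]).
  by apply: measurableC; exact: measurable_lt_set.
by apply/seteqP; split => x /=; rewrite leNgt => /negP.
Qed.

End LevelSets.

(** * Open sets and continuous functions are measurable *)

Section RowVectorBorel.
Variable R : realType.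

(** The sup-norm ball when r > 0, written by coordinates so that it factors under [row_mx]. In
    dimension 0 it is the whole space even for r <= 0, hence the hypothesis 0 < r of
    [ball_rboxE]. *)
Definition rbox (n : nat) (c : 'rV[R]_n) (r : R) : set 'rV[R]_n :=
  [set x | forall i, `|x 0 i - c 0 i| < r].

Lemma measurable_rbox n (c : 'rV[R]_n) r : measurable (rbox c r).
Proof.
rewrite (_ : rbox c r =
    \big[setI/setT]_(i < n) [set x : 'rV[R]_n | `|x 0 i - c 0 i| < r]); last first.
  apply/seteqP; split => [x xr|x].
    by apply: (big_ind (fun A : set _ => A x)) => // i _; exact: xr.
  by move=> h i; move: h; rewrite (bigD1 i)//= => -[].
apply: big_ind => //; first exact: measurableI.
move=> i _; apply: measurable_lt_set => //.
apply: measurableT_comp => //.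
by apply: measurable_funB => //; exact: measurable_coord.
Qed.

Lemma ball_rboxE n (c : 'rV[R]_n) r : 0 < r -> ball c r = rbox c r.
Proof.
move=> r0; apply/seteqP; split => x.
  by case=> _ h i; rewrite -normrN opprB; exact: h.
by move=> h; split => // i j; rewrite ord1 /ball/= -normrN opprB; exact: h.
Qed.

Lemma open_rboxP n (U : set 'rV[R]_n) x : open U -> U x ->
  exists2 e : R, 0 < e & rbox x e `<=` U.
Proof.
move=> oU Ux; have : nbhs x U by exact: open_nbhs_nbhs.
rewrite -nbhs_ballE => -[e e0 he]; exists e => //.
by rewrite -ball_rboxE.
Qed.

(** Countably many cubes with rational centre and radius 1/(m+1) lie inside U, and they cover it. *)
Lemma measurable_open n (U : set 'rV[R]_n) : open U -> measurable U.
Proof.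
move=> oU.
pose I := ('rV[rat]_n * nat)%type.
pose cent (k : I) : 'rV[R]_n := map_mx ratr k.1.
pose B (k : I) := rbox (cent k) (k.2.+1%:R^-1).
pose D : set I := [set k | B k `<=` U].
have -> : U = \bigcup_(k in D) B k.
  apply/seteqP; split => [x Ux|x [k Dk Bx]]; last exact: Dk.
  have [e e0 he] := open_rboxP oU Ux.
  (* If the centre is within 1/(m+1) of x, the cube of radius 1/(m+1) about it stays in the cube of
     radius e about x. *)
  have [m hm] : exists m : nat, m.+1%:R^-1 < e / 2.
    have e20 : 0 < e / 2 by rewrite divr_gt0.
    exists (Num.truncn (e / 2)^-1); rewrite invf_plt ?posrE//.
    exact: truncnS_gt.
  pose r : R := m.+1%:R^-1.
  have r0 : 0 < r by rewrite invr_gt0.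
  have hq (i : 'I_n) : exists q : rat, `|x 0 i - ratr q| < r.
    have [|q] := @rat_in_itvoo R (x 0 i - r) (x 0 i + r).
      by rewrite ltrD2l gt0_cp.
    rewrite in_itv/= => /andP[h1 h2]; exists q.
    by rewrite distrC ltr_distl h1 h2.
  exists ((\row_i xchoose (hq i)), m).
    move=> y /= By; apply: he => i.
    have := By i; rewrite !mxE/= => h1.
    have h2 := xchooseP (hq i).
    apply: (@lt_trans _ _ (r + r)); last by rewrite [ltRHS]splitr ltrD.
    rewrite -(subrKA (ratr (xchoose (hq i)))).
    apply: (le_lt_trans (ler_normD _ _)); rewrite ltrD//.
    by rewrite distrC.
  by move=> i; rewrite !mxE/=; exact: (xchooseP (hq i)).
rewrite bigcup_mkcond.
apply: countable_bigcupT_measurable => [|k]; first exact: countableP.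
by case: ifPn => _ //; exact: measurable_rbox.
Qed.

Lemma continuous_measurable n (f : 'rV[R]_n -> R) :
  continuous f -> measurable_fun setT f.
Proof.
move=> cf; apply: (measurability (@RGenOpens.G R)); first exact: RGenOpens.measurableE.
move=> _ [_ [a [b ->] <-]]; rewrite setTI; apply: measurable_open.
by apply: open_comp => // x _; exact: cf.
Qed.

End RowVectorBorel.

(** * Lebesgue measure by induction on the dimension *)

Section RowLebesgue.
Variable R : realType.

Lemma measurable_row_mx n :
  measurable_fun setT (fun p : measurableTypeR R * 'rV[R]_n =>
    (row_mx (p.1%:M : 'M[R]_1) p.2 : 'rV[R]_n.+1)).
Proof.
apply: measurable_rowP => i.
case: (@splitP 1 n i) => j ij.
  have -> : i = @lshift 1 n j by exact: val_inj.
  rewrite (_ : (fun _ => _) = fst); first exact: measurable_fst.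
  by apply/funext => p; rewrite (@row_mxEl _ 1 1 n) !ord1 mxE mulr1n.
have -> : i = @rshift 1 n j by exact: val_inj.
rewrite (_ : (fun _ => _) = (fun v : 'rV[R]_n => v 0 j) \o snd).
  by apply: measurableT_comp => //; exact: measurable_coord.
by apply/funext => p; rewrite (@row_mxEr _ 1 1 n).
Qed.

Lemma measurable_row_split n :
  measurable_fun setT (fun v : 'rV[R]_n.+1 =>
    (v 0 0 : measurableTypeR R, @rsubmx R 1 1 n v)).
Proof.
apply/measurable_fun_pairP; split; first exact: measurable_coord.
apply: measurable_rowP => i /=.
rewrite (_ : (fun _ => _) = (fun v : 'rV[R]_n.+1 => v 0 (@rshift 1 n i))).
  exact: measurable_coord.
by apply/funext => v; rewrite mxE.
Qed.

Lemma row_mx_split n (v : 'rV[R]_n.+1) :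
  row_mx ((v 0 0)%:M : 'M[R]_1) (@rsubmx R 1 1 n v) = v.
Proof.
rewrite -[RHS](@hsubmxK _ 1 1 n); congr row_mx.
by apply/rowP => i; rewrite !mxE ord1 mulr1n; congr (v _ _); exact: val_inj.
Qed.

Lemma split_row_mx n (s : R) (v : 'rV[R]_n) :
  let w : 'rV[R]_n.+1 := row_mx (s%:M : 'M[R]_1) v in
  (w 0 0, @rsubmx R 1 1 n w) = (s, v).
Proof.
move=> w; congr pair; last by rewrite /w row_mxKr.
rewrite /w (_ : (0 : 'I_n.+1) = @lshift 1 n 0); last exact: val_inj.
by rewrite (@row_mxEl _ 1 1 n) mxE mulr1n.
Qed.

Section Step.
Variables (n : nat) (M : {sigma_finite_measure set 'rV[R]_n -> \bar R}).

Let glue (p : measurableTypeR R * 'rV[R]_n) : 'rV[R]_n.+1 :=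
  row_mx (p.1%:M : 'M[R]_1) p.2.

Let mglue : measurable_fun setT glue.
Proof. exact: measurable_row_mx. Qed.

(** The product of the line with M, transported to rows. Sigma-finiteness is carried through the
    induction because the next product and Tonelli rest on it. *)
Definition leb_step : set 'rV[R]_n.+1 -> \bar R :=
  pushforward (@lebesgue_measure R \x M)%E glue.

Let leb_step0 : leb_step set0 = 0%E.
Proof. by rewrite /leb_step /pushforward preimage_set0 measure0. Qed.

Let leb_step_ge0 A : (0 <= leb_step A)%E.
Proof. by rewrite /leb_step /pushforward. Qed.

Let leb_step_sigma_additive : semi_sigma_additive leb_step.
Proof.
move=> F mF tF mUF.
rewrite /leb_step /pushforward preimage_bigcup.
apply: measure_semi_sigma_additive => //.
- by move=> k; rewrite -[X in measurable X]setTI; exact: mglue.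
- apply/trivIsetP => i j _ _ ij; rewrite -preimage_setI.
  by move/trivIsetP : tF => /(_ i j I I ij) ->; rewrite preimage_set0.
- by rewrite -preimage_bigcup -[X in measurable X]setTI; exact: mglue.
Qed.

HB.instance Definition _ := isMeasure.Build _ _ _ leb_step
  leb_step0 leb_step_ge0 leb_step_sigma_additive.

Let leb_step_sigma_finite : sigma_finite setT leb_step.
Proof.
have /sigma_finiteP[F [TF ndF Foo]] := sigma_finiteT (@lebesgue_measure R).
have /sigma_finiteP[G [TG ndG Goo]] := sigma_finiteT M.
pose psi (v : 'rV[R]_n.+1) : measurableTypeR R * 'rV[R]_n := (v 0 0, @rsubmx R 1 1 n v).
(* Rectangles with sides of finite measure, pulled back by the inverse of [glue]. Both exhaustions
   are monotone, so one index serves both factors. *)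
exists (fun k => psi @^-1` (F k `*` G k)).
  rewrite -preimage_bigcup (_ : \bigcup_k _ = setT) ?preimage_setT//.
  rewrite -setXTT TF TG predeqE => -[x y]; split.
    by move=> [k _ []/= ? ?]; split; exists k.
  move=> [/= [i _ Fnx] [k _ Gky]]; exists (maxn i k) => //; split.
  - by move: x Fnx; exact/subsetPset/ndF/leq_maxl.
  - by move: y Gky; exact/subsetPset/ndG/leq_maxr.
move=> k; have [? ?] := Foo k; have [? ?] := Goo k; split.
  rewrite -[X in measurable X]setTI; apply: measurable_row_split => //.
  exact: measurableX.
rewrite /leb_step /pushforward.
rewrite (_ : glue @^-1` _ = F k `*` G k); last first.
  by apply/seteqP; split => -[s v];
    rewrite /= /psi /glue/=; case: (split_row_mx s v) => -> ->.
by rewrite product_measure1E// lte_mul_pinfty// ge0_fin_numE.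
Qed.

HB.instance Definition _ := @Measure_isSigmaFinite.Build _ _ _
  leb_step leb_step_sigma_finite.

End Step.

(** The Dirac mass in dimension 0 matches the base case of [leb_int], which is evaluation at the
    only point. *)
Fixpoint lebM (n : nat) : {sigma_finite_measure set 'rV[R]_n -> \bar R} :=
  match n with
  | 0 => [the {sigma_finite_measure set 'rV[R]_0 -> \bar R} of \d_(0 : 'rV[R]_0)]
  | n'.+1 => [the {sigma_finite_measure set 'rV[R]_n'.+1 -> \bar R} of leb_step (lebM n')]
  end.

Local Open Scope ereal_scope.

Lemma ge0_integral_lebMS n (f : 'rV[R]_n.+1 -> \bar R) :
  measurable_fun setT f -> (forall x, 0 <= f x) ->
  \int[lebM n.+1]_x f x =
  \int[(@lebesgue_measure R \x lebM n)]_p f (row_mx (p.1%:M : 'M[R]_1) p.2).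
Proof.
move=> mf f0; rewrite [LHS](@ge0_integral_pushforward _ _ _ _ R _ (@measurable_row_mx n)
  (@lebesgue_measure R \x lebM n) setT f)//.
Qed.

Lemma integral_lebMS n (f : 'rV[R]_n.+1 -> \bar R) :
  measurable_fun setT f ->
  (@lebesgue_measure R \x lebM n)%E.-integrable setT
     (fun p => f (row_mx (p.1%:M : 'M[R]_1) p.2)) ->
  \int[lebM n.+1]_x f x =
  \int[(@lebesgue_measure R \x lebM n)]_p f (row_mx (p.1%:M : 'M[R]_1) p.2).
Proof.
move=> mf fi.
rewrite [LHS](@integral_pushforward _ _ _ _ R _ (@measurable_row_mx n)
  (@lebesgue_measure R \x lebM n) setT f)//.
Qed.

End RowLebesgue.

(** * The iterated integral as an integral against [lebM] *)

Section LebInt.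
Variable R : realType.
Local Open Scope ereal_scope.

Lemma measurable_row_mx2 n (s : R) :
  measurable_fun setT (fun v : 'rV[R]_n => (row_mx (s%:M : 'M[R]_1) v : 'rV[R]_n.+1)).
Proof.
have := measurableT_comp (@measurable_row_mx R n) (@pair1_measurable _ _ (measurableTypeR R) 'rV[R]_n s).
exact.
Qed.

Lemma ge0_integral_lebMS_iter n (f : 'rV[R]_n.+1 -> \bar R) :
  measurable_fun setT f -> (forall x, 0 <= f x) ->
  \int[lebM R n.+1]_x f x =
  \int[@lebesgue_measure R]_s \int[lebM R n]_v f (row_mx (s%:M : 'M[R]_1) v).
Proof.
move=> mf f0; rewrite ge0_integral_lebMS// fubini_tonelli1//.
exact: measurableT_comp mf (@measurable_row_mx R n).
Qed.

Lemma ge0_leb_intE n (f : 'rV[R]_n -> \bar R) :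
  measurable_fun setT f -> (forall x, 0 <= f x) ->
  leb_int f = \int[lebM R n]_x f x.
Proof.
elim: n f => [|n IH] f mf f0.
  by rewrite /= [RHS](@integral_dirac _ 'rV[R]_0)// diracT mul1e.
rewrite ge0_integral_lebMS_iter//=.
apply: eq_integral => s _; rewrite IH//.
exact: measurableT_comp mf (measurable_row_mx2 s).
Qed.

Lemma rbox_row_mx n (r s : R) (v : 'rV[R]_n) :
  rbox 0 r (row_mx (s%:M : 'M[R]_1) v : 'rV[R]_n.+1) <-> (`|s| < r)%R /\ rbox 0 r v.
Proof.
split=> [h|[hs hv] i].
  split.
    by have := h (@lshift 1 n ord0); rewrite (@row_mxEl _ 1 1 n) !mxE mulr1n subr0.
  by move=> i; have := h (@rshift 1 n i); rewrite (@row_mxEr _ 1 1 n) !mxE.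
case: (@splitP 1 n i) => j ij.
  have -> : i = @lshift 1 n j by exact: val_inj.
  by rewrite (@row_mxEl _ 1 1 n) !ord1 !mxE mulr1n subr0.
have -> : i = @rshift 1 n j by exact: val_inj.
by have := hv j; rewrite (@row_mxEr _ 1 1 n) !mxE.
Qed.

Lemma lebM_rbox n (r : R) : (0 < r)%R -> lebM R n (rbox 0 r) = ((2 * r) ^+ n)%:E.
Proof.
move=> r0; rewrite -[rbox 0 r]setIT -integral_indic//; last exact: measurable_rbox.
elim: n => [|n IH].
  rewrite [LHS](@integral_dirac _ 'rV[R]_0)//; last first.
    by apply/measurable_EFinP; apply: measurable_indic; exact: measurable_rbox.
  by rewrite diracT mul1e expr0 indicE mem_set// => -[].
rewrite ge0_integral_lebMS_iter//; last first.
  by apply/measurable_EFinP; apply: measurable_indic; exact: measurable_rbox.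
under eq_integral => s _.
  rewrite (_ : \int[_]_v _ = (\1_(ball (0%R : R) r) s)%:E * ((2 * r) ^+ n)%:E); last first.
    rewrite -IH -ge0_integralZl//; last first.
      by apply/measurable_EFinP; apply: measurable_indic; exact: measurable_rbox.
    apply: eq_integral => v _; rewrite -EFinM; congr EFin.
    rewrite !indicE; apply/esym; case: (ltP `|s|%R r) => h1; last first.
      rewrite [X in ((nat_of_bool X)%:R * _)%R]memNset ?mul0r; last first.
        by rewrite /= -ball_normE /ball_/= sub0r normrN ltNge h1.
      by rewrite memNset// => /rbox_row_mx[]; rewrite ltNge h1.
    rewrite [X in ((nat_of_bool X)%:R * _)%R]mem_set ?mul1r; last first.
      by rewrite /= -ball_normE /ball_/= sub0r normrN.
    have [h2|h2] := boolP (v \in rbox 0 r).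
      by rewrite mem_set//; apply/rbox_row_mx; rewrite inE in h2.
    by rewrite memNset// => /rbox_row_mx[_ hv]; move: h2; rewrite mem_set.
  over.
rewrite ge0_integralZr//; last 2 first.
- by apply/measurable_EFinP; apply: measurable_indic; exact: measurable_ball.
- by rewrite lee_fin exprn_ge0// mulr_ge0// ltW.
rewrite integral_indic ?setIT//; last exact: measurable_ball.
rewrite [X in X * _](_ : _ = (r *+ 2)%:E); last exact: lebesgue_measure_ball (ltW r0).
by rewrite -EFinM exprS mulr_natl.
Qed.

Lemma bounded_integrable d (T : measurableType d) (mu : {measure set T -> \bar R})
    (D : set T) (f : T -> R) (C : R) :
  measurable D -> mu D < +oo -> measurable_fun D f ->
  (forall x, D x -> `|f x| <= C)%R -> mu.-integrable D (EFin \o f).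
Proof.
move=> mD Doo mf fC; apply: (@le_integrable _ _ _ mu D mD _ (EFin \o cst C)).
- exact/measurable_EFinP.
- move=> x Dx /=; rewrite lee_fin; apply: (le_trans (fC _ Dx)).
  exact: ler_norm.
- apply/integrableP; split; first exact/measurable_EFinP.
  rewrite (_ : (fun _ => _) = cst `|C|%:E)//.
  by rewrite integral_cst// lte_mul_pinfty// ?lee_fin.
Qed.

Lemma box_integrable n (f : 'rV[R]_n -> R) (C r : R) :
  measurable_fun setT f -> (forall x, `|f x| <= C)%R -> (0 < r)%R ->
  (forall x, ~ rbox 0 r x -> f x = 0%R) ->
  (lebM R n).-integrable setT (EFin \o f).
Proof.
move=> mf fC r0 fr.
have mB := measurable_rbox (0 : 'rV[R]_n) r.
have -> : EFin \o f = (EFin \o f) \_ (rbox 0 r).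
  apply/funext => x; rewrite patchE; case: ifPn => // /negP xr /=.
  by rewrite fr// => xr'; apply: xr; rewrite inE.
apply/(integrable_mkcond _ mB); apply: (@bounded_integrable _ _ _ _ _ C) => //.
- by rewrite [ltLHS](lebM_rbox n r0) ltry.
- exact: measurable_funTS.
Qed.

(** For a signed integrand Fubini asks for integrability, which boundedness and support in a cube
    provide. Both properties pass to slices with the same C and r, so the induction closes. *)
Lemma leb_intE n (f : 'rV[R]_n -> R) (C r : R) :
  measurable_fun setT f -> (forall x, `|f x| <= C)%R -> (0 < r)%R ->
  (forall x, ~ rbox 0 r x -> f x = 0%R) ->
  leb_int (fun x => (f x)%:E) = \int[lebM R n]_x (f x)%:E.
Proof.
move=> + + r0; elim: n f => [|n IH] f mf fC fr.
  rewrite /= [RHS](@integral_dirac _ 'rV[R]_0)// ?diracT ?mul1e//.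
  exact/measurable_EFinP.
have mf' : measurable_fun setT (fun p : measurableTypeR R * 'rV[R]_n =>
    (f (row_mx (p.1%:M : 'M[R]_1) p.2))%:E).
  by apply/measurable_EFinP; exact: measurableT_comp mf (@measurable_row_mx R n).
have fi : (@lebesgue_measure R \x lebM R n).-integrable setT
     (fun p : measurableTypeR R * 'rV[R]_n => (f (row_mx (p.1%:M : 'M[R]_1) p.2))%:E).
  have := box_integrable mf fC r0 fr.
  move=> /integrableP[_]; rewrite ge0_integral_lebMS//.
    by move=> fi; apply/integrableP; split.
  by apply: measurableT_comp => //; exact/measurable_EFinP.
rewrite integral_lebMS//; last exact/measurable_EFinP.
rewrite -integral12_prod_meas1//=.
apply: eq_integral => s _; rewrite /fubini_F IH//.
- exact: measurableT_comp mf (measurable_row_mx2 s).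
- by move=> v vr; apply: fr => /rbox_row_mx[].
Qed.

End LebInt.

(** * Linear changes of variables *)

Section LinearChange.
Variable R : realType.
Local Open Scope ereal_scope.
Notation leb := (@lebesgue_measure R).

Lemma measurable_affine (a b : R) :
  measurable_fun (setT : set (measurableTypeR R)) (fun s : measurableTypeR R => (a * s + b)%R : measurableTypeR R).
Proof. by apply: measurable_funD => //; exact: measurable_funM. Qed.

Lemma lebesgue_affine_itv (a b x y : R) : a != 0%R -> (x < y)%R ->
  `|a|%:E * leb ((fun s => a * s + b)%R @^-1` `]x, y]%classic) = (y - x)%:E.
Proof.
move=> a0 xy; have [an|ap|/eqP] := ltgtP a 0%R; last by rewrite (negbTE a0).
  rewrite (_ : _ @^-1` _ = `[(y - b) / a, (x - b) / a[%classic)%R; last first.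
    apply/seteqP; split => s /=; rewrite !in_itv/= => /andP[h1 h2]; apply/andP; split.
    - by rewrite ler_ndivrMr// mulrC; lra.
    - by rewrite ltr_ndivlMr// mulrC; lra.
    - by move: h2; rewrite ltr_ndivlMr// mulrC; lra.
    - by move: h1; rewrite ler_ndivrMr// mulrC; lra.
  rewrite lebesgue_measure_itv/= lte_fin ltr_nM2r ?invr_lt0// ltrD2r xy.
  rewrite -EFinD -EFinM ltr0_norm//; congr EFin.
  by field.
rewrite (_ : _ @^-1` _ = `](x - b) / a, (y - b) / a]%classic)%R; last first.
  apply/seteqP; split => s /=; rewrite !in_itv/= => /andP[h1 h2]; apply/andP; split.
  - by rewrite ltr_pdivrMr// mulrC; lra.
  - by rewrite ler_pdivlMr// mulrC; lra.
  - by move: h1; rewrite ltr_pdivrMr// mulrC; lra.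
  - by move: h2; rewrite ler_pdivlMr// mulrC; lra.
rewrite lebesgue_measure_itv/= lte_fin ltr_pM2r ?invr_gt0// ltrD2r xy.
rewrite -EFinD -EFinM gtr0_norm//; congr EFin.
by field.
Qed.

(** [|a|] times the image of Lebesgue measure under the affine map agrees with Lebesgue measure on
    half-open intervals, hence everywhere by uniqueness. *)
Lemma ge0_integral_affine (a b : R) (f : R -> \bar R) : a != 0%R ->
  measurable_fun setT f -> (forall x, 0 <= f x) ->
  `|a|%:E * \int[leb]_s f (a * s + b)%R = \int[leb]_s f s.
Proof.
move=> a0 mf f0.
have k0 : (0 <= `|a|)%R by [].
pose nu0 := measure_function_pushforward__canonical__measure_function_Measure
  leb (measurable_affine a b).
pose nu := mscale (NngNum k0) nu0.
have -> : \int[leb]_s f s = \int[nu]_s f s.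
  apply: eq_measure_integral => A mA _.
  apply: lebesgue_measure_unique => //= X /ocitvP[->|[[x y] /= xy ->]].
    by rewrite /nu !measure0.
  rewrite lebesgue_measure_itv/= lte_fin xy -EFinD.
  by rewrite /nu /mscale/= /pushforward lebesgue_affine_itv.
rewrite ge0_integral_mscale// ge0_integral_pushforward//.
exact: measurable_affine.
Qed.

Lemma measurable_linear n m (A : 'M[R]_(n, m)) (c : 'rV[R]_m) :
  measurable_fun setT (fun x : 'rV[R]_n => (x *m A + c)%R).
Proof.
apply: measurable_rowP => i.
rewrite (_ : (fun _ => _) = (fun x : 'rV[R]_n => \sum_j x ord0 j * A j i + c ord0 i)%R).
  apply: measurable_funD => //; apply: measurable_sum => j.
  by apply: measurable_funM => //; exact: measurable_coord.
by apply/funext => x; rewrite !mxE.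
Qed.

Lemma measurable_addr n (c : 'rV[R]_n) :
  measurable_fun setT (fun x : 'rV[R]_n => (x + c)%R).
Proof.
rewrite (_ : (fun _ => _) = (fun x => x *m 1%:M + c)%R).
  exact: measurable_linear.
by apply/funext => x; rewrite mulmx1.
Qed.

Lemma measurable_mulmxr n m (A : 'M[R]_(n, m)) :
  measurable_fun setT (fun x : 'rV[R]_n => x *m A).
Proof.
rewrite (_ : (fun _ => _) = (fun x => x *m A + 0)%R).
  exact: measurable_linear.
by apply/funext => x; rewrite addr0.
Qed.

Lemma ge0_integral_lebM_shift n (c : 'rV[R]_n) (f : 'rV[R]_n -> \bar R) :
  measurable_fun setT f -> (forall x, 0 <= f x) ->
  \int[lebM R n]_x f (x + c)%R = \int[lebM R n]_x f x.
Proof.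
elim: n c f => [|n IH] c f mf f0.
  by apply: eq_integral => x _; congr f; apply/rowP => -[].
have mfc : measurable_fun setT (fun x : 'rV[R]_n.+1 => f (x + c)%R).
  exact: measurableT_comp mf (measurable_addr c).
rewrite (ge0_integral_lebMS_iter mf f0) (ge0_integral_lebMS_iter mfc (fun x => f0 _)).
pose g s := \int[lebM R n]_v f (row_mx (s%:M : 'M[R]_1) v).
transitivity (\int[leb]_s g (1 * s + c ord0 ord0)%R).
  apply: eq_integral => s _; rewrite /g.
  rewrite -(IH (@rsubmx R 1 1 n c)
      (fun w => f (row_mx (1 * s + c ord0 ord0)%:M%R w)))//; last first.
    exact: measurableT_comp mf (measurable_row_mx2 _).
  apply: eq_integral => v _; congr f.
  have /= := @add_row_mx R 1 1 n s%:M%R v (c ord0 ord0)%:M%R (@rsubmx R 1 1 n c).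
  by rewrite -raddfD mul1r => <-; congr (_ + _)%R; rewrite row_mx_split.
rewrite -[RHS](@ge0_integral_affine 1 (c ord0 ord0) g) ?oner_neq0//.
- by rewrite normr1 mul1e.
- apply: (@measurable_fun_fubini_tonelli_F _ _ _ _ R (lebM R n)
    (fun p : measurableTypeR R * 'rV[R]_n => f (row_mx (p.1%:M : 'M[R]_1) p.2))) => //.
  exact: measurableT_comp mf (@measurable_row_mx R n).
- by move=> s; exact: integral_ge0.
Qed.

(** Stated for all nonnegative integrands and not for sets, so that it composes and applies to
    slices of a function. *)
Definition changes_leb n (A : 'M[R]_n) := forall f : 'rV[R]_n -> \bar R,
  measurable_fun setT f -> (forall x, 0 <= f x) ->
  `|\det A|%:E * \int[lebM R n]_x f (x *m A) = \int[lebM R n]_x f x.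

Lemma changes_leb1 n : changes_leb (1%:M : 'M[R]_n).
Proof.
move=> f mf f0; rewrite det1 normr1 mul1e.
by apply: eq_integral => x _; rewrite mulmx1.
Qed.

Lemma changes_lebM n (A B : 'M[R]_n) :
  changes_leb A -> changes_leb B -> changes_leb (A *m B).
Proof.
move=> hA hB f mf f0.
rewrite -[RHS]hB//; have /= <- := hA (fun x => f (x *m B)); last first.
- by move=> x; exact: f0.
- exact: measurableT_comp mf (measurable_mulmxr B).
rewrite det_mulmx normrM EFinM muleA [X in X * _]muleC; congr (_ * _).
by apply: eq_integral => x _; rewrite mulmxA.
Qed.

Lemma measurable_mulmx n (f : 'rV[R]_n -> \bar R) (A : 'M[R]_n) :
  measurable_fun setT f -> measurable_fun setT (fun x : 'rV[R]_n => f (x *m A)).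
Proof.
by move=> mf; exact: measurableT_comp mf (measurable_mulmxr A).
Qed.

(** The row (s, v) goes to (a s, v D + s b): for fixed s the inner integral sees D and a
    translation, and the outer one sees a dilation. *)
Lemma changes_leb_ublock n (a : R) (b : 'rV[R]_n) (D : 'M[R]_n) :
  a != 0%R -> changes_leb D ->
  changes_leb (block_mx (a%:M : 'M[R]_1) b 0%R D : 'M[R]_n.+1).
Proof.
move=> a0 hD f mf f0.
rewrite (@det_ublock _ 1 n) det_scalar1 normrM EFinM.
rewrite (ge0_integral_lebMS_iter mf f0).
rewrite (ge0_integral_lebMS_iter (measurable_mulmx _ mf) (fun x => f0 _)).
pose g s := \int[lebM R n]_v f (row_mx (s%:M : 'M[R]_1) v).
have mg : measurable_fun setT g.
  apply: (@measurable_fun_fubini_tonelli_F _ _ _ _ R (lebM R n)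
    (fun p : measurableTypeR R * 'rV[R]_n => f (row_mx (p.1%:M : 'M[R]_1) p.2))) => //.
  exact: measurableT_comp mf (@measurable_row_mx R n).
rewrite -[RHS](ge0_integral_affine 0 a0 mg (fun s => integral_ge0 _ (fun v _ => f0 _))).
rewrite -muleA; congr (_ * _).
rewrite -ge0_integralZl//; last 2 first.
- apply: (@measurable_fun_fubini_tonelli_F _ _ _ _ R (lebM R n)
    (fun p : measurableTypeR R * 'rV[R]_n => f (row_mx (p.1%:M : 'M[R]_1) p.2 *m
       (block_mx (a%:M : 'M[R]_1) b 0%R D : 'M[R]_n.+1)))) => //.
  exact: measurableT_comp (measurable_mulmx _ mf) (@measurable_row_mx R n).
- by move=> s _; exact: integral_ge0.
apply: eq_integral => s _.
under eq_integral => v _.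
  rewrite (_ : _ *m _ = row_mx ((a * s)%:M : 'M[R]_1) (v *m D + s *: b)%R); last first.
    rewrite (@mul_row_block _ 1 1 n 1 n) mulmx0 addr0 -scalar_mxM mulrC.
    by rewrite mul_scalar_mx addrC.
  over.
rewrite (hD (fun w => f (row_mx (a * s)%:M (w + s *: b)%R)))//; last first.
  exact: measurableT_comp (measurableT_comp mf (measurable_row_mx2 (a * s)%R))
    (measurable_addr (s *: b)%R).
rewrite (ge0_integral_lebM_shift (s *: b)%R (f := fun w => f (row_mx (a * s)%:M w)))//.
  by rewrite /g addr0.
exact: (measurableT_comp mf (measurable_row_mx2 (a * s)%R)).
Qed.

(** The row (s, v) goes to (s + v c, v): a translation of the first coordinate for fixed v, so
    Tonelli is used with v outermost. *)
Lemma changes_leb_lblock n (c : 'cV[R]_n) :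
  changes_leb (block_mx (1%:M : 'M[R]_1) 0%R c 1%:M : 'M[R]_n.+1).
Proof.
move=> f mf f0.
rewrite (@det_lblock _ 1 n) !det1 mulr1 normr1 mul1e.
rewrite (ge0_integral_lebMS_iter mf f0).
rewrite (ge0_integral_lebMS_iter (measurable_mulmx _ mf) (fun x => f0 _)).
have mf2 := measurableT_comp mf (@measurable_row_mx R n).
have mf3 := measurableT_comp (measurable_mulmx
  (block_mx (1%:M : 'M[R]_1) 0%R c 1%:M : 'M[R]_n.+1) mf) (@measurable_row_mx R n).
rewrite [RHS](@fubini_tonelli _ _ _ _ R leb (lebM R n) _ mf2 (fun p => f0 _)).
rewrite [LHS](@fubini_tonelli _ _ _ _ R leb (lebM R n) _ mf3 (fun p => f0 _)).
apply: eq_integral => v _.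
rewrite -[RHS](@ge0_integral_affine 1 ((v *m c) ord0 ord0)
  (fun s => f (row_mx (s%:M : 'M[R]_1) v))) ?oner_neq0//; last first.
  by have := measurableT_comp mf2 (@pair2_measurable _ _ (measurableTypeR R) 'rV[R]_n v); exact.
rewrite normr1 mul1e; apply: eq_integral => s _; congr f.
rewrite (@mul_row_block _ 1 1 n 1 n) mulmx0 add0r !mulmx1/=.
rewrite (_ : s%:M + v *m c = (1 * s + (v *m c) ord0 ord0)%:M)%R//.
by apply/rowP => i; rewrite !ord1 !mxE ?mulr1n mul1r.
Qed.

(* Block elimination: a nonzero corner entry a splits the matrix into a lower and an
   upper block factor; otherwise a transvection first makes the corner nonzero. *)
Lemma unitmx_changes_leb n (A : 'M[R]_n) : A \in unitmx -> changes_leb A.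
Proof.
elim: n A => [|n IH] A uA.
  by rewrite (_ : A = 1%:M); [exact: changes_leb1|apply/matrixP => -[]].
have pivot (a : R) (b : 'rV[R]_n) (c : 'cV[R]_n) (D : 'M[R]_n) :
    (block_mx (a%:M : 'M[R]_1) b c D : 'M[R]_(1 + n)) \in unitmx -> a != 0%R ->
    changes_leb (block_mx (a%:M : 'M[R]_1) b c D : 'M[R]_n.+1).
  move=> uB a0.
  have BE : block_mx (a%:M : 'M[R]_1) b c D = block_mx (1%:M : 'M[R]_1) 0%R (a^-1 *: c)%R 1%:M
      *m block_mx (a%:M : 'M[R]_1) b 0%R (D - a^-1 *: (c *m b))%R :> 'M[R]_(1 + n).
    rewrite mulmx_block !mul1mx !mul0mx !addr0 mul_mx_scalar scalerA divff// scale1r.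
    by rewrite -scalemxAl addrC subrK.
  move: uB; rewrite BE unitmx_mul => /andP[_].
  rewrite unitmxE (@det_ublock _ 1 n) unitrM => /andP[_ uD].
  apply: changes_lebM; first exact: changes_leb_lblock.
  by apply: changes_leb_ublock => //; apply: IH; rewrite unitmxE.
have [a [b [c [D defA]]]] : exists a b c D,
    A = block_mx (a%:M : 'M[R]_1) b c D :> 'M[R]_(1 + n).
  exists (@ulsubmx _ 1 n 1 n A ord0 ord0), (@ursubmx _ 1 n 1 n A),
    (@dlsubmx _ 1 n 1 n A), (@drsubmx _ 1 n 1 n A).
  by rewrite -[LHS](@submxK _ 1 n 1 n A) -mx11_scalar.
have uA' := uA; rewrite defA in uA' *.
have [a0|a0] := eqVneq a 0%R; last exact: pivot.
have [j cj] : exists j, c j ord0 != 0%R.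
  apply/existsP; apply: contraLR uA' => /existsPn c0.
  have -> : c = 0%R.
    by apply/colP => i; rewrite mxE; apply/eqP; move: (c0 i); rewrite negbK.
  by rewrite unitmxE (@det_ublock _ 1 n) a0 det_scalar1 mul0r unitr0.
pose w : 'rV[R]_n := delta_mx ord0 j.
have TK : (block_mx (1%:M : 'M[R]_1) (- w)%R 0%R 1%:M : 'M[R]_(1 + n)) *m
    block_mx (1%:M : 'M[R]_1) w 0%R 1%:M = 1%:M.
  rewrite mulmx_block ?mul1mx !mulmx1 !mulmx0 !mul0mx !addr0 !add0r subrr.
  by rewrite -scalar_mx_block.
rewrite -[block_mx _ _ _ _]mul1mx -TK -mulmxA.
apply: changes_lebM.
  by apply: (@changes_leb_ublock n 1%R); [exact: oner_neq0|exact: changes_leb1].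
have TA : (block_mx (1%:M : 'M[R]_1) w 0%R 1%:M : 'M[R]_(1 + n)) *m
    block_mx (a%:M : 'M[R]_1) b c D = block_mx ((c j ord0)%:M : 'M[R]_1) (b + w *m D)%R c D.
  rewrite mulmx_block !mul1mx !mul0mx !add0r a0; congr block_mx.
  apply/matrixP => i k; rewrite !ord1 !mxE (bigD1 j)//= !mxE !eqxx mul1r mul0rn add0r.
  by rewrite big1 ?addr0 ?mulr1n// => l lj; rewrite !mxE (negbTE lj) andbF mul0r.
rewrite TA; apply: pivot => //; rewrite -TA unitmx_mul uA' andbT.
by rewrite unitmxE (@det_ublock _ 1 n) !det1 mulr1 unitr1.
Qed.

(** Positive and negative parts are transported separately. The factor distributes over their
    difference because the transported negative part is finite, which follows from \det A != 0. *)
Lemma integral_unitmx n (A : 'M[R]_n) (f : 'rV[R]_n -> \bar R) :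
  A \in unitmx -> (lebM R n).-integrable setT f ->
  `|\det A|%:E * \int[lebM R n]_x f (x *m A) = \int[lebM R n]_x f x.
Proof.
move=> uA fi; have cA := unitmx_changes_leb uA.
have mf := measurable_int _ fi.
rewrite [RHS]integralE -(cA f^\+)//; last exact: measurable_funepos.
have := integrable_neg_fin_num measurableT fi.
rewrite -(cA f^\-)//; last exact: measurable_funeneg.
move=> fn; rewrite integralE -muleBr//.
  by congr (_ * (_ - _)); apply: eq_integral => x _; rewrite ?funeposE ?funenegE.
apply: fin_num_adde_defl; rewrite fin_numN.
have d0 : `|\det A|%R != 0%R by rewrite normr_eq0 -unitfE -unitmxE.
rewrite -[X in X \is a _]mul1e -(mulVf d0) EFinM -muleA fin_numM//.
Qed.

End LinearChange.

(** * Matrix exponentials *)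

Section RealDerivatives.
Variable R : realType.
Implicit Types (f g : R -> R) (x a b : R).

Lemma derD f g x a b : is_derive x 1 f a -> is_derive x 1 g b ->
  is_derive x 1 (fun y => f y + g y) (a + b).
Proof. by move=> hf hg; exact: is_deriveD. Qed.

Lemma derB f g x a b : is_derive x 1 f a -> is_derive x 1 g b ->
  is_derive x 1 (fun y => f y - g y) (a - b).
Proof. by move=> hf hg; exact: is_deriveB. Qed.

Lemma derN f x a : is_derive x 1 f a -> is_derive x 1 (fun y => - f y) (- a).
Proof. by move=> hf; exact: is_deriveN. Qed.

Lemma derM f g x a b : is_derive x 1 f a -> is_derive x 1 g b ->
  is_derive x 1 (fun y => f y * g y) (a * g x + f x * b).
Proof.
move=> hf hg; apply: (@is_derive_eq _ _ _ (f * g)).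
by rewrite /GRing.scale/= addrC [g x * a]mulrC.
Qed.

Lemma derZ (k : R) f x a : is_derive x 1 f a -> is_derive x 1 (fun y => k * f y) (k * a).
Proof. by move=> hf; exact: is_deriveZ. Qed.

Lemma derC (k x : R) : is_derive x 1 (fun _ : R => k) 0.
Proof. exact: is_derive_cst. Qed.

Lemma derI (x : R) : is_derive x 1 (fun y : R => y) 1.
Proof. exact: is_derive_id. Qed.

Lemma derV f x a : f x != 0 -> is_derive x 1 f a ->
  is_derive x 1 (fun y => (f y)^-1) (- (a / (f x) ^+ 2)).
Proof.
move=> fx hf; apply: is_derive_eq (is_deriveV fx hf) _.
by rewrite /GRing.scale/= mulrC mulrN.
Qed.

Lemma der_comp f g x a b : is_derive (g x) 1 f a -> is_derive x 1 g b ->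
  is_derive x 1 (fun y => f (g y)) (b * a).
Proof.
by move=> hf hg; apply: (is_derive_eq (is_derive1_comp hf hg)); rewrite mulrC.
Qed.

Lemma der_sum (I : Type) (r : seq I) (h : I -> R -> R) x (dh : I -> R) :
  (forall i, is_derive x 1 (h i) (dh i)) ->
  is_derive x 1 (fun y => \sum_(i <- r) h i y) (\sum_(i <- r) dh i).
Proof.
move=> hh; elim: r => [|i r IH].
  rewrite big_nil (_ : (fun _ => _) = fun=> 0); first exact: derC.
  by apply/funext => y; rewrite big_nil.
rewrite big_cons (_ : (fun _ => _) = fun y => h i y + \sum_(i <- r) h i y).
  exact: derD.
by apply/funext => y; rewrite big_cons.
Qed.

Lemma der_eq f x a b : is_derive x 1 f a -> a = b -> is_derive x 1 f b.
Proof. by move=> hf <-. Qed.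

Lemma der_continuous f x a : is_derive x 1 f a -> {for x, continuous f}.
Proof. by move=> hf; apply/differentiable_continuous/derivable1_diffP. Qed.

Lemma der_MVT_bound f (df : R -> R) (a b C : R) : a <= b ->
  (forall x, a <= x <= b -> is_derive x 1 f (df x)) ->
  (forall x, a <= x <= b -> `|df x| <= C) ->
  `|f b - f a| <= C * (b - a).
Proof.
move=> ab fd dC.
have [||c + ->] := @MVT_segment _ f df a b ab.
- by move=> x; rewrite in_itv/= => /andP[/ltW ax /ltW xb]; apply: fd; rewrite ax.
- apply: continuous_in_subspaceT => x; rewrite inE/= in_itv/= => axb.
  exact: der_continuous (fd x axb).
rewrite in_itv/= => acb.
by rewrite normrM [`|b - a|]ger0_norm ?subr_ge0// ler_wpM2r ?subr_ge0// dC.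
Qed.

End RealDerivatives.

Section MatrixExp.
Variables (R : realType) (d : nat).
Implicit Types (A B : 'M[R]_d) (s t : R).

Lemma cvg_mx (T : Type) (G : set_system T) m n (u : T -> 'M[R]_(m, n))
    (l : 'M[R]_(m, n)) : Filter G ->
  (forall i j, (fun k => u k i j) @ G --> l i j) -> u @ G --> l.
Proof.
move=> FG h; apply/cvg_ballP => e e0.
have : \forall k \near G, forall ij : 'I_m * 'I_n,
    ball (l ij.1 ij.2) e (u k ij.1 ij.2).
  by apply: filter_forall => ij; move/cvg_ballP: (h ij.1 ij.2); apply.
by apply: filterS => k hk; split => // i j; exact: (hk (i, j)).
Qed.

(** It dominates the absolute row sums, hence its k-th power dominates the entries of A^k; this
    compares the matrix series with a scalar exponential series. *)
Definition mxsize A : R := 1 + \sum_i \sum_j `|A i j|.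

Lemma mxsize_ge1 A : 1 <= mxsize A.
Proof. by rewrite /mxsize lerDl sumr_ge0// => i _; rewrite sumr_ge0. Qed.

Lemma mxsize_ge0 A : 0 <= mxsize A.
Proof. exact: le_trans ler01 (mxsize_ge1 A). Qed.

Lemma expr_mxsize A k i j : `|(A ^+ k) i j| <= mxsize A ^+ k.
Proof.
have C0 := mxsize_ge0 A.
elim: k i j => [|k IH] i j.
  by rewrite !expr0 mxE normr_nat; case: eqP.
rewrite exprS mxE; apply: (le_trans (ler_norm_sum _ _ _)).
apply: (@le_trans _ _ (\sum_l `|A i l| * mxsize A ^+ k)).
  by apply: ler_sum => l _; rewrite normrM ler_wpM2l.
rewrite -mulr_suml exprS ler_wpM2r ?exprn_ge0//.
rewrite /mxsize [X in _ <= _ + X](bigD1 i)//=.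
apply: ler_wpDl => //; rewrite lerDl sumr_ge0// => l _.
by rewrite sumr_ge0.
Qed.

(** Power series coefficients of the entry (i, j) of A^m exp(s A). With m as a parameter, termwise
    differentiation in s is the shift from m to m + 1. *)
Definition mexp_coef A m i j : R^nat := fun k => (k`!%:R)^-1 * (A ^+ (k + m)) i j.

Lemma cvg_mexp_coef A m i j x : cvgn (pseries (mexp_coef A m i j) x).
Proof.
apply: normed_cvg.
apply: (@series_le_cvg _ _ (fun k => mxsize A ^+ m * exp_coeff (mxsize A * `|x|) k)).
- by move=> k /=.
- move=> k; rewrite /exp_coeff/= mulr_ge0 ?exprn_ge0 ?mxsize_ge0//.
  by rewrite divr_ge0// exprn_ge0// mulr_ge0// mxsize_ge0.
- move=> k; rewrite /exp_coeff/= /mexp_coef !normrM normfV normr_nat normrX.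
  rewrite exprMn mulrC !mulrA.
  rewrite -[leLHS]mulrA [leRHS](_ : _ = `|x| ^+ k * ((k`!%:R)^-1 * (mxsize A ^+ (k + m)))).
    rewrite ler_wpM2l ?exprn_ge0// ler_wpM2l ?invr_ge0//.
    exact: expr_mxsize.
  by rewrite exprD; ring.
rewrite (_ : (fun k => _) = mxsize A ^+ m *: exp_coeff (mxsize A * `|x|))//.
rewrite seriesZ; apply: is_cvgZr; exact: is_cvg_series_exp_coeff.
Qed.

Lemma pseries_diffs_mexp_coef A m i j :
  pseries_diffs (mexp_coef A m i j) = mexp_coef A m.+1 i j.
Proof.
apply/funext => k; rewrite /pseries_diffs /mexp_coef factS natrM invfM.
rewrite addSnnS !mulrA divff ?mul1r ?pnatr_eq0//.
Qed.

Definition mexpS A m (s : R) : 'M[R]_d :=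
  \matrix_(i, j) limn (pseries (mexp_coef A m i j) s).

Lemma exprZmx A s k : (s *: A) ^+ k = s ^+ k *: A ^+ k.
Proof.
elim: k => [|k IH]; first by rewrite !expr0 scale1r.
by rewrite !exprS IH; rewrite /GRing.mul/= -scalemxAl -scalemxAr scalerA.
Qed.

Lemma mexpE A s : mexp (s *: A) = mexpS A 0 s.
Proof.
apply: cvg_lim; first exact: norm_hausdorff.
apply: cvg_mx => i j; rewrite mxE.
rewrite [X in X @ \oo --> _](_ : _ = pseries (mexp_coef A 0 i j) s).
  exact: cvg_mexp_coef.
apply/funext => n; rewrite /pseries/= /series/= summxE big_mkord.
by apply: eq_bigr => k _; rewrite exprZmx !mxE /mexp_coef addn0 mulrA mulrAC -mulrA mulrC -mulrA.
Qed.

Lemma mexpS_mull A m s : mexpS A m.+1 s = A *m mexpS A m s.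
Proof.
apply/matrixP => i j; rewrite !mxE.
apply: cvg_lim => //.
rewrite [X in X @ \oo --> _](_ : _ = fun n => \sum_l A i l * pseries (mexp_coef A m l j) s n).
  apply: cvg_big => [|l _]; [exact: add_continuous|rewrite mxE; apply: cvgMl_tmp; exact: cvg_mexp_coef].
apply/funext => n; rewrite /pseries/= /series/=.
under [RHS]eq_bigr do rewrite mulr_sumr.
rewrite exchange_big/=; apply: eq_bigr => k _.
rewrite /mexp_coef addnS exprS mxE mulr_sumr mulr_suml; apply: eq_bigr => l _.
by ring.
Qed.

Lemma mexpS_mulr A m s : mexpS A m.+1 s = mexpS A m s *m A.
Proof.
apply/matrixP => i j; rewrite !mxE.
apply: cvg_lim => //.
rewrite [X in X @ \oo --> _](_ : _ = fun n => \sum_l pseries (mexp_coef A m i l) s n * A l j).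
  apply: cvg_big => [|l _]; [exact: add_continuous|rewrite mxE; apply: cvgMr_tmp; exact: cvg_mexp_coef].
apply/funext => n; rewrite /pseries/= /series/=.
under [RHS]eq_bigr do rewrite mulr_suml.
rewrite exchange_big/=; apply: eq_bigr => k _.
rewrite /mexp_coef addnS exprSr mxE mulr_sumr mulr_suml; apply: eq_bigr => l _.
by ring.
Qed.

Lemma der_mexpS A m i j s :
  is_derive s 1 (fun u => mexpS A m u i j) (mexpS A m.+1 s i j).
Proof.
rewrite mxE -pseries_diffs_mexp_coef.
rewrite (_ : (fun _ => _) = fun u => limn (pseries (mexp_coef A m i j) u)); last first.
  by apply/funext => u; rewrite mxE.
apply: (@pseries_snd_diffs _ _ (`|s| + 1)).
- exact: cvg_mexp_coef.
- by rewrite pseries_diffs_mexp_coef; exact: cvg_mexp_coef.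
- by rewrite !pseries_diffs_mexp_coef; exact: cvg_mexp_coef.
- by rewrite [ltRHS]ger0_norm ?ltrDl// addr_ge0.
Qed.

Definition eflow A (s : R) : 'M[R]_d := mexp (s *: A).

Lemma der_eflowl A i j s :
  is_derive s 1 (fun u => eflow A u i j) ((A *m eflow A s) i j).
Proof.
have := der_mexpS A 0 i j s; rewrite mexpS_mull /eflow mexpE.
by rewrite (_ : (fun u => mexp (u *: A) i j) = fun u => mexpS A 0 u i j)//;
  apply/funext => u; rewrite mexpE.
Qed.

Lemma eflow_comm A s : A *m eflow A s = eflow A s *m A.
Proof. by rewrite /eflow mexpE -mexpS_mull mexpS_mulr. Qed.

Lemma eflow0 A : eflow A 0 = 1%:M.
Proof.
rewrite /eflow mexpE; apply/matrixP => i j; rewrite mxE.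
apply: cvg_lim => //; rewrite -cvg_shiftS.
rewrite (_ : (fun _ => _) = fun=> (1%:M : 'M[R]_d) i j); first exact: cvg_cst.
apply/funext => n; rewrite /pseries/= /series/= big_nat_recl// big1 ?addr0.
  by rewrite /mexp_coef expr0 mulr1 fact0 invr1 mul1r addn0 expr0.
by move=> k _; rewrite expr0n mulr0.
Qed.

(** The left side has derivative 0 in t, since A commutes with the flow, so it keeps its value at t
    = 0. Invertibility and the group law both follow from this identity. *)
Lemma eflowD_eflowN A s t : eflow A (s + t) *m eflow A (- t) = eflow A s.
Proof.
apply/matrixP => i j.
have -> : eflow A s i j = (eflow A (s + 0) *m eflow A (- 0)) i j.
  by rewrite addr0 oppr0 eflow0 mulmx1.
apply: (@is_derive_0_is_cst R (fun t => (eflow A (s + t) *m eflow A (- t)) i j)) => {}t.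
rewrite (_ : (fun _ => _) = fun u => \sum_l eflow A (s + u) i l * eflow A (- u) l j); last first.
  by apply/funext => u; rewrite mxE.
have h1 l : is_derive t 1 (fun u => eflow A (s + u) i l) ((A *m eflow A (s + t)) i l).
  apply: (der_eq (der_comp (der_eflowl A i l (s + t)) (derD (derC s t) (derI t)))).
  by rewrite add0r mul1r.
have h2 l : is_derive t 1 (fun u => eflow A (- u) l j) (- (A *m eflow A (- t)) l j).
  apply: (der_eq (der_comp (der_eflowl A l j (- t)) (derN (derI t)))).
  by rewrite mulN1r.
apply: (der_eq (der_sum _ (fun l => derM (h1 l) (h2 l)))).
under eq_bigr do rewrite mulrN.
rewrite sumrB eflow_comm.
transitivity ((eflow A (s + t) *m A *m eflow A (- t)) i j -
  (eflow A (s + t) *m (A *m eflow A (- t))) i j); first by rewrite !mxE.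
by rewrite mulmxA subrr.
Qed.

Lemma eflowN A t : eflow A t *m eflow A (- t) = 1%:M.
Proof. by have := eflowD_eflowN A 0 t; rewrite add0r eflow0. Qed.

Lemma eflowD A s t : eflow A (s + t) = eflow A s *m eflow A t.
Proof.
have e := eflowN A (- t); rewrite opprK in e.
by rewrite -(eflowD_eflowN A s t) -mulmxA e mulmx1.
Qed.

Lemma eflow_unit A s : eflow A s \in unitmx.
Proof. by have [] := mulmx1_unit (eflowN A s). Qed.

Lemma eflow_tr A s : eflow A^T s = (eflow A s)^T.
Proof.
rewrite /eflow !mexpE; apply/matrixP => i j; rewrite !mxE.
congr (limn (pseries _ _)); apply/funext => k; rewrite /mexp_coef; congr (_ * _).
suff -> m : A^T ^+ m = (A ^+ m)^T by rewrite mxE.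
elim: m => [|m IH]; first by rewrite !expr0 trmx1.
by rewrite exprS exprSr IH [RHS]trmx_mul.
Qed.

Lemma der_prod (I : eqType) (r : seq I) (h : I -> R -> R) (dh : I -> R) (x : R) :
  uniq r -> (forall i, is_derive x 1 (h i) (dh i)) ->
  is_derive x 1 (fun y => \prod_(i <- r) h i y)
    (\sum_(i <- r) dh i * \prod_(j <- r | j != i) h j x).
Proof.
move=> + hd; elim: r => [_|a r IH /= /andP[ar ur]].
  rewrite big_nil (_ : (fun _ => _) = fun=> 1); first exact: derC.
  by apply/funext => y; rewrite big_nil.
rewrite (_ : (fun _ => _) = fun y => h a y * \prod_(i <- r) h i y); last first.
  by apply/funext => y; rewrite big_cons.
apply: (der_eq (derM (hd a) (IH ur))).
rewrite big_cons big_cons eqxx/=; congr (_ * _ + _).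
  rewrite [LHS]big_seq [RHS]big_seq_cond; apply: eq_bigl => i.
  by case ir: (i \in r) => //=; apply/esym; apply: contraNneq ar => <-.
rewrite mulr_sumr [LHS]big_seq [RHS]big_seq; apply: eq_bigr => i ir.
rewrite big_cons ifT; first by rewrite mulrCA.
by apply: contraNneq ar => ->.
Qed.

(** To first order at the identity matrix only the identity permutation contributes to the Leibniz
    expansion, and it contributes the trace. *)
Lemma der_det_eflow0 A : is_derive (0 : R) 1 (fun s => \det (eflow A s)) (\tr A).
Proof.
rewrite (_ : (fun _ => _) = fun s => \sum_(t : 'S_d) (-1) ^+ t * \prod_i eflow A s i (t i))//.
have hs (t : 'S_d) : is_derive (0 : R) 1 (fun s => (-1) ^+ t * \prod_i eflow A s i (t i))
    (if t == 1%g then \tr A else 0).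
  apply: der_eq.
    apply: derZ; apply: (der_prod (index_enum_uniq _)) => i; exact: der_eflowl.
  rewrite !eflow0 mulmx1; case: ifPn => [/eqP ->|t1].
    rewrite odd_perm1 mul1r; apply: eq_bigr => i _.
    rewrite perm1 big1 ?mulr1// => j _.
    by rewrite perm1 mxE eqxx.
  have [i ti] : exists i, t i != i.
    apply/existsP; apply: contraR t1 => /existsPn h; apply/eqP/permP => i.
    by rewrite perm1; apply/eqP; move: (h i); rewrite negbK.
  rewrite big1 ?mulr0// => j _.
  (* a non-identity permutation moves two indices, so every term of the product rule
     still contains an off-diagonal entry of the identity *)
  have [k kj tk] : exists2 k, k != j & t k != k.
    have [ij|ij] := eqVneq i j; last by exists i.
    exists (t i); first by rewrite -ij.
    by apply: contra ti => /eqP/perm_inj ->.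
  by rewrite (bigD1 k)//= mxE eq_sym (negbTE tk) mul0r mulr0.
apply: der_eq (der_sum _ hs) _.
by rewrite -big_mkcond big_pred1_eq.
Qed.

(** The determinant times exp(- s tr A) has derivative 0; the group law reduces the derivative of
    the determinant at s to the one at 0. *)
Lemma det_eflow A s : \det (eflow A s) = expR (s * \tr A).
Proof.
have h : \det (eflow A s) * expR (- (s * \tr A)) = 1.
  have -> : 1 = \det (eflow A 0) * expR (- (0 * \tr A)).
    by rewrite eflow0 det1 mul0r oppr0 expR0 mulr1.
  apply: (@is_derive_0_is_cst R (fun s => \det (eflow A s) * expR (- (s * \tr A)))) => {}s.
  have h1 : is_derive s 1 (fun u => \det (eflow A u)) (\det (eflow A s) * \tr A).
    rewrite (_ : (fun _ => _) = fun u => \det (eflow A s) * \det (eflow A (u - s))); last first.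
      by apply/funext => u; rewrite -det_mulmx -eflowD addrC subrK.
    apply: derZ.
    have h0 : is_derive (s - s) 1 (fun u => \det (eflow A u)) (\tr A).
      by rewrite subrr; exact: der_det_eflow0.
    apply: (der_eq (der_comp (g := fun u => u - s) h0 (derB (derI s) (derC s s)))).
    by rewrite subr0 mul1r.
  have h2 : is_derive s 1 (fun u => expR (- (u * \tr A))) (- \tr A * expR (- (s * \tr A))).
    apply: (der_eq (der_comp (is_derive_expR _) (derN (derM (derI s) (derC (\tr A) s))))).
    by rewrite mul1r mulr0 addr0.
  by apply: (der_eq (derM h1 h2)); ring.
by rewrite -[LHS]mulr1 -(expRxMexpNx_1 (s * \tr A)) mulrCA h mulr1.
Qed.

End MatrixExp.

(** * Growth of homogeneous functions *)

Section Homogeneity.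
Variables (R : realType) (d : nat).
Implicit Types (x y : 'rV[R]_d) (A : 'M[R]_d).

Lemma coord_le_norm x i : `|x 0 i| <= `|x|.
Proof.
have /mapP[j Hj E] : `|x 0 i| \in [seq `|x k.1 k.2| | k : 'I_1 * 'I_d].
  by apply/mapP; exists (ord0, i) => //=; rewrite mem_enum.
by rewrite E [leRHS]/Num.norm /= mx_normrE; apply/bigmax_geP; right => /=; exists j.
Qed.

Lemma norm_lt_rbox x (r : R) : 0 < r -> (forall i, `|x 0 i| < r) -> `|x| < r.
Proof.
move=> r0 h; have : ball (0 : 'rV[R]_d) r x.
  by rewrite ball_rboxE// => i; rewrite mxE subr0.
by rewrite -ball_normE /ball_/= sub0r normrN.
Qed.

Lemma compact_norm_bound (A : set 'rV[R]_d) : compact A ->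
  exists2 N : R, 1 <= N & forall x, A x -> `|x| <= N.
Proof.
move=> /compact_bounded[M [Mr hM]]; exists (`|M| + 1); first by rewrite lerDr.
move=> x Ax; apply: (hM (`|M| + 1)) => //.
by rewrite (le_lt_trans (ler_norm M))// ltrDl.
Qed.

Lemma continuous_bounded_on_ball (P : 'rV[R]_d -> R) (N : R) : continuous P ->
  exists2 M : R, 1 <= M & forall x, `|x| <= N -> P x <= M.
Proof.
move=> cP.
have cB : compact [set x : 'rV[R]_d | `|x| <= N].
  apply: bounded_closed_compact.
    exists N; split; first exact: num_real.
    by move=> y Ny x /= xN; apply: (le_trans xN); exact: ltW.
  rewrite (_ : [set _ | _] = (fun x => `|x|) @^-1` [set r | r <= N])//.
  by apply: closed_comp => [x _|]; [exact: norm_continuous|exact: closed_le].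
have /compact_bounded[M [Mr hM]] : compact (P @` [set x | `|x| <= N]).
  by apply: continuous_compact => //; exact: continuous_subspaceT.
exists (`|M| + 1); first by rewrite lerDr.
move=> x xN; apply: (le_trans (ler_norm _)).
apply: (hM (`|M| + 1)); last by exists x.
by rewrite (le_lt_trans (ler_norm M))// ltrDl.
Qed.

Lemma continuous_segment x y : continuous (fun u : R => (1 - u) *: x + u *: y).
Proof.
move=> u; apply: cvgD; apply: cvgZr_tmp => //.
by apply: cvgB => //; exact: cvg_cst.
Qed.

(** By the intermediate value theorem, passing from P < 1 to P >= 1 would meet {P = 1} outside the
    ball of radius N. *)
Lemma segment_avoid_level (P : 'rV[R]_d -> R) (N : R) x y : continuous P ->
  (forall z, P z = 1 -> `|z| <= N) ->
  (forall u, 0 <= u <= 1 -> N < `|(1 - u) *: x + u *: y|) ->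
  P x < 1 -> P y < 1.
Proof.
move=> cP hN hs Px; rewrite ltNge; apply/negP => Py.
pose f u := P ((1 - u) *: x + u *: y).
have f0 : f 0 = P x by rewrite /f subr0 scale1r scale0r addr0.
have f1 : f 1 = P y by rewrite /f subrr scale0r add0r scale1r.
have [||c + fc] := @IVT R f 0 1 1 ler01.
- apply: continuous_subspaceT => u.
  by apply: continuous_comp; [exact: continuous_segment|exact: cP].
- by rewrite f0 f1 ge_min (ltW Px)/= le_max Py orbT.
rewrite in_itv/= => c01.
by have := hs _ c01; rewrite ltNge hN.
Qed.

(** The segment from x to y may enter the ball although it avoids 0. Its dilate by a large c does
    not, and neither do the radial pieces from x to c x and from c y to y. *)
Lemma outward_path (P : 'rV[R]_d -> R) (N : R) x y : continuous P -> 0 <= N ->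
  (forall z, P z = 1 -> `|z| <= N) -> N < `|x| -> N < `|y| ->
  (forall u, 0 <= u <= 1 -> (1 - u) *: x + u *: y != 0) ->
  P x < 1 -> P y < 1.
Proof.
move=> cP N0 hN xN yN h0 Px.
have [c c1 hc] : exists2 c : R, 1 <= c &
    forall u, 0 <= u <= 1 -> N < `|(1 - u) *: (c *: x) + u *: (c *: y)|.
  have [|m m01 hm] := @EVT_min R (fun u => `|(1 - u) *: x + u *: y|) 0 1 ler01.
    apply: continuous_subspaceT => u.
    by apply: continuous_comp; [exact: continuous_segment|exact: norm_continuous].
  set delta : R := `|(1 - m) *: x + m *: y| in hm.
  have d0 : 0 < delta by rewrite normr_gt0 h0// -in_itv.
  (* delta is the distance from 0 to the segment, and c delta = delta + N + 1. *)
  exists (1 + (N + 1) / delta).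
    by rewrite lerDl divr_ge0 ?(ltW d0)// addr_ge0.
  move=> u u01; set c := 1 + _ / _.
  have -> : (1 - u) *: (c *: x) + u *: (c *: y) = c *: ((1 - u) *: x + u *: y).
    by rewrite scalerDr !scalerA [c * u]mulrC [c * (1 - u)]mulrC.
  rewrite normrZ /c {c} ger0_norm ?addr_ge0// ?divr_ge0 ?(ltW d0)// ?addr_ge0//.
  have := hm u; rewrite in_itv/= => /(_ u01) hu.
  apply: (@lt_le_trans _ _ ((1 + (N + 1) / delta) * delta)).
    rewrite mulrDl mul1r divfK ?gt_eqF//; lra.
  by rewrite ler_wpM2l// addr_ge0// divr_ge0 ?(ltW d0)// addr_ge0.
have ray w u : N < `|w| -> 0 <= u <= 1 -> N < `|(1 - u) *: w + u *: (c *: w)|.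
  move=> wN /andP[u0 u1]; rewrite scalerA -scalerDl normrZ.
  apply: (lt_le_trans wN); rewrite ler_peMl//.
  have hh : 1 <= 1 - u + u * c by nra.
  by rewrite ger0_norm// (le_trans _ hh).
(* The three pieces are taken backwards: c y to y, then c x to c y, then x to c x. *)
apply: (@segment_avoid_level P N (c *: y)) => //.
  move=> u /andP[u0 u1]; rewrite addrC -{1}[u](subKr 1).
  by apply: ray => //; rewrite subr_ge0 u1 gerBl.
apply: (@segment_avoid_level P N (c *: x)) => //.
apply: (@segment_avoid_level P N x) => // u u01; exact: ray.
Qed.

Variables (P : 'rV[R]_d -> R) (F : 'M[R]_d).
Hypothesis cP : continuous P.
Hypothesis P_ge0 : forall x, 0 <= P x.
Hypothesis P_eq0 : forall x, P x = 0 <-> x = 0.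
Hypothesis P_flow : forall x s, P (x *m eflow F s) = expR s * P x.
Hypothesis P_compact : compact [set x | P x = 1].

Lemma pos_off0 x : x != 0 -> 0 < P x.
Proof.
by move=> x0; rewrite lt_def P_ge0 andbT; apply: contra x0 => /eqP/P_eq0 ->.
Qed.

(* A far point x with P x < 1 is moved by the flow to a far point z with P z > 1; some
   path joining x to z outside the ball would then meet {P = 1}.  When the segment
   from x to z = - k x meets 0, one uses the next flow iterate k^2 x instead. *)
Lemma sublevel_bounded : exists2 N : R, 0 < N & forall x, P x <= 1 -> `|x| < N.
Proof.
have [N N1 hN] := compact_norm_bound P_compact.
have N0 : 0 <= N by lra.
exists (N + 1); first lra.
move=> x; rewrite le_eqVlt => /predU1P[/hN|Px]; first lra.
rewrite ltNge; apply/negP => xN1; have {xN1}xN : N < `|x| by lra.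
have [M M1 hM] := continuous_bounded_on_ball N cP.
have x0 : x != 0 by rewrite -normr_gt0; lra.
have Px0 := pos_off0 x0.
(* Chosen so that P z = M + 1: M bounds P on the ball of radius N, so z must lie outside it. *)
pose s := ln ((M + 1) / P x).
have es : expR s = (M + 1) / P x by rewrite lnK// posrE divr_gt0//; lra.
have es1 : 1 <= expR s by rewrite es ler_pdivlMr//; lra.
pose z := x *m eflow F s; pose z' := z *m eflow F s.
have Pz : P z = M + 1 by rewrite P_flow es divfK ?gt_eqF.
have Pz' : M + 1 <= P z' by rewrite P_flow Pz ler_peMl//; lra.
have big w : M + 1 <= P w -> N < `|w|.
  by move=> Pw; rewrite ltNge; apply/negP => /hM; lra.
have key w : M + 1 <= P w ->
    (forall u, 0 <= u <= 1 -> (1 - u) *: x + u *: w != 0) -> False.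
  move=> Pw h; have := outward_path cP N0 hN xN (big _ Pw) h Px; lra.
have [h|] := pselect (forall u, 0 <= u <= 1 -> (1 - u) *: x + u *: z != 0).
  by apply: (key z) => //; rewrite Pz.
move=> /existsNP[u /not_implyP[/andP[u0 u1] /negP/negPn/eqP hu]].
have un0 : u != 0.
  by apply: contraNneq x0 => uE; move: hu; rewrite uE subr0 scale1r scale0r addr0 => ->.
pose k := (1 - u) / u.
have zE : z = - k *: x.
  apply: (scalerI un0); rewrite scalerA /k mulrN mulrCA divff// mulr1.
  by apply/eqP; rewrite scaleNr -addr_eq0 addrC hu.
(* The flow is linear, so x is an eigenvector at time s with eigenvalue - k, and the second iterate
   lies on the ray through x. *)
have z'E : z' = (k ^+ 2) *: x.
  by rewrite /z' zE -scalemxAl -/z zE scalerA mulrNN expr2.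
apply: (key z') => // v /andP[v0 v1].
rewrite z'E scalerA -scalerDl scaler_eq0 negb_or x0 andbT.
have k0 : 0 != k.
  apply/eqP => k0; have := Pz; rewrite zE -k0 oppr0 scale0r.
  have -> : P 0 = 0 by exact/P_eq0.
  lra.
have k20 : 0 < k ^+ 2 by rewrite exprn_even_gt0//= eq_sym.
rewrite gt_eqF//; have [v1'|v1'] := ltP v 1; nra.
Qed.

Lemma det_bound n (A : 'M[R]_n) (C : R) : (forall i j, `|A i j| <= C) ->
  `|\det A| <= n`!%:R * C ^+ n.
Proof.
move=> h; apply: (le_trans (ler_norm_sum _ _ _)).
apply: (@le_trans _ _ (\sum_(t : 'S_n) C ^+ n)).
  apply: ler_sum => t _; rewrite normrM normrX normrN1 expr1n mul1r.
  rewrite normr_prod; apply: (@le_trans _ _ (\prod_(i < n) C)).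
    by apply: ler_prod => i _; rewrite normr_ge0 h.
  by rewrite prodr_const card_ord.
by rewrite sumr_const mulr_natl (_ : #|_| = #|{: 'S_n}|) ?card_Sn.
Qed.

(** For s >= 0 the backward flow preserves {P <= 1}, which contains a ball of radius e and lies in a
    ball of radius N. Testing on the vectors (e / 2) e_i bounds the entries. *)
Lemma eflowN_bounded : exists2 C : R, 0 <= C &
  forall s i j, 0 <= s -> `|eflow F (- s) i j| <= C.
Proof.
have [N N0 hN] := sublevel_bounded.
have [e e0 he] : exists2 e : R, 0 < e & forall x, `|x| < e -> P x <= 1.
  have P0 : P 0 = 0 by exact/P_eq0.
  have : \forall x \near (0 : 'rV[R]_d), P x < 1.
    have /cvgr_lt : P x @[x --> (0 : 'rV[R]_d)] --> P 0 by exact: cP.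
    by apply; rewrite P0.
  move=> /nbhs_ballP[e /= e0 he]; exists e => // x xe.
  by apply/ltW/he; rewrite -ball_normE /ball_/= sub0r normrN.
exists (N * (2 / e)); first by rewrite mulr_ge0 ?divr_ge0// ltW.
move=> s i j s0.
pose x : 'rV[R]_d := (e / 2) *: delta_mx 0 i.
have xe : `|x| < e.
  apply: norm_lt_rbox => // k; rewrite !mxE eqxx/=.
  by case: (k == i) => /=; rewrite ?mulr1 ?mulr0 ?normr0// ger0_norm; lra.
have : P (x *m eflow F (- s)) <= 1.
  rewrite P_flow -[leRHS]mul1r ler_pM ?expR_ge0 ?he//.
  by rewrite -expR0 ler_expR oppr_le0.
move=> /hN /(le_lt_trans (coord_le_norm _ j)).
have e20 : 0 < e / 2 by rewrite divr_gt0.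
rewrite -scalemxAl -rowE !mxE normrM (gtr0_norm e20) -ltr_pdivlMl//.
by rewrite invf_div mulrC => /ltW.
Qed.

(** A negative trace would make the determinant exp(- s tr F) of the bounded matrices unbounded. *)
Lemma trace_ge0 : 0 <= \tr F.
Proof.
have [C C0 hC] := eflowN_bounded.
rewrite leNgt; apply/negP => t0.
pose B := d`!%:R * C ^+ d.
have B0 : 0 <= B by rewrite mulr_ge0// exprn_ge0.
(* At this time the determinant equals exp(B) >= 1 + B, above its bound B. *)
pose s := B / (- \tr F).
have s0 : 0 <= s by rewrite divr_ge0// oppr_ge0 ltW.
have := det_bound (fun i j => hC s i j s0).
rewrite det_eflow ger0_norm ?expR_ge0// mulNr -mulrN /s mulfVK ?oppr_eq0 ?lt_eqF//.
have := expR_ge1Dx B; rewrite -/B; lra.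
Qed.

Lemma eflow_growth : exists2 C : R, 0 <= C &
  forall s i j, 0 <= s -> `|eflow F s i j| <= C * expR (s * \tr F).
Proof.
have [C C0 hC] := eflowN_bounded.
exists (d.-1`!%:R * C ^+ d.-1); first by rewrite mulr_ge0// exprn_ge0.
move=> s i j s0.
have uN := eflow_unit F (- s).
(* Entries of the adjugate are signed minors of size d - 1 of a bounded matrix, whence the
   constant. *)
have -> : eflow F s = expR (s * \tr F) *: \adj (eflow F (- s)).
  have /(congr1 (mulmx^~ (invmx (eflow F (- s))))) := eflowN F s.
  rewrite mulmxK// mul1mx => ->; rewrite /invmx uN det_eflow; congr (_ *: _).
  by rewrite mulNr expRN invrK.
rewrite mxE normrM ger0_norm ?expR_ge0// mulrC ler_wpM2r ?expR_ge0//.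
rewrite mxE /cofactor normrM normrX normrN1 expr1n mul1r.
by apply: det_bound => k l; rewrite !mxE; exact: hC.
Qed.

(** Flowing x back for the time ln (P x) lands on {P = 1}, which is bounded; returning costs exp(s
    tr F) = (P x)^(tr F). *)
Lemma superlevel_growth : exists2 C : R, 0 <= C &
  forall x i, 1 <= P x -> `|x 0 i| <= C * P x `^ \tr F.
Proof.
have [N N0 hN] := sublevel_bounded.
have [C C0 hC] := eflow_growth.
exists (\sum_(k < d) N * C).
  by apply: sumr_ge0 => k _; rewrite mulr_ge0// ltW.
move=> x i Px; pose s := ln (P x).
have s0 : 0 <= s by rewrite ln_ge0.
have Px0 : 0 < P x by lra.
pose y := x *m eflow F (- s).
have Py : P y = 1.
  by rewrite P_flow expRN lnK ?posrE// mulVf// gt_eqF.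
have -> : x = y *m eflow F s.
  by have := eflowN F (- s); rewrite opprK /y -mulmxA => ->; rewrite mulmx1.
rewrite P_flow Py mulr1 /powR gt_eqF ?expR_gt0// expRK mxE mulr_suml.
apply: (le_trans (ler_norm_sum _ _ _)); apply: ler_sum => k _.
rewrite normrM -mulrA ler_pM//.
  by apply: (le_trans (coord_le_norm _ _)); apply/ltW/hN; rewrite Py.
by rewrite [\tr F * s]mulrC; exact: hC.
Qed.

End Homogeneity.

(** * Rotating the Gamma integral *)

Section Rotation.
Variable R : realType.
Notation leb := (@lebesgue_measure R).
Implicit Types (f F : R -> R) (a b s x th : R).

Lemma continuous_itv_integrable f a b : (forall x, a <= x <= b -> {for x, continuous f}) ->
  leb.-integrable `[a, b] (EFin \o f).
Proof.
move=> cf; apply: continuous_compact_integrable; first exact: segment_compact.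
apply: continuous_in_subspaceT => x; rewrite inE/= in_itv/=; exact: cf.
Qed.

Lemma Rintegral_FTC f F a b : a < b ->
  (forall x, a <= x <= b -> {for x, continuous f}) ->
  (forall x, a <= x <= b -> is_derive x 1 F (f x)) ->
  \int[leb]_(x in `[a, b]) f x = F b - F a.
Proof.
move=> ab cf dF.
have aab : a <= a <= b by rewrite lexx ltW.
have bab : a <= b <= b by rewrite lexx ltW.
have inab x : x \in `]a, b[ -> a <= x <= b.
  by rewrite in_itv/= => /andP[/ltW -> /ltW ->].
rewrite /Rintegral (continuous_FTC2 ab (F := F)) //.
- apply: continuous_in_subspaceT => x; rewrite inE/= in_itv/=; exact: cf.
- split.
  + by move=> x /inab /dF [].
  + by apply: cvg_at_right_filter; exact: (der_continuous (dF _ aab)).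
  + by apply: cvg_at_left_filter; exact: (der_continuous (dF _ bab)).
- by move=> x /inab xab; have [_ <-] := dF _ xab; rewrite derive1E.
Qed.

(** Both G - f and G + f are nondecreasing, so no integral of the bound is taken. *)
Lemma der_dominated (f G df dG : R -> R) a b : a <= b ->
  (forall x, a <= x <= b -> is_derive x 1 f (df x)) ->
  (forall x, a <= x <= b -> is_derive x 1 G (dG x)) ->
  (forall x, a <= x <= b -> `|df x| <= dG x) ->
  `|f b - f a| <= G b - G a.
Proof.
move=> ab hf hG hd.
have mono (h dh : R -> R) : (forall x, a <= x <= b -> is_derive x 1 h (dh x)) ->
    (forall x, a <= x <= b -> 0 <= dh x) -> h a <= h b.
  move=> hh h0; have [||c + E] := @MVT_segment _ h dh a b ab.
  - by move=> x; rewrite in_itv/= => /andP[/ltW ax /ltW xb]; apply: hh; rewrite ax.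
  - apply: continuous_in_subspaceT => x; rewrite inE/= in_itv/= => axb.
    exact: der_continuous (hh x axb).
  rewrite in_itv/= => acb; rewrite -subr_ge0 E mulr_ge0 ?subr_ge0//; exact: h0.
have h1 := mono (fun x => G x - f x) (fun x => dG x - df x)
  (fun x ax => derB (hG x ax) (hf x ax)).
have h2 := mono (fun x => G x + f x) (fun x => dG x + df x)
  (fun x ax => derD (hG x ax) (hf x ax)).
have {}h1 : G a - f a <= G b - f b.
  by apply: h1 => x ax; rewrite subr_ge0; exact: le_trans (ler_norm _) (hd _ ax).
have {}h2 : G a + f a <= G b + f b.
  apply: h2 => x ax; have := hd _ ax; rewrite ler_norml => /andP[]; lra.
rewrite ler_norml; apply/andP; split; lra.
Qed.

Variable mu : R.
Hypothesis mu0 : 0 <= mu.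
Hypothesis mu1 : mu < 1.

(** With z = s e^{i th}, the number e^{-i mu pi/2} z^mu e^{-z} has modulus s^mu [damp th s] and
    argument [ang th s]. [rotint] is its real part after multiplication by dz/ds = e^{i th},
    [rotint'] the derivative of that in th, and [rotprim] the imaginary part after multiplication by
    z. *)
Definition ang th s : R := mu * (th - pi / 2) - s * sin th.
Definition damp th s : R := expR (- (s * cos th)).

Lemma der_powR (p s : R) : 0 < s -> is_derive s 1 (fun z => z `^ p) (p * s `^ (p - 1)).
Proof. by move=> s0; exact: is_derive1_powR. Qed.

Lemma der_damps th s : is_derive s 1 (damp th) (- cos th * damp th s).
Proof.
apply: (der_eq (der_comp (g := fun s => - (s * cos th)) (is_derive_expR _)
  (derN (derM (derI s) (derC (cos th) s))))).
by rewrite /damp; ring.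
Qed.

Lemma der_dampth th s : is_derive th 1 (fun th => damp th s) (s * sin th * damp th s).
Proof.
apply: (der_eq (der_comp (g := fun th => - (s * cos th)) (is_derive_expR _)
  (derN (derZ s (is_derive_cos th))))).
by rewrite /damp; ring.
Qed.

Lemma der_angs th s : is_derive s 1 (ang th) (- sin th).
Proof.
apply: (der_eq (derB (derC _ s) (derM (derI s) (derC (sin th) s)))); ring.
Qed.

Lemma der_angth th s : is_derive th 1 (fun th => ang th s) (mu - s * cos th).
Proof.
apply: (der_eq (derB (derZ mu (derB (derI th) (derC (pi / 2) th))) (derZ s (is_derive_sin th)))).
by ring.
Qed.

Definition rotint th s : R := s `^ mu * (damp th s * cos (ang th s + th)).
Definition rotint' th s : R := s `^ mu * (damp th s *
  (s * sin th * cos (ang th s + th) - (mu + 1 - s * cos th) * sin (ang th s + th))).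
Definition rotprim th s : R := s `^ (mu + 1) * (damp th s * sin (ang th s + th)).

Lemma der_rotint_th th s : is_derive th 1 (fun th => rotint th s) (rotint' th s).
Proof.
have h : is_derive th 1 (fun th => ang th s + th) (mu - s * cos th + 1).
  exact: derD (der_angth th s) (derI th).
apply: (der_eq (derZ _ (derM (der_dampth th s)
  (der_comp (g := fun th => ang th s + th) (is_derive_cos _) h)))).
by rewrite /rotint'; ring.
Qed.

Lemma powRS p s : 0 < s -> s `^ (p + 1) = s `^ p * s.
Proof.
move=> s0; rewrite powRD; first by rewrite powRr1// ltW.
by rewrite (gt_eqF s0) implybT.
Qed.

(** The Cauchy-Riemann relation in polar form: differentiating the contour integrand in the angle
    gives an exact derivative in the radius. *)
Lemma der_rotprim th s : 0 < s -> is_derive s 1 (rotprim th) (- rotint' th s).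
Proof.
move=> s0.
have h : is_derive s 1 (fun s => ang th s + th) (- sin th + 0).
  exact: derD (der_angs th s) (derC th s).
apply: (der_eq (derM (der_powR (mu + 1) s0) (derM (der_damps th s)
  (der_comp (g := fun s => ang th s + th) (is_derive_sin _) h)))).
by rewrite addrK powRS// /rotint'; ring.
Qed.

Lemma rotint_continuous th s : 0 < s -> {for s, continuous (rotint th)}.
Proof.
move=> s0.
have h : is_derive s 1 (fun s => ang th s + th) (- sin th + 0).
  exact: derD (der_angs th s) (derC th s).
exact: (der_continuous (derM (der_powR mu s0) (derM (der_damps th s)
  (der_comp (g := fun s => ang th s + th) (is_derive_cos _) h)))).
Qed.

Lemma rotint'_continuous th s : 0 < s -> {for s, continuous (rotint' th)}.
Proof.
move=> s0.
have h : is_derive s 1 (fun s => ang th s + th) (- sin th + 0).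
  exact: derD (der_angs th s) (derC th s).
have hc := der_comp (g := fun s => ang th s + th) (is_derive_cos _) h.
have hs := der_comp (g := fun s => ang th s + th) (is_derive_sin _) h.
have h1 := derM (derM (derI s) (derC (sin th) s)) hc.
have h2 := derM (derB (derC (mu + 1) s) (derM (derI s) (derC (cos th) s))) hs.
exact: (der_continuous (derM (der_powR mu s0) (derM (der_damps th s) (derB h1 h2)))).
Qed.

(** A crude bound, uniform in the angle, serving as the dominating constant for differentiation
    under the integral. *)
Lemma rotint'_bound th s T : 0 < s <= T -> 1 <= T ->
  `|rotint' th s| <= T * (expR T * (T + (mu + 1 + T))).
Proof.
move=> /andP[s0 sT] T1.
have c1 x : `|cos x| <= 1 by rewrite ler_norml cos_geN1 cos_le1.
have s1 x : `|sin x| <= 1 by rewrite ler_norml sin_geN1 sin_le1.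
rewrite /rotint' normrM (ger0_norm (powR_ge0 _ _)); apply: ler_pM => //.
- exact: powR_ge0.
- apply: (@le_trans _ _ (T `^ mu)).
    by apply: ge0_ler_powR; rewrite ?nnegrE//; lra.
  have T0 : 0 <= T by lra.
  by rewrite -[leRHS](powRr1 T0) ler_powR// ltW.
rewrite normrM (ger0_norm (expR_ge0 _)); apply: ler_pM => //.
- rewrite ler_expR; have := c1 th; rewrite ler_norml => /andP[h _]; nra.
apply: (le_trans (ler_normB _ _)); apply: lerD.
  rewrite !normrM -[leRHS]mulr1 -[X in X * 1]mulr1; apply: ler_pM => //.
  by apply: ler_pM => //; rewrite gtr0_norm.
rewrite normrM -[leRHS]mulr1; apply: ler_pM => //.
apply: (le_trans (ler_normB _ _)); apply: lerD; first by rewrite ger0_norm// addr_ge0.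
rewrite normrM gtr0_norm// -[leRHS]mulr1; by apply: ler_pM => //; exact: ltW.
Qed.

Section Interval.
Variables a T : R.
Hypothesis a0 : 0 < a.
Hypothesis a1 : a <= 1.
Hypothesis T1 : 1 < T.

Let rint th := \int[leb]_(s in `[a, T]) rotint th s.

(** Only the two arcs contribute: the derivative under the integral is exact in s. *)
Lemma der_rint th : is_derive th 1 rint (rotprim th a - rotprim th T).
Proof.
have pos s : a <= s <= T -> 0 < s by move=> /andP[h _]; exact: lt_le_trans h.
have intf (x : R) : `]th - 1, th + 1[%classic x -> leb.-integrable `[a, T] (EFin \o rotint x).
  by move=> _; apply: continuous_itv_integrable => s /pos; exact: rotint_continuous.
have Ith : `]th - 1, th + 1[%classic th by rewrite /= in_itv/=; apply/andP; split; lra.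
have derf (x s : R) : `]th - 1, th + 1[%classic x -> `[a, T]%classic s -> derivable (rotint ^~ s) x 1.
  by move=> _ _; have [] := der_rotint_th x s.
pose C := T * (expR T * (T + (mu + 1 + T))).
have C0 : 0 <= C.
  by have m0 := mu0; have t1 := T1; rewrite !mulr_ge0 ?expR_ge0//; lra.
have intG : leb.-integrable `[a, T] (EFin \o (fun _ : R => C)).
  by apply: continuous_itv_integrable => s _; exact: cvg_cst.
have d1E x s : derive1 (fun z => rotint z s) x = rotint' x s.
  by rewrite derive1E; have [_ ->] := der_rotint_th x s.
have Gub (x s : R) : `]th - 1, th + 1[%classic x -> `[a, T]%classic s ->
    `|partial1of2 rotint x s| <= C.
  move=> _; rewrite /= in_itv/= => /andP[h1 h2].
  rewrite /partial1of2 d1E; apply: rotint'_bound; last exact: ltW.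
  by rewrite h2 andbT; exact: lt_le_trans h1.
have mI : measurable (`[a, T]%classic : set (measurableTypeR R)) by exact: measurable_itv.
have D := derivable_under_integral mI Ith intf derf (fun _ => C0) intG Gub.
have E := differentiation_under_integral mI Ith intf derf (fun _ => C0) intG Gub.
apply: DeriveDef; first exact: D.
rewrite -derive1E E.
transitivity (\int[leb]_(s in `[a, T]) rotint' th s).
  by apply: eq_Rintegral => s _; exact: d1E.
have aT : a < T by exact: le_lt_trans T1.
transitivity (- rotprim th T - - rotprim th a); last by rewrite opprK addrC.
apply: (@Rintegral_FTC (rotint' th) (fun s => - rotprim th s) a T aT) => s /pos s0.
- exact: rotint'_continuous.
- by apply: (der_eq (derN (der_rotprim th s0))); rewrite opprK.
Qed.

(* With z = s e^{i th}, rot th is the real part of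
   e^{-i mu pi/2} (z_T^mu e^{-z_T} + int_{z_a}^{z_T} z^mu e^{-z} dz); the boundary term
   cancels the part of the derivative in th of order T^{mu+1} e^{-T cos th}. *)
Definition rot th : R := T `^ mu * (damp th T * cos (ang th T)) + rint th.

Lemma der_rot th : is_derive th 1 rot
  (rotprim th a - mu * T `^ mu * (damp th T * sin (ang th T))).
Proof.
have h := derZ (T `^ mu) (derM (der_dampth th T)
   (der_comp (g := fun th => ang th T) (is_derive_cos _) (der_angth th T))).
apply: (der_eq (derD h (der_rint th))).
have T0 : 0 < T by exact: lt_trans T1.
by rewrite {2}/rotprim powRS// sinD; ring.
Qed.

(** A form of Jordan's lemma. Where sin th >= 1/2, the term T^mu e^{-T cos th} is at most the
    derivative of 2 T^(mu-1) [damp th T]; elsewhere cos th >= 1/2 and it is at most T^mu e^{-T/2}.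
    The inner arc costs at most a. *)
Lemma rot_bound : `|rot (pi / 2) - rot 0| <=
  2 * T `^ (mu - 1) + (T `^ mu * expR (- (T / 2)) + a) * (pi / 2).
Proof.
have T0 : 0 < T by exact: lt_trans T1.
have pi0 : 0 <= pi / 2 :> R by rewrite divr_ge0// pi_ge0.
pose k := T `^ mu * expR (- (T / 2)) + a.
pose G th := 2 * T `^ (mu - 1) * damp th T + k * th.
have dG th : is_derive th 1 G (2 * T `^ (mu - 1) * (T * sin th * damp th T) + k * 1).
  exact: derD (derZ _ (der_dampth th T)) (derZ k (derI th)).
apply: (@le_trans _ _ (G (pi / 2) - G 0)).
  apply: (der_dominated pi0 (fun x _ => der_rot x) (fun x _ => dG x)) => th /andP[th0 th1].
  have s0 : 0 <= sin th.
    apply: sin_ge0_pi; rewrite th0/=; apply: (le_trans th1); have := pi_ge0 R; lra.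
  have c0 : 0 <= cos th.
    by apply: cos_ge0_pihalf; apply/andP; split => //; apply: le_trans th0; lra.
  have sc := cos2Dsin2 th.
  have TE : T `^ (mu - 1) * T = T `^ mu.
    by rewrite -powRS// subrK.
  have d0 : 0 <= damp th T by exact: expR_ge0.
  have tm0 : 0 <= T `^ mu by exact: powR_ge0.
  have e0 : 0 <= expR (- (T / 2)) by exact: expR_ge0.
  have c1 x : `|cos x| <= 1 by rewrite ler_norml cos_geN1 cos_le1.
  have s1 x : `|sin x| <= 1 by rewrite ler_norml sin_geN1 sin_le1.
  have hA : `|rotprim th a| <= a.
    rewrite /rotprim normrM (ger0_norm (powR_ge0 _ _)) -[leRHS]mulr1; apply: ler_pM => //.
    - exact: powR_ge0.
    - rewrite powRS// ler_piMl ?(ltW a0)// -[leRHS](powRr0 a) ger_powR//.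
      by rewrite a0.
    - rewrite normrM (ger0_norm (expR_ge0 _)) -[leRHS]mulr1; apply: ler_pM => //.
      by rewrite -expR0 ler_expR oppr_le0 mulr_ge0// ltW.
  have hB : `|mu * T `^ mu * (damp th T * sin (ang th T))| <= T `^ mu * damp th T.
    rewrite !normrM (ger0_norm mu0) (ger0_norm tm0) (ger0_norm d0).
    apply: ler_pM; rewrite ?mulr_ge0//; first by rewrite ler_piMl// ltW.
    by rewrite ler_piMr.
  apply: (le_trans (ler_normB _ _)).
  rewrite mulr1 /k (_ : 2 * _ * _ = 2 * sin th * (T `^ mu * damp th T)); last by rewrite -TE; ring.
  have hC : T `^ mu * damp th T <= 2 * sin th * (T `^ mu * damp th T) + T `^ mu * expR (- (T / 2)).
    have [s2|s2] := leP (1 / 2) (sin th).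
      have := mulr_ge0 tm0 d0; have := mulr_ge0 tm0 e0; nra.
    have c2 : 1 / 2 <= cos th by nra.
    have : T `^ mu * damp th T <= T `^ mu * expR (- (T / 2)).
      rewrite ler_wpM2l// ler_expR; nra.
    have : 0 <= 2 * sin th * (T `^ mu * damp th T) by rewrite !mulr_ge0.
    lra.
  lra.
have h1 : 2 * T `^ (mu - 1) * damp (pi / 2) T = 2 * T `^ (mu - 1).
  by rewrite /damp cos_pihalf mulr0 oppr0 expR0 mulr1.
have h2 : 0 <= 2 * T `^ (mu - 1) * damp 0 T.
  by rewrite !mulr_ge0 ?powR_ge0 ?expR_ge0.
rewrite /G -/k h1 mulr0 addr0; move: h2; lra.
Qed.

(** On the imaginary axis the factor e^{-i mu pi/2} cancels the argument of z^mu. What remains is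
    the expression that [oscrad_rot] obtains by parts. *)
Lemma rot_pihalf : rot (pi / 2) = T `^ mu * cos T + \int[leb]_(s in `[a, T]) (s `^ mu * sin s).
Proof.
rewrite /rot /rint /damp /ang subrr mulr0 add0r sin_pihalf cos_pihalf mulr0 oppr0 expR0 mul1r.
rewrite mulr1 cosN; congr (_ + _); apply: eq_Rintegral => s _.
rewrite /rotint /damp /ang subrr mulr0 add0r sin_pihalf cos_pihalf mulr0 oppr0 expR0 mul1r mulr1.
by rewrite cosDpihalf sinN opprK.
Qed.

Lemma rot_0 : rot 0 = cos (mu * pi / 2) *
  (T `^ mu * expR (- T) + \int[leb]_(s in `[a, T]) (s `^ mu * expR (- s))).
Proof.
have c s : cos (ang 0 s) = cos (mu * pi / 2).
  by rewrite /ang sin0 mulr0 subr0 sub0r mulrN cosN mulrA.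
rewrite /rot /rint c /damp cos0 mulr1 [RHS]mulrDr; congr (_ + _); first by ring.
rewrite -RintegralZl//; last first.
  apply: continuous_itv_integrable => s /andP[as_ _].
  have s0 : 0 < s by exact: lt_le_trans as_.
  exact: (der_continuous (derM (der_powR mu s0)
    (der_comp (g := fun s => - s) (is_derive_expR _) (derN (derI s))))).
apply: eq_Rintegral => s _; rewrite /rotint addr0 c /damp cos0 mulr1; ring.
Qed.

End Interval.
End Rotation.

(** * The Gamma integral as a limit over compact intervals *)

Section GammaLimit.
Variable R : realType.
Notation leb := (@lebesgue_measure R).
Variable mu : R.
Hypothesis mu0 : 0 <= mu.
Hypothesis mu1 : mu < 1.

Let f (s : R) : R := s `^ mu * expR (- s).
(** The shift by 2 keeps the endpoints strictly on either side of 1 from n = 0 on, as the rotation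
    estimate requires. *)
Let I (n : nat) : set R := `[(n.+2%:R)^-1, n.+2%:R]%classic.

Let f_cont s : 0 < s -> {for s, continuous f}.
Proof.
move=> s0; exact: (der_continuous (derM (der_powR mu s0)
    (der_comp (g := fun s => - s) (is_derive_expR _) (derN (derI s))))).
Qed.

Let f_ge0 s : 0 <= f s.
Proof. by rewrite mulr_ge0 ?powR_ge0 ?expR_ge0. Qed.

Let inI n s : I n s -> 0 < s.
Proof. by rewrite /I/= in_itv/= => /andP[h _]; apply: lt_le_trans h; rewrite invr_gt0. Qed.

Let f_int n : leb.-integrable (I n) (EFin \o f).
Proof.
apply: continuous_itv_integrable => s sI; apply: f_cont.
by apply: (@inI n); rewrite /I/= in_itv.
Qed.

(** s^mu <= 1 + s because 0 <= mu < 1, and (1 + s) e^{-s} has primitive - (2 + s) e^{-s}. *)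
Let I_bound n : \int[leb]_(s in I n) f s <= 3.
Proof.
pose g (s : R) := (1 + s) * expR (- s).
pose G (s : R) := - ((2 + s) * expR (- s)).
have de (s : R) : is_derive s 1 (fun s : R => expR (- s)) (- 1 * expR (- s)).
  exact: (der_comp (g := fun s => - s) (is_derive_expR _) (derN (derI s))).
have dG (s : R) : is_derive s 1 G (g s).
  by apply: (der_eq (derN (derM (derD (derC 2 s) (derI s)) (de s)))); rewrite /g; ring.
have cg s : {for s, continuous g}.
  exact: (der_continuous (derM (derD (derC 1 s) (derI s)) (de s))).
pose a : R := n.+2%:R^-1; pose T : R := n.+2%:R.
have T2 : 2 <= T by rewrite ler_nat.
have a1 : a <= 1 by rewrite invf_le1//; lra.
have a0 : 0 < a by rewrite invr_gt0//; lra.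
have aT : a < T by lra.
apply: (@le_trans _ _ (\int[leb]_(s in I n) g s)).
  apply: le_Rintegral => //.
  - exact: measurable_itv.
  - by apply: continuous_itv_integrable => s _; exact: cg.
  - move=> s /inI s0; rewrite ler_wpM2r ?expR_ge0//.
    have [s1|s1] := leP 1 s.
      by apply: (@le_trans _ _ s); [rewrite -[leRHS](powRr1 (ltW s0)) ler_powR// ltW|rewrite lerDr].
    apply: (@le_trans _ _ 1); last by rewrite lerDl ltW.
    by rewrite -[leRHS](powRr0 s) ger_powR// s0 ltW.
rewrite (_ : \int[leb]_(s in I n) g s = G T - G a); last first.
  by apply: Rintegral_FTC.
rewrite /G opprK; have h1 : 0 <= (2 + T) * expR (- T) by rewrite mulr_ge0 ?expR_ge0//; lra.
have h2 : expR (- a) <= 1 by rewrite -expR0 ler_expR; lra.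
have h3 := expR_ge0 (- a); nra.
Qed.

Let I_mono : {homo I : n m / (n <= m)%N >-> (n <= m)%O}.
Proof.
move=> n m nm; apply/subsetPset => s; rewrite /I/= !in_itv/= => /andP[h1 h2].
apply/andP; split; last by rewrite (le_trans h2)// ler_nat.
by apply: le_trans h1; rewrite lef_pV2 ?posrE// ler_nat.
Qed.

Let I_union : \bigcup_n I n = [set s : R | 0 < s].
Proof.
apply/seteqP; split => s /=; first by case=> n _ /inI.
move=> s0; pose n := Num.truncn (Num.max s s^-1).
have hn : Num.max s s^-1 < n.+1%:R by exact: truncnS_gt.
have hn2 : n.+1%:R <= n.+2%:R :> R by rewrite ler_nat.
move: hn; rewrite gt_max => /andP[hs hi].
exists n => //; rewrite /I/= in_itv/=; apply/andP; split; last by rewrite ltW// (lt_le_trans hs).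
by rewrite invf_ple ?posrE// ltW// (lt_le_trans hi).
Qed.

(** Monotone convergence over an exhaustion of (0, oo). The uniform bound makes the limit finite, so
    [fine] in [Gamma] returns the actual value of the integral. *)
Lemma gamma_cvg : (fun n => \int[leb]_(s in `[(n.+2%:R)^-1, n.+2%:R]) (s `^ mu * expR (- s))) @ \oo -->
  Gamma (1 + mu).
Proof.
have mf : measurable_fun setT f.
  apply: measurable_funM; first exact: measurable_powR.
  by apply: measurableT_comp => //; exact: measurable_expR.
have cv : (fun n => \int[leb]_(s in I n) (f s)%:E)%E @ \oo -->
    (\int[leb]_(s in [set s : R | (0 < s)%R]) (f s)%:E)%E.
  rewrite -I_union; apply: ge0_nondecreasing_set_cvg_integral => //.
  - by move=> n; exact: measurable_itv.
  - by move=> n; apply/measurable_EFinP; exact: measurable_funTS.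
  - by move=> n s _; rewrite lee_fin.
set L := (\int[leb]_(s in [set s : R | (0 < s)%R]) (f s)%:E)%E in cv.
have L0 : (0 <= L)%E by apply: integral_ge0 => s _; rewrite lee_fin.
have L3 : (L <= 3%:E)%E.
  rewrite -(cvg_lim _ cv)//; apply: lime_le; first by apply/cvg_ex; eexists; exact: cv.
  apply: nearW => n; have := I_bound n; rewrite -lee_fin /Rintegral fineK//.
  by apply: integrable_fin_num; [exact: measurable_itv|exact: f_int].
have Lfin : L \is a fin_num by rewrite ge0_fin_numE// (le_lt_trans L3) ?ltry.
have GE : Gamma (1 + mu) = fine L.
  rewrite /Gamma; congr fine; apply: eq_integral => s _; congr EFin.
  by rewrite /f addrAC subrr add0r.
rewrite GE; apply: fine_cvg; rewrite fineK//; exact: cv.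
Qed.

Lemma Gamma_gt0 : 0 < Gamma (1 + mu).
Proof.
have I0E : I 0 = `[2^-1, 2]%classic by [].
have mI n : measurable (I n) by exact: measurable_itv.
have low : (2^-1 `^ mu * expR (- 2)) * (2 - 2^-1) <= \int[leb]_(s in I 0) f s.
  have -> : (2^-1 `^ mu * expR (- 2)) * (2 - 2^-1) =
      \int[leb]_(s in I 0) (2^-1 `^ mu * expR (- 2)).
    rewrite Rintegral_cst; last exact: mI.
    rewrite I0E; congr (_ * _).
    have l : 2^-1 < 2 :> R by lra.
    have lI : lebesgue_measure (`[2^-1, 2]%classic : set R) = (2 - 2^-1)%:E.
      by rewrite lebesgue_measure_itv/= lte_fin l.
    exact: (esym (congr1 fine lI)).
  apply: le_Rintegral => //; first exact: mI.
    by apply: continuous_itv_integrable => s _; exact: cvg_cst.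
  move=> s; rewrite I0E/= in_itv/= => /andP[h1 h2].
  apply: ler_pM; rewrite ?powR_ge0 ?expR_ge0//; last by rewrite ler_expR; lra.
  by apply: ge0_ler_powR; rewrite ?nnegrE//; lra.
apply: (@lt_le_trans _ _ (\int[leb]_(s in I 0) f s)).
  apply: lt_le_trans low; rewrite mulr_gt0 ?mulr_gt0 ?powR_gt0 ?expR_gt0//; lra.
rewrite -(cvg_lim _ gamma_cvg)//; apply: limr_ge.
  by apply/cvg_ex; eexists; exact: gamma_cvg.
apply: nearW => n; rewrite /Rintegral; apply: fine_le; [by apply: integrable_fin_num; [exact: mI|exact: f_int]..|].
apply: (@ge0_subset_integral _ _ R leb _ _ (mI 0) (mI n) (fun x => (f x)%:E)).
- exact: (measurable_int leb (f_int n)).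
- by move=> s _; rewrite lee_fin.
- by apply/subsetPset; exact: I_mono.
Qed.

End GammaLimit.

(** * Oscillatory integrals along the flow *)

Section FlowIntegrals.
Variable R : realType.

(** Inversion takes the value 0 at 0 and is continuous only off 0, so the line is cut there. *)
Lemma measurable_inv : measurable_fun (setT : set R) (fun x : R => x^-1).
Proof.
have -> : (setT : set R) = [set 0] `|` [set x | x != 0].
  by apply/seteqP; split => x // _; have [->|x0] := eqVneq x 0; [left|right].
have o0 : open [set x : R | x != 0].
  by apply: open_neq.
apply/measurable_funU => //; first exact: open_measurable.
split; first exact: measurable_fun_set1.
apply: open_continuous_measurable_fun => // x; rewrite inE/=.
exact: inv_continuous.
Qed.

Variable d : nat.
Notation M := (lebM R d).
Implicit Types (x : 'rV[R]_d) (s t a b : R).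

Lemma lebM_rbox_fin (r : R) : 0 < r -> (M (rbox 0 r) < +oo)%E.
Proof. by move=> r0; rewrite [ltLHS](lebM_rbox d r0) ltry. Qed.

Variables (P : 'rV[R]_d -> R) (F : 'M[R]_d).
Hypothesis cP : continuous P.
Hypothesis P_ge0 : forall x, 0 <= P x.
Hypothesis P_eq0 : forall x, P x = 0 <-> x = 0.
Hypothesis P_flow : forall x s, P (x *m eflow F s) = expR s * P x.
Hypothesis P_compact : compact [set x | P x = 1].
Let mu : R := \tr F.
Hypothesis mu1 : mu < 1.

Let mu0 : 0 <= mu.
Proof. exact: (@trace_ge0 R d P). Qed.

Let mP : measurable_fun setT P.
Proof. exact: continuous_measurable. Qed.

Definition below b : set 'rV[R]_d := [set x | P x < b].
Definition shell a b : set 'rV[R]_d := [set x | a <= P x < b].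

Lemma measurable_below b : measurable (below b).
Proof. by apply: measurable_lt_set => //; exact: measurable_cst. Qed.

Lemma measurable_shell a b : measurable (shell a b).
Proof.
rewrite (_ : shell a b = [set x | a <= P x] `&` below b).
  apply: measurableI; last exact: measurable_below.
  by apply: measurable_le_set => //; exact: measurable_cst.
by apply/seteqP; split => x /=; [move=> /andP[]|case=> ? ?; apply/andP].
Qed.

Lemma below1_rbox : exists2 N : R, 0 < N & below 1 `<=` rbox 0 N.
Proof.
have [N N0 hN] := sublevel_bounded cP P_ge0 P_eq0 P_flow P_compact.
exists N => // x /ltW/hN xN; rewrite -ball_rboxE//.
by rewrite -ball_normE /ball_/= sub0r normrN.
Qed.

Definition vol : R := fine (M (below 1)).

(** The flow at time ln b carries {P < 1} onto {P < b} with determinant b^mu. *)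
Lemma lebM_below b : 0 < b -> M (below b) = ((b `^ mu)%:E * M (below 1))%E.
Proof.
move=> b0.
rewrite -[below b]setIT -[below 1]setIT -!integral_indic//; last 2 first.
- exact: measurable_below.
- exact: measurable_below.
rewrite -(unitmx_changes_leb (eflow_unit F (ln b))); last 2 first.
- by apply/measurable_EFinP; apply: measurable_indic; exact: measurable_below.
- by move=> x; rewrite lee_fin.
rewrite det_eflow ger0_norm ?expR_ge0// /powR gt_eqF// [ln b * _]mulrC; congr (_ * _)%E.
apply: eq_integral => x _; congr EFin; rewrite !indicE; congr (_%:R); congr nat_of_bool.
have bE : (x *m eflow F (ln b) \in below b) = (x \in below 1).
  by apply/idP/idP; rewrite !inE /below/= P_flow lnK ?posrE// gtr_pMr.
exact: bE.
Qed.

Lemma below1_fin : (M (below 1) < +oo)%E.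
Proof.
have [N N0 hN] := below1_rbox.
apply: le_lt_trans (lebM_rbox_fin N0).
by apply: le_measure => //; rewrite inE; [exact: measurable_below|exact: measurable_rbox].
Qed.

Lemma lebM_belowE b : 0 < b -> M (below b) = (b `^ mu * vol)%:E.
Proof.
move=> b0; rewrite lebM_below// EFinM /vol fineK// ge0_fin_numE//.
exact: below1_fin.
Qed.

Lemma below_fin b : (M (below b) < +oo)%E.
Proof.
have [b0|b0] := leP b 0; last by rewrite lebM_belowE// ltry.
rewrite (_ : below b = set0) ?measure0//.
by apply/seteqP; split => x //=; rewrite /below/= ltNge (le_trans b0).
Qed.

Lemma vol_ge0 : 0 <= vol.
Proof. exact: fine_ge0. Qed.

Lemma shell_fin a b : (M (shell a b) < +oo)%E.
Proof.
apply: le_lt_trans (below_fin b); apply: le_measure; rewrite ?inE.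
- exact: measurable_shell.
- exact: measurable_below.
- by move=> x /andP[].
Qed.

Lemma below_shellU a b : a <= b -> below b = below a `|` shell a b.
Proof.
move=> ab; apply/seteqP; split => x; rewrite /below /shell/=.
  by move=> xb; case: (ltP (P x) a) => xa; [left|right].
by case=> [xa|/andP[]//]; exact: lt_le_trans ab.
Qed.

Lemma below_shell_disj a b : [disjoint below a & shell a b].
Proof.
by apply/disj_setPS => x [/= xa /andP[]]; rewrite leNgt xa.
Qed.

Lemma lebM_shellE a b : 0 < a -> a <= b ->
  M (shell a b) = ((b `^ mu - a `^ mu) * vol)%:E.
Proof.
move=> a0 ab; have b0 : 0 < b by exact: lt_le_trans ab.
have : M (below b) = (M (below a) + M (shell a b))%E.
  rewrite (below_shellU ab); apply: measureU.
  - exact: measurable_below.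
  - exact: measurable_shell.
  - by apply/disj_set2P; exact: below_shell_disj.
rewrite !lebM_belowE// => h.
have : M (shell a b) \is a fin_num by rewrite ge0_fin_numE//; exact: shell_fin.
move: h; case: (M (shell a b)) => // r; rewrite -EFinD => -[h] _.
by congr EFin; rewrite mulrBl h; ring.
Qed.

Lemma fin_integrable (D : set 'rV[R]_d) (f : 'rV[R]_d -> R) (C : R) :
  measurable D -> (M D < +oo)%E -> measurable_fun D f ->
  (forall x, D x -> `|f x| <= C) -> M.-integrable D (EFin \o f).
Proof. by move=> mD Doo mf fC; exact: (bounded_integrable (C := C)). Qed.

Lemma Rint_bound (D : set 'rV[R]_d) (f : 'rV[R]_d -> R) (C : R) :
  measurable D -> (M D < +oo)%E -> measurable_fun D f ->
  (forall x, D x -> `|f x| <= C) -> `|\int[M]_(x in D) f x| <= C * fine (M D).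
Proof.
move=> mD Doo mf fC; have fi := fin_integrable mD Doo mf fC.
apply: (le_trans (le_normr_Rintegral mD fi)).
rewrite -Rintegral_cst//; apply: le_Rintegral => //.
  by have := integrable_abse fi.
by apply: (fin_integrable (C := `|C|) mD Doo).
Qed.

Lemma Rint_flow (D : set 'rV[R]_d) (f : 'rV[R]_d -> R) s :
  M.-integrable setT (EFin \o (f \_ D)) ->
  expR (s * mu) * \int[M]_(x in [set x | D (x *m eflow F s)]) f (x *m eflow F s)
  = \int[M]_(x in D) f x.
Proof.
move=> fi; rewrite [in RHS]Rintegral_mkcond [in LHS]Rintegral_mkcond /Rintegral.
rewrite -(integral_unitmx (eflow_unit F s) fi).
have E0 : 0 < expR (s * mu) := expR_gt0 _.
rewrite det_eflow (gtr0_norm E0).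
pose Y := (\int[M]_x (EFin \o (f \_ D)) (x *m eflow F s))%E; rewrite -/Y.
transitivity (expR (s * mu) * fine Y).
  congr (_ * fine _); apply: eq_integral => x _ /=; congr EFin; rewrite !patchE.
have : ((expR (s * mu))%:E * Y)%E \is a fin_num.
  rewrite /Y -[X in X%:E](gtr0_norm E0) -det_eflow (integral_unitmx (eflow_unit F s) fi).
  exact: integrable_fin_num fi.
move: (Y) => [r _| |]; first by rewrite -EFinM.
- by rewrite gt0_muley ?lte_fin.
- by rewrite gt0_muleNy ?lte_fin.
Qed.

Lemma powR_anti (T1 T r : R) : 0 < T1 -> T1 <= T -> r <= 0 -> T `^ r <= T1 `^ r.
Proof.
move=> T0 TT r0; have T0' : 0 < T by exact: lt_le_trans TT.
by rewrite /powR !gt_eqF// ler_expR ler_wnM2l// ler_ln.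
Qed.

Lemma shell_integrable (h : 'rV[R]_d -> R) T1 C a b :
  measurable_fun setT h -> (forall x, T1 <= P x -> `|h x| <= C) -> T1 <= a ->
  M.-integrable (shell a b) (EFin \o h).
Proof.
move=> mh hC aT; apply: (fin_integrable (C := C)).
- exact: measurable_shell.
- exact: shell_fin.
- exact: measurable_funTS.
- by move=> x /andP[ax _]; apply: hC; exact: le_trans ax.
Qed.

Lemma Rint_shellD (h : 'rV[R]_d -> R) a b c : a <= b -> b <= c ->
  M.-integrable (shell a c) (EFin \o h) ->
  \int[M]_(x in shell a c) h x =
  \int[M]_(x in shell a b) h x + \int[M]_(x in shell b c) h x.
Proof.
move=> ab bc hi.
have E : shell a c = shell a b `|` shell b c.
  apply/seteqP; split => x; rewrite /shell/=.
    by move=> /andP[ax xc]; case: (ltP (P x) b) => xb; [left; rewrite ax|right].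
  case=> /andP[h1 h2]; apply/andP; split=> //.
    exact: lt_le_trans bc.
  exact: le_trans h1.
rewrite E Rintegral_setU//.
- exact: measurable_shell.
- exact: measurable_shell.
- by rewrite -E.
- by apply/disj_setPS => x [/= /andP[_ xb] /andP[]]; rewrite leNgt xb.
Qed.

(** The thin shell has measure T^mu (e^{s mu} - 1) vol, of order s, and |h| <= c / T on it. As mu <
    1, T^(mu-1) <= T1^(mu-1), so one bound serves both ends of a shell. *)
Lemma shell_boundary (h : 'rV[R]_d -> R) T1 c s : 0 < T1 -> 0 <= c -> 0 <= s <= 1 ->
  measurable_fun setT h -> (forall x, T1 <= P x -> `|h x| <= c / P x) ->
  forall T, T1 <= T ->
  `|\int[M]_(x in shell T (T * expR s)) h x| <= expR 1 * vol * c * T1 `^ (mu - 1) * s.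
Proof.
move=> T10 c0 /andP[s0 s1] mh hc T TT.
have T0 : 0 < T by exact: lt_le_trans TT.
have es1 : 1 <= expR s by rewrite -expR0 ler_expR.
have TTs : T <= T * expR s by rewrite ler_peMr// ltW.
have hb x : shell T (T * expR s) x -> `|h x| <= c / T.
  move=> /andP[Tx _]; apply: (le_trans (hc _ (le_trans TT Tx))).
  by rewrite ler_wpM2l// lef_pV2// posrE (lt_le_trans T0).
have := Rint_bound (measurable_shell _ _) (shell_fin _ _) (measurable_funTS mh) hb.
move/le_trans; apply.
rewrite lebM_shellE//= powRM ?expR_ge0 ?(ltW T0)// -expRM.
have -> : c / T * ((T `^ mu * expR (s * mu) - T `^ mu) * vol) =
    c * vol * (T `^ (mu - 1) * (expR (s * mu) - 1)).
  have -> : T `^ (mu - 1) = T `^ mu / T.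
    rewrite powRB; first by rewrite powRr1// ltW.
    by rewrite (gt_eqF T0) implybT.
  by field; rewrite gt_eqF.
have -> : expR 1 * vol * c * T1 `^ (mu - 1) * s = c * vol * (T1 `^ (mu - 1) * (s * expR 1)).
  by ring.
apply: ler_wpM2l; first by rewrite mulr_ge0// vol_ge0.
apply: ler_pM; rewrite ?powR_ge0//.
- by rewrite subr_ge0 -expR0 ler_expR mulr_ge0.
- by apply: powR_anti => //; rewrite subr_le0 ltW.
have smu : s * mu <= s by rewrite ler_piMr// ltW.
have h1 : expR (s * mu) <= expR s by rewrite ler_expR.
have h2 : 1 - s <= expR (- s) by exact: expR_ge1Dx.
have h3 : expR s * expR (- s) = 1 by rewrite expRxMexpNx_1.
have h4 : expR s <= expR 1 by rewrite ler_expR.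
have h5 : expR s - 1 <= s * expR s.
  rewrite -h3; have := ler_wpM2l (expR_ge0 s) h2; lra.
have h6 : s * expR s <= s * expR 1 by rewrite ler_wpM2l.
lra.
Qed.

(** Since T1 e^s <= T2 the shifted shell still overlaps the original, and all but one thin shell at
    each end cancels; hence the factor 2. *)
Lemma shell_flow_diff (h : 'rV[R]_d -> R) T1 T2 c s : 0 < T1 -> 0 <= c ->
  0 <= s <= 1 -> T1 * expR s <= T2 ->
  measurable_fun setT h -> (forall x, T1 <= P x -> `|h x| <= c / P x) ->
  `|\int[M]_(x in shell T1 T2) (expR (s * mu) * h (x *m eflow F s) - h x)|
   <= 2 * (expR 1 * vol * c * T1 `^ (mu - 1)) * s.
Proof.
move=> T10 c0 s01 T12 mh hc; have /andP[s0 s1] := s01.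
have es1 : 1 <= expR s by rewrite -expR0 ler_expR.
have TTs : T1 <= T1 * expR s by rewrite ler_peMr// ltW.
have TT2 : T1 <= T2 by exact: le_trans T12.
have T20 : 0 < T2 by exact: lt_le_trans TT2.
have T2s : T2 <= T2 * expR s by rewrite ler_peMr// ltW.
have hC x : T1 <= P x -> `|h x| <= c / T1.
  move=> Tx; apply: (le_trans (hc _ Tx)).
  by rewrite ler_wpM2l// lef_pV2// posrE (lt_le_trans T10).
have hi a b : T1 <= a -> M.-integrable (shell a b) (EFin \o h).
  exact: shell_integrable mh hC.
have mhs : measurable_fun setT (fun x => h (x *m eflow F s)).
  exact: measurableT_comp mh (measurable_mulmxr (eflow F s)).
have hsC x : T1 <= P x -> `|h (x *m eflow F s)| <= c / T1.
  move=> Tx; apply: hC; rewrite P_flow (le_trans Tx)// ler_peMl//.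
have hsi : M.-integrable (shell T1 T2) (EFin \o (fun x => h (x *m eflow F s))).
  exact: shell_integrable mhs hsC _.
rewrite RintegralB//; last 3 first.
- exact: measurable_shell.
- apply: (fin_integrable (C := expR (s * mu) * (c / T1))).
  + exact: measurable_shell.
  + exact: shell_fin.
  + by apply: measurable_funTS; apply: measurable_funM.
  + move=> x /andP[Tx _]; rewrite normrM ger0_norm ?expR_ge0//.
    by rewrite ler_wpM2l ?expR_ge0// hsC.
- exact: hi.
rewrite RintegralZl//; last exact: measurable_shell.
have -> : expR (s * mu) * \int[M]_(x in shell T1 T2) h (x *m eflow F s) =
    \int[M]_(x in shell (T1 * expR s) (T2 * expR s)) h x.
  rewrite -(@Rint_flow _ h s).
    congr (_ * _); congr (Rintegral _ _ _); apply/seteqP; split => x;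
    by rewrite /shell/= P_flow ![expR s * _]mulrC ler_pM2r ?expR_gt0// ltr_pM2r ?expR_gt0.
  have := hi _ (T2 * expR s) TTs.
  move/(integrable_mkcond _ (measurable_shell _ _)).
  by rewrite -restrict_EFin.
have E1 := Rint_shellD TTs T12 (hi _ T2 (lexx _)).
have E2 := Rint_shellD T12 T2s (hi _ (T2 * expR s) TTs).
have B1 := shell_boundary T10 c0 s01 mh hc (lexx T1).
have B2 := shell_boundary T10 c0 s01 mh hc TT2.
rewrite E1 E2.
set B := expR 1 * vol * c * T1 `^ (mu - 1) in B1 B2 *.
rewrite [X in `|X|](_ : _ = \int[M]_(x in shell T2 (T2 * expR s)) h x -
  \int[M]_(x in shell T1 (T1 * expR s)) h x); last by ring.
apply: (le_trans (ler_normB _ _)); rewrite -mulrA mulr2n mulrDl mul1r.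
by rewrite lerD.
Qed.

Lemma der_flow (h : 'rV[R]_d -> R) x s (k : R) :
  is_derive (0 : R) 1 (fun u => h ((x *m eflow F s) *m eflow F u)) k ->
  is_derive s 1 (fun u => h (x *m eflow F u)) k.
Proof.
move=> hk.
rewrite (_ : (fun _ => _) = fun u => h ((x *m eflow F s) *m eflow F (u - s))); last first.
  by apply/funext => u; rewrite -mulmxA -eflowD addrC subrK.
rewrite -(subrr s) in hk.
apply: (der_eq (der_comp (g := fun u => u - s) hk (derB (derI s) (derC s s)))).
by rewrite subr0 mul1r.
Qed.

(* Push the shell by the flow for a small time s: the integral of
   e^{mu s} h(G_s y) - h(y) is the difference of the integrals of h over two thin shells.
   Dividing by s and letting s tend to 0 by dominated convergence gives the bound. *)
Lemma flow_ibp (h k : 'rV[R]_d -> R) (T1 T2 c C : R) : 0 < T1 -> T1 < T2 -> 0 <= c ->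
  measurable_fun setT h -> measurable_fun setT k ->
  (forall x, T1 <= P x -> is_derive (0 : R) 1 (fun s => h (x *m eflow F s)) (k x)) ->
  (forall x, T1 <= P x -> `|h x| <= c / P x) ->
  (forall x, T1 <= P x -> `|k x| <= C) ->
  `|\int[M]_(x in shell T1 T2) (k x + mu * h x)|
   <= 2 * (expR 1 * vol * c * T1 `^ (mu - 1)).
Proof.
move=> T10 T12 c0 mh mk hd hc kC.
set B := 2 * _.
(* Times up to L satisfy both s <= 1 and T1 e^s <= T2. *)
pose L := Num.min 1 (ln (T2 / T1)).
have L0 : 0 < L.
  by rewrite lt_min ltr01/= ln_gt0// ltr_pdivlMr// mul1r.
have hL s : s <= L -> T1 * expR s <= T2.
  move=> sL; rewrite mulrC -ler_pdivlMr//.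
  have eT : expR (ln (T2 / T1)) = T2 / T1.
    by rewrite lnK// posrE divr_gt0//; exact: lt_trans T12.
  rewrite -eT ler_expR.
  by apply: (le_trans sL); rewrite ge_min lexx orbT.
pose dl (n : nat) : R := L / n.+1%:R.
have dl0 n : 0 < dl n by rewrite divr_gt0.
have dlL n : dl n <= L by rewrite ler_pdivrMr// ler_peMr ?ler1n// ltW.
have dl1 n : dl n <= 1 by apply: (le_trans (dlL n)); rewrite ge_min lexx.
have dlc : dl @ \oo --> (0 : R).
  rewrite -(mulr0 L); apply: cvgMl_tmp; exact: cvg_harmonic.
have hC x : T1 <= P x -> `|h x| <= c / T1.
  move=> Tx; apply: (le_trans (hc _ Tx)).
  by rewrite ler_wpM2l// lef_pV2// posrE (lt_le_trans T10).
pose g x s := expR (s * mu) * h (x *m eflow F s).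
pose g' x s := expR (s * mu) * (k (x *m eflow F s) + mu * h (x *m eflow F s)).
have gd x s : 0 <= s -> T1 <= P x -> is_derive s 1 (g x) (g' x s).
  move=> s0 Tx.
  have Txs : T1 <= P (x *m eflow F s).
    by rewrite P_flow (le_trans Tx)// ler_peMl// -expR0 ler_expR.
  have e1 := der_comp (g := fun s => s * mu) (is_derive_expR (s * mu)) (derM (derI s) (derC mu s)).
  by apply: (der_eq (derM e1 (der_flow (hd _ Txs)))); rewrite /g'; ring.
pose f n x := (g x (dl n) - g x 0) / dl n.
have mflow s : measurable_fun setT (fun x => h (x *m eflow F s)).
  exact: measurableT_comp mh (measurable_mulmxr (eflow F s)).
have mf n : measurable_fun setT (f n).
  apply: measurable_funM => //; apply: measurable_funB; exact: measurable_funM.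
have C0 x : T1 <= P x -> 0 <= C by move=> /kC; exact: le_trans.
(* Bounds the derivative of s |-> e^{s mu} h(G_s x) for 0 <= s <= 1, hence the difference quotients,
   by the mean value theorem. *)
pose D := expR 1 * (C + c / T1).
have fD n x : shell T1 T2 x -> `|f n x| <= D.
  move=> /andP[Tx _].
  suff hb : `|g x (dl n) - g x 0| <= D * (dl n - 0).
    by rewrite subr0 in hb; rewrite /f normrM normfV (gtr0_norm (dl0 n)) ler_pdivrMr.
  apply: (@der_MVT_bound R (g x) (g' x) 0 (dl n) D (ltW (dl0 n))).
    by move=> s /andP[s0 _]; exact: gd.
  move=> s /andP[s0 sd]; rewrite /g' normrM ger0_norm ?expR_ge0//.
  have s1 : s <= 1 by exact: le_trans (dl1 n).
  have Txs : T1 <= P (x *m eflow F s).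
    by rewrite P_flow (le_trans Tx)// ler_peMl// -expR0 ler_expR.
  apply: ler_pM => //.
    rewrite ler_expR; apply: (@le_trans _ _ (s * 1)); last by rewrite mulr1.
    by rewrite ler_wpM2l// ltW.
  apply: (le_trans (ler_normD _ _)); apply: lerD; first exact: kC.
  rewrite normrM ger0_norm//; apply: (@le_trans _ _ (1 * `|h (x *m eflow F s)|)).
    by rewrite ler_wpM2r// ltW.
  by rewrite mul1r; exact: hC.
have fk x : shell T1 T2 x -> f ^~ x @ \oo --> k x + mu * h x.
  move=> /andP[Tx _].
  (* The Caratheodory slope function is continuous at 0 and takes the difference quotients as its
     values along [dl]. *)
  have [psi [h1 h2 h3]] := (is_derive1_caratheodory (g x) 0 (g' x 0)).1 (gd x 0 (lexx _) Tx).
  have <- : psi 0 = k x + mu * h x.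
    by rewrite h3 /g' mul0r expR0 mul1r eflow0 mulmx1.
  rewrite (_ : f ^~ x = psi \o dl); last first.
    by apply/funext => n; rewrite /f h1 subr0 /= mulfK// gt_eqF.
  exact: (cvg_comp _ _ dlc h2).
have fkE x : shell T1 T2 x -> (fun n => (f n x)%:E) @ \oo --> (k x + mu * h x)%:E.
  by move=> Sx; apply/fine_cvgP; split; [exact: nearW|exact: fk].
have fi n : `|\int[M]_(x in shell T1 T2) f n x| <= B.
  have := shell_flow_diff T10 c0 _ (hL _ (dlL n)) mh hc.
  rewrite (ltW (dl0 n)) dl1 => /(_ isT) hb.
  rewrite -(ler_pM2r (dl0 n)) -{1}(gtr0_norm (dl0 n)) -normrM.
  rewrite -RintegralZr//; last 2 first.
  - exact: measurable_shell.
  - apply: (fin_integrable (C := D)); [exact: measurable_shell|exact: shell_fin| |exact: fD].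
    exact: measurable_funTS.
  rewrite (@eq_Rintegral _ _ _ M _ (fun x => expR (dl n * mu) * h (x *m eflow F (dl n)) - h x))//.
  move=> x _; rewrite /f divfK ?gt_eqF//.
  by rewrite /g mul0r expR0 mul1r eflow0 mulmx1.
have mS := measurable_shell T1 T2.
have mK : measurable_fun setT (fun x => k x + mu * h x).
  by apply: measurable_funD => //; exact: measurable_funM.
have [|||||_ _ cv] := @dominated_convergence _ _ R M (shell T1 T2) mS
  (fun n x => (f n x)%:E) (fun x => (k x + mu * h x)%:E) (fun _ => D%:E).
- by move=> n; apply/measurable_EFinP; exact: measurable_funTS.
- by apply/measurable_EFinP; exact: measurable_funTS.
- by apply: aeW => x Sx; exact: fkE.
- by apply: (fin_integrable (f := cst D) (C := `|D|) mS (shell_fin _ _)).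
- by apply: aeW => x n Sx; rewrite lee_fin; exact: fD.
have Sint : M.-integrable (shell T1 T2) (EFin \o (fun x => k x + mu * h x)).
  apply: (shell_integrable (T1 := T1) (C := C + mu * (c / T1))) => // x Tx.
  apply: (le_trans (ler_normD _ _)); apply: lerD; first exact: kC.
  by rewrite normrM ger0_norm// ler_wpM2l// hC.
have cvr : (fun n => \int[M]_(x in shell T1 T2) f n x) @ \oo -->
    \int[M]_(x in shell T1 T2) (k x + mu * h x).
  apply: fine_cvg; rewrite fineK//.
  exact: integrable_fin_num Sint.
have cn : (fun n => `|\int[M]_(x in shell T1 T2) f n x|) @ \oo -->
    `|\int[M]_(x in shell T1 T2) (k x + mu * h x)|.
  by apply: cvg_norm; exact: cvr.
rewrite -(cvg_lim _ cn)//; apply: limr_le; first by apply/cvg_ex; eexists; exact: cn.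
exact: nearW.
Qed.

(** Integration by parts with h = 1 / P, whose flow derivative is - 1 / P, so that k + mu h = (mu -
    1) / P. *)
Lemma inv_shell_bound T1 T2 : 0 < T1 -> T1 <= T2 ->
  (1 - mu) * \int[M]_(x in shell T1 T2) (P x)^-1
    <= 2 * (expR 1 * vol * T1 `^ (mu - 1)).
Proof.
move=> T10; rewrite le_eqVlt => /predU1P[<-|T12].
  rewrite (_ : shell T1 T1 = set0) ?Rintegral_set0 ?mulr0.
    by rewrite !mulr_ge0 ?expR_ge0 ?vol_ge0 ?powR_ge0.
  by apply/seteqP; split => x //= /andP[]; rewrite leNgt => /negP.
have mPi : measurable_fun setT (fun x => (P x)^-1) by exact: measurableT_comp measurable_inv mP.
have pos x : T1 <= P x -> 0 < P x by exact: lt_le_trans.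
have bd x : T1 <= P x -> `|(P x)^-1| <= T1^-1.
  by move=> Tx; rewrite gtr0_norm ?invr_gt0 ?pos// lef_pV2// posrE pos.
have mPn : measurable_fun setT (fun x => - (P x)^-1).
  rewrite (_ : (fun _ => _) = fun x => (-1) * (P x)^-1).
    exact: measurable_funM.
  by apply/funext => x; rewrite mulN1r.
have := flow_ibp T10 T12 ler01 mPi mPn _ _ _ (C := T1^-1).
have ipi : M.-integrable (shell T1 T2) (EFin \o (fun x => (P x)^-1)).
  exact: shell_integrable mPi bd _.
rewrite (@eq_Rintegral _ _ _ M _ (fun x => (mu - 1) * (P x)^-1)); last first.
  by move=> x _; rewrite mulrBl mul1r addrC.
rewrite RintegralZl//; last exact: measurable_shell.
rewrite normrM (ler0_norm (_ : mu - 1 <= 0)) ?subr_le0 ?(ltW mu1)// opprB mulr1.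
rewrite ger0_norm; last first.
  by apply: Rintegral_ge0 => x _; rewrite invr_ge0.
apply.
- move=> x Tx; have P0 := pos _ Tx.
  rewrite (_ : (fun _ => _) = fun s => expR (- s) * (P x)^-1); last first.
    by apply/funext => s; rewrite P_flow invfM expRN.
  apply: (der_eq (derM (der_comp (g := fun s => - s) (is_derive_expR (- 0)) (derN (derI 0))) (derC _ 0))).
  by rewrite oppr0 expR0; ring.
- by move=> x Tx; rewrite div1r ger0_norm// invr_ge0.
- by move=> x Tx; rewrite normrN bd.
Qed.

(** * Oscillatory integrals with phase t Q + x.y and their limits *)

Variable Q : 'rV[R]_d -> R.
Hypothesis cQ : continuous Q.
Hypothesis QP : forall x, `|Q x| = P x.
Hypothesis Q_flow : forall x s, Q (x *m eflow F s) = expR s * Q x.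

Lemma der_dotp x y :
  is_derive (0 : R) 1 (fun s => dotp x (y *m eflow F s)) (dotp x (y *m F)).
Proof.
apply: der_eq.
  apply: der_sum => i; apply: derZ.
  rewrite (_ : (fun _ => _) = fun s => \sum_j y 0 j * eflow F s j i); last first.
    by apply/funext => s; rewrite mxE.
  apply: der_sum => j; apply: derZ; exact: der_eflowl.
by rewrite /dotp eflow0 mulmx1; apply: eq_bigr => i _; rewrite mxE.
Qed.

(** Used with B = F and B = F^2, the first and second flow derivatives of x.y. K depends on neither
    x nor y, which yields uniformity for x in a compact set. *)
Lemma dotp_growth (B : 'M[R]_d) : exists2 K : R, 0 <= K &
  forall x y (X : R), (forall i, `|x 0 i| <= X) -> 1 <= P y ->
  `|dotp x (y *m B)| <= X * K * P y `^ mu.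
Proof.
have [C C0 hC] := superlevel_growth cP P_ge0 P_eq0 P_flow P_compact.
exists (\sum_(i < d) \sum_(j < d) C * `|B j i|).
  by do 2 (apply: sumr_ge0 => ? _); rewrite mulr_ge0.
move=> x y X hX Py; rewrite -mulrA mulr_suml mulr_sumr.
apply: (le_trans (ler_norm_sum _ _ _)); apply: ler_sum => i _.
rewrite normrM ler_pM// mxE mulr_suml.
apply: (le_trans (ler_norm_sum _ _ _)); apply: ler_sum => j _.
by rewrite normrM mulrAC ler_wpM2r//; exact: hC.
Qed.

(** Equivalent to p^(1-mu) >= 2 C / t0. The 1 added in a makes the threshold at least 1. *)
Lemma powR_dominates (C t0 : R) : 0 <= C -> 0 < t0 -> exists2 T0 : R, 1 <= T0 &
  forall p, T0 <= p -> C * p `^ mu <= t0 / 2 * p.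
Proof.
move=> C0 t00; pose a := 1 + 2 * C / t0.
have a1 : 1 <= a by rewrite lerDl divr_ge0 ?mulr_ge0// ltW.
have m1 : 0 < 1 - mu by rewrite subr_gt0.
exists (a `^ (1 - mu)^-1).
  by rewrite -[leLHS](powRr0 a) ler_powR// invr_ge0 ltW.
move=> p ap.
have p0 : 0 < p by apply: lt_le_trans ap; rewrite powR_gt0//; lra.
have : a <= p `^ (1 - mu).
  have -> : a = (a `^ (1 - mu)^-1) `^ (1 - mu).
    by rewrite -powRrM mulVf ?powRr1 ?(le_trans ler01 a1)// gt_eqF.
  by apply: ge0_ler_powR; rewrite ?nnegrE ?powR_ge0 ?(ltW p0)// ltW.
move=> h.
have pE : p = p `^ mu * p `^ (1 - mu).
  rewrite -powRD; first by rewrite addrC subrK powRr1// ltW.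
  by rewrite (gt_eqF p0) implybT.
have h2 : C <= t0 / 2 * p `^ (1 - mu).
  apply: (@le_trans _ _ (t0 / 2 * a)).
    rewrite /a mulrDr mulr1 (_ : t0 / 2 * (2 * C / t0) = C); last by field; rewrite gt_eqF.
    by rewrite lerDr divr_ge0// ltW.
  by rewrite ler_wpM2l// divr_ge0// ltW.
rewrite {2}pE mulrCA [leLHS]mulrC; apply: ler_wpM2l => //; exact: powR_ge0.
Qed.

Lemma measurable_dotp x : measurable_fun setT (fun y : 'rV[R]_d => dotp x y).
Proof.
apply: measurable_sum => i; apply: measurable_funM => //; exact: measurable_coord.
Qed.

(** th = 0 gives the real part of the integrand; th = pi / 2 turns the cosine into minus the sine,
    its imaginary part. *)
Definition phase t x th y : R := t * Q y + dotp x y + th.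

Lemma measurable_Q : measurable_fun setT Q.
Proof. exact: continuous_measurable. Qed.

Lemma measurable_phase t x th : measurable_fun setT (phase t x th).
Proof.
apply: measurable_funD => //; apply: measurable_funD; last exact: measurable_dotp.
by apply: measurable_funM => //; exact: measurable_Q.
Qed.

Lemma measurable_cos_phase t x th : measurable_fun setT (fun y => cos (phase t x th y)).
Proof.
apply: measurableT_comp (measurable_phase t x th).
apply: continuous_measurable_fun; exact: continuous_cos.
Qed.

Lemma measurable_sin_phase t x th : measurable_fun setT (fun y => sin (phase t x th y)).
Proof.
apply: measurableT_comp (measurable_phase t x th).
apply: continuous_measurable_fun; exact: continuous_sin.
Qed.

(** With h = sin(phase) / D1 the integration by parts controls cos(phase) only up to E = r - mu h.
    This error is O(1 / (t P)) and is absorbed by the integral of 1 / P. *)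
Lemma shell_oscillation (t0 X : R) : 0 < t0 -> 0 <= X ->
  exists T0 K : R, [/\ 1 <= T0, 0 <= K &
  forall t x th T1 T2, t0 <= t -> (forall i, `|x 0 i| <= X) -> T0 <= T1 -> T1 <= T2 ->
  `|\int[M]_(y in shell T1 T2) cos (phase t x th y)| <= K * T1 `^ (mu - 1)].
Proof.
move=> t00 X0.
have [K1 K10 hK1] := dotp_growth F.
have [K2 K20 hK2] := dotp_growth (F *m F).
have XK1 : 0 <= X * K1 by exact: mulr_ge0.
have XK2 : 0 <= X * K2 by exact: mulr_ge0.
(* Beyond T0 both x-dependent terms are at most (t / 2) P, so D1 and D2 are comparable with t P. *)
have [T0 T01 hT0] := powR_dominates (addr_ge0 XK1 XK2) t00.
have m1 : 0 < 1 - mu by rewrite subr_gt0.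
pose c0 := 2 * (expR 1 * vol).
have c00 : 0 <= c0 by rewrite mulr_ge0// mulr_ge0 ?expR_ge0 ?vol_ge0.
have cc : 0 <= c0 * (2 / t0) + 10 / t0 * (c0 / (1 - mu)).
  by rewrite addr_ge0// mulr_ge0// divr_ge0// ?(ltW t00) ?(ltW m1).
exists T0, (c0 * (2 / t0) + 10 / t0 * (c0 / (1 - mu))); split => //.
move=> t x th T1 T2 tt hx TT1; rewrite le_eqVlt => /predU1P[<-|T12].
  rewrite (_ : shell T1 T1 = set0) ?Rintegral_set0 ?normr0.
    by rewrite mulr_ge0// powR_ge0.
  by apply/seteqP; split => y //= /andP[]; rewrite leNgt => /negP.
have T10 : 0 < T1 by lra.
have t_gt0 : 0 < t by lra.
pose D1 y := t * Q y + dotp x (y *m F).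
pose D2 y := t * Q y + dotp x (y *m (F *m F)).
have mD1 : measurable_fun setT D1.
  apply: measurable_funD; first by apply: measurable_funM => //; exact: measurable_Q.
  exact: measurableT_comp (measurable_dotp x) (measurable_mulmxr F).
have mD2 : measurable_fun setT D2.
  apply: measurable_funD; first by apply: measurable_funM => //; exact: measurable_Q.
  exact: measurableT_comp (measurable_dotp x) (measurable_mulmxr (F *m F)).
have mD1i : measurable_fun setT (fun y => (D1 y)^-1) by exact: measurableT_comp measurable_inv mD1.
have bounds y : T1 <= P y -> [/\ 0 < P y, 1 <= P y, t / 2 * P y <= `|D1 y| & `|D2 y| <= 2 * t * P y].
  move=> Ty; have Py1 : 1 <= P y by lra.
  have h1 := hK1 x y X hx Py1; have h2 := hK2 x y X hx Py1.
  have h3 := hT0 _ (le_trans TT1 Ty).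
  have p0 := powR_ge0 (P y) mu.
  have s1 : `|dotp x (y *m F)| <= t / 2 * P y.
    apply: (le_trans h1); apply: (@le_trans _ _ (t0 / 2 * P y)); last by nra.
    by apply: le_trans h3; rewrite ler_wpM2r// lerDl.
  have s2 : `|dotp x (y *m (F *m F))| <= t / 2 * P y.
    apply: (le_trans h2); apply: (@le_trans _ _ (t0 / 2 * P y)); last by nra.
    by apply: le_trans h3; rewrite ler_wpM2r// lerDr.
  have tQ : `|t * Q y| = t * P y by rewrite normrM QP gtr0_norm.
  have tP : 0 <= t * P y by rewrite mulr_ge0 ?ltW//; lra.
  split => //; first lra.
    have := lerB_normD (t * Q y) (dotp x (y *m F)); rewrite tQ -/(D1 y); lra.
  have := ler_normD (t * Q y) (dotp x (y *m (F *m F))); rewrite tQ -/(D2 y); lra.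
(* The term that arises when 1 / D1 is differentiated. *)
pose r y := sin (phase t x th y) * D2 y / (D1 y) ^+ 2.
pose h y := sin (phase t x th y) / D1 y.
pose k y := cos (phase t x th y) - r y.
have mr : measurable_fun setT r.
  apply: measurable_funM; first by apply: measurable_funM => //; exact: measurable_sin_phase.
  rewrite (_ : (fun _ => _) = fun y => (D1 y)^-1 * (D1 y)^-1).
    exact: measurable_funM.
  by apply/funext => y; rewrite expr2 invfM.
have mh : measurable_fun setT h by apply: measurable_funM => //; exact: measurable_sin_phase.
have mk : measurable_fun setT k by apply: measurable_funB => //; exact: measurable_cos_phase.
have D1n0 y : T1 <= P y -> D1 y != 0.
  move=> /bounds[p0 _ h1 _]; rewrite -normr_gt0; apply: lt_le_trans h1.
  by rewrite mulr_gt0// divr_gt0.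
have hd y : T1 <= P y -> is_derive (0 : R) 1 (fun s => h (y *m eflow F s)) (k y).
  move=> Ty.
  have dQ : is_derive (0 : R) 1 (fun s => t * Q (y *m eflow F s)) (t * Q y).
    rewrite (_ : (fun _ => _) = fun s => t * (expR s * Q y)); last first.
      by apply/funext => s; rewrite Q_flow.
    apply: (der_eq (derZ t (derM (is_derive_expR 0) (derC (Q y) 0)))).
    by rewrite expR0; ring.
  have dph : is_derive (0 : R) 1 (fun s => phase t x th (y *m eflow F s)) (D1 y).
    apply: (der_eq (derD (derD dQ (der_dotp x y)) (derC th 0))).
    by rewrite addr0.
  have dD1 : is_derive (0 : R) 1 (fun s => D1 (y *m eflow F s)) (D2 y).
    rewrite (_ : (fun _ => _) = fun s => t * Q (y *m eflow F s) + dotp x (y *m F *m eflow F s)).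
      by apply: (der_eq (derD dQ (der_dotp x (y *m F)))); rewrite /D2 mulmxA.
    by apply/funext => s; rewrite /D1 -!mulmxA eflow_comm.
  have ph0 : phase t x th (y *m eflow F 0) = phase t x th y by rewrite eflow0 mulmx1.
  have D10 : D1 (y *m eflow F 0) = D1 y by rewrite eflow0 mulmx1.
  have D1n : D1 (y *m eflow F 0) != 0 by rewrite D10 D1n0.
  have := derM (der_comp (g := fun s => phase t x th (y *m eflow F s)) (is_derive_sin _) dph)
    (derV (f := fun s => D1 (y *m eflow F s)) D1n dD1).
  move/der_eq; apply; rewrite ph0 D10 /k /r.
  have D1y := D1n0 y Ty; by field.
have hb y : T1 <= P y -> `|h y| <= (2 / t) / P y.
  move=> Ty; have [p0 _ h1 _] := bounds y Ty.
  rewrite normrM normfV; apply: (@le_trans _ _ (1 * (t / 2 * P y)^-1)).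
    apply: ler_pM; rewrite ?invr_ge0//; first by rewrite ler_norml sin_geN1 sin_le1.
    by rewrite lef_pV2// posrE ?normr_gt0 ?D1n0// mulr_gt0// divr_gt0.
  by rewrite mul1r invfM invf_div.
(* 8 / t comes from 2 t P over (t P / 2)^2; adding 2 / t for mu h gives the 10 / t below. *)
have rb y : T1 <= P y -> `|r y| <= (8 / t) / P y.
  move=> Ty; have [p0 _ h1 h2] := bounds y Ty.
  have tp : 0 < t / 2 * P y by rewrite mulr_gt0// divr_gt0.
  rewrite !normrM normfV normrX.
  apply: (@le_trans _ _ (1 * (2 * t * P y) * ((t / 2 * P y) ^+ 2)^-1)).
    apply: ler_pM; rewrite ?invr_ge0 ?mulr_ge0 ?exprn_ge0//.
      by apply: ler_pM => //; rewrite ler_norml sin_geN1 sin_le1.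
    rewrite lef_pV2 ?posrE ?exprn_gt0// ?normr_gt0 ?D1n0//.
    by rewrite lerXn2r// nnegrE// ltW.
  by rewrite le_eqVlt; apply/orP; left; apply/eqP; field; rewrite !gt_eqF.
have invT y : T1 <= P y -> (P y)^-1 <= 1.
  by move=> /bounds[p0 p1 _ _]; rewrite invf_le1.
have kb y : T1 <= P y -> `|k y| <= 1 + 8 / t.
  move=> Ty; apply: (le_trans (ler_normB _ _)); apply: lerD.
    by rewrite ler_norml cos_geN1 cos_le1.
  by apply: (le_trans (rb _ Ty)); rewrite ler_piMr ?invT ?divr_ge0 ?(ltW t_gt0).
have t2 : 0 <= 2 / t by rewrite divr_ge0// ltW.
have main := flow_ibp T10 T12 t2 mh mk hd hb kb.
pose E y := r y - mu * h y.
have mE : measurable_fun setT E by apply: measurable_funB => //; exact: measurable_funM.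
have Eb y : T1 <= P y -> `|E y| <= 10 / t / P y.
  move=> Ty; apply: (le_trans (ler_normB _ _)).
  have -> : 10 / t / P y = 8 / t / P y + 2 / t / P y by ring.
  apply: lerD; first exact: rb.
  rewrite normrM ger0_norm//; apply: le_trans (hb _ Ty).
  by rewrite ler_piMl// ltW.
have mS := measurable_shell T1 T2.
have kh_int : M.-integrable (shell T1 T2) (EFin \o (fun y => k y + mu * h y)).
  apply: (shell_integrable (T1 := T1) (C := 1 + 8 / t + mu * (2 / t))) => //.
    by apply: measurable_funD => //; exact: measurable_funM.
  move=> y Ty; apply: (le_trans (ler_normD _ _)); apply: lerD; first exact: kb.
  rewrite normrM ger0_norm// ler_wpM2l//; apply: (le_trans (hb _ Ty)).
  by rewrite ler_piMr ?invT.
have E_int : M.-integrable (shell T1 T2) (EFin \o E).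
  apply: (shell_integrable (T1 := T1) (C := 10 / t)) => // y Ty.
  by apply: (le_trans (Eb _ Ty)); rewrite ler_piMr ?invT ?divr_ge0 ?(ltW t_gt0).
have Pi_int : M.-integrable (shell T1 T2) (EFin \o (fun y => (P y)^-1)).
  apply: (shell_integrable (T1 := T1) (C := 1)) => //.
    exact: measurableT_comp measurable_inv mP.
  by move=> y Ty; rewrite ger0_norm ?invr_ge0// invT.
rewrite (@eq_Rintegral _ _ _ M _ (fun y => (k y + mu * h y) + E y)); last first.
  by move=> y _; rewrite /k /E; ring.
rewrite RintegralD//; apply: (le_trans (ler_normD _ _)).
rewrite mulrDl; apply: lerD.
  apply: (le_trans main).
  have -> : 2 * (expR 1 * vol * (2 / t) * T1 `^ (mu - 1)) = c0 * (2 / t) * T1 `^ (mu - 1).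
    by rewrite /c0; ring.
  rewrite ler_wpM2r ?powR_ge0// ler_wpM2l// ler_wpM2l// lef_pV2// posrE; lra.
apply: (le_trans (le_normr_Rintegral mS E_int)).
apply: (@le_trans _ _ (\int[M]_(y in shell T1 T2) (10 / t * (P y)^-1))).
  apply: le_Rintegral => //.
  - by have := integrable_abse E_int.
  - by apply: (integrableZl mS (10 / t)) Pi_int.
  - by move=> y /andP[Ty _]; exact: Eb.
rewrite RintegralZl// -[leRHS]mulrA; apply: ler_pM => //.
- by rewrite divr_ge0// ltW.
- by apply: Rintegral_ge0 => y _; rewrite invr_ge0.
- rewrite ler_wpM2l// lef_pV2// posrE; lra.
rewrite mulrAC ler_pdivlMr// mulrC.
have := inv_shell_bound T10 (ltW T12); rewrite /c0 !mulrA; exact.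
Qed.

Lemma below_sub_rbox b : exists2 r : R, 0 < r & below b `<=` rbox 0 r.
Proof.
have [b0|b0] := leP b 0.
  by exists 1 => // x xb; have := P_ge0 x; move: xb; rewrite /below/= ltNge => /negP[]; exact: le_trans b0 _.
have [N N0 hN] := sublevel_bounded cP P_ge0 P_eq0 P_flow P_compact.
pose G := eflow F (ln b).
(* {P < b} is the image of {P < 1} under G; the 1 keeps the radius positive and the inclusion
   strict. *)
exists (1 + \sum_i \sum_j N * `|G j i|).
  apply: ltr_pwDl => //; do 2 (apply: sumr_ge0 => ? _).
  by rewrite mulr_ge0// ltW.
move=> x xb i; rewrite !mxE subr0.
have -> : x = (x *m eflow F (- ln b)) *m G.
  by have := eflowN F (- ln b); rewrite opprK -mulmxA => ->; rewrite mulmx1.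
set y := x *m _.
have Ny : `|y| <= N.
  by apply/ltW/hN; rewrite P_flow expRN lnK// ler_pdivrMl// mulr1 ltW.
apply: (@le_lt_trans _ _ (\sum_j N * `|G j i|)).
  rewrite mxE; apply: (le_trans (ler_norm_sum _ _ _)); apply: ler_sum => j _.
  by rewrite normrM ler_wpM2r//; exact: le_trans (coord_le_norm _ _) Ny.
rewrite [X in _ < 1 + X](bigD1 i)//=.
apply: (@lt_le_trans _ _ (1 + \sum_j N * `|G j i|)); first by rewrite ltrDr.
rewrite lerD2l lerDl; do 2 (apply: sumr_ge0 => ? _).
by rewrite mulr_ge0// ltW.
Qed.

Definition oscint th b t x : R := \int[M]_(y in below b) cos (phase t x th y).

Lemma cos_phase_bound t x th y : `|cos (phase t x th y)| <= 1.
Proof. by rewrite ler_norml cos_geN1 cos_le1. Qed.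

Lemma cos_phase_integrable (D : set 'rV[R]_d) t x th : measurable D -> (M D < +oo)%E ->
  M.-integrable D (EFin \o (fun y => cos (phase t x th y))).
Proof.
move=> mD Doo; apply: (fin_integrable (C := 1)) => //.
- apply: measurable_funTS; exact: measurable_cos_phase.
- by move=> y _; exact: cos_phase_bound.
Qed.

Lemma oscint_shell th a b t x : a <= b ->
  oscint th b t x - oscint th a t x = \int[M]_(y in shell a b) cos (phase t x th y).
Proof.
move=> ab; rewrite /oscint (below_shellU ab) Rintegral_setU.
- by rewrite addrC addKr.
- exact: measurable_below.
- exact: measurable_shell.
- rewrite -below_shellU//; apply: cos_phase_integrable; first exact: measurable_below.
  exact: below_fin.
- exact: below_shell_disj.
Qed.

(** K a^(mu-1) <= e / 2 for large a is [powR_dominates] with e in the role of t0. *)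
Lemma oscint_tail (t0 X e : R) : 0 < t0 -> 0 <= X -> 0 < e ->
  exists2 T0 : R, 1 <= T0 & forall t x th a b, t0 <= t -> (forall i, `|x 0 i| <= X) ->
  T0 <= a -> a <= b -> `|oscint th b t x - oscint th a t x| <= e.
Proof.
move=> t00 X0 e0.
have [T0 [K [T01 K0 hK]]] := shell_oscillation t00 X0.
have [T1 T11 hT1] := powR_dominates K0 e0.
exists (T0 + T1); first lra.
move=> t x th a b tt hx ha ab; rewrite oscint_shell//.
have a0 : 0 < a by lra.
apply: (le_trans (hK _ _ th _ _ tt hx _ ab)); first lra.
have -> : a `^ (mu - 1) = a `^ mu / a.
  rewrite powRB; first by rewrite powRr1// ltW.
  by rewrite (gt_eqF a0) implybT.
rewrite mulrA ler_pdivrMr//; apply: (le_trans (hT1 _ _)); first lra.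
by rewrite ler_wpM2r ?(ltW a0)//; lra.
Qed.

Lemma oscint_cvg th t x : 0 < t -> cvg ((fun b => oscint th b t x) @ +oo).
Proof.
move=> t0; apply: cauchy_cvg; apply: cauchy_exP => e e0.
have [T0 T01 hT0] := oscint_tail t0 (normr_ge0 x) (divr_gt0 e0 (ltr0n R 2)).
exists (oscint th T0 t x); exists T0; split; first exact: num_real.
move=> b T0b /=; rewrite /ball/= distrC.
apply: (@le_lt_trans _ _ (e / 2)); last lra.
by apply: hT0 => //; [exact: coord_le_norm|exact: ltW].
Qed.

Definition osclim th t x : R := lim ((fun b => oscint th b t x) @ +oo).

Lemma osclim_tail (t0 X e : R) : 0 < t0 -> 0 <= X -> 0 < e ->
  exists2 T0 : R, 1 <= T0 & forall t x th a, t0 <= t -> (forall i, `|x 0 i| <= X) ->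
  T0 <= a -> `|osclim th t x - oscint th a t x| <= e.
Proof.
move=> t00 X0 e0; have [T0 T01 hT0] := oscint_tail t00 X0 e0.
exists T0 => // t x th a tt hx ha.
have tpos : 0 < t by exact: lt_le_trans tt.
have cv : (fun b => `|oscint th b t x - oscint th a t x|) @ +oo -->
    `|osclim th t x - oscint th a t x|.
  by apply: cvg_norm; apply: cvgB; [exact: oscint_cvg|exact: cvg_cst].
rewrite -(cvg_lim _ cv)//; apply: limr_le; first by apply/cvg_ex; eexists; exact: cv.
exists a; split; first exact: num_real.
by move=> b /ltW ab; exact: hT0.
Qed.

Lemma cos_lipschitz (u v : R) : `|cos u - cos v| <= `|u - v|.
Proof.
wlog uv : u v / v <= u.
  by move=> h; have [/h//|/ltW/h] := leP v u; rewrite distrC [`|v - u|]distrC.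
have uv0 : 0 <= u - v by rewrite subr_ge0.
rewrite (ger0_norm uv0) -[leRHS]mul1r.
apply: (@der_MVT_bound R cos (fun z => - sin z)) => // z _.
by rewrite normrN ler_norml sin_geN1 sin_le1.
Qed.

Lemma oscint_lipschitz th b : exists2 C : R, 0 <= C & forall t t' x x',
  `|oscint th b t x - oscint th b t' x'| <= C * (`|t - t'| + `|x - x'|).
Proof.
have [r r0 hr] := below_sub_rbox b.
pose c := `|b| + \sum_(i < d) r.
have c0 : 0 <= c by rewrite addr_ge0// sumr_ge0// => i _; exact: ltW.
exists (c * fine (M (below b))); first by rewrite mulr_ge0// fine_ge0.
move=> t t' x x'.
have mB := measurable_below b.
rewrite /oscint -RintegralB//; [|exact: cos_phase_integrable mB (below_fin b)..].
rewrite mulrAC; apply: Rint_bound => //.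
- exact: below_fin.
- apply: measurable_funTS; apply: measurable_funB; exact: measurable_cos_phase.
- move=> y yb; apply: (le_trans (cos_lipschitz _ _)).
  rewrite /phase (_ : _ - _ = (t - t') * Q y + dotp (x - x') y); last first.
    rewrite (_ : dotp (x - x') y = dotp x y - dotp x' y); first by ring.
    by rewrite /dotp -sumrB; apply: eq_bigr => i _; rewrite !mxE mulrBl.
  apply: (le_trans (ler_normD _ _)); rewrite normrM QP.
  have Pb : P y <= `|b| by apply: (le_trans (ltW yb)); exact: ler_norm.
  have hd : `|dotp (x - x') y| <= `|x - x'| * \sum_(i < d) r.
    apply: (le_trans (ler_norm_sum _ _ _)); rewrite mulr_sumr; apply: ler_sum => i _.
    rewrite normrM ler_pM//; first exact: coord_le_norm.
    by have := hr _ yb i; rewrite !mxE subr0 => /ltW.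
  have h1 : `|t - t'| * P y <= `|t - t'| * `|b| by rewrite ler_wpM2l.
  have s0 : 0 <= \sum_(i < d) r by rewrite sumr_ge0// => i _; exact: ltW.
  have := mulr_ge0 (normr_ge0 (t - t')) s0.
  have := mulr_ge0 (normr_ge0 (x - x')) (normr_ge0 b).
  rewrite /c; lra.
Qed.

Lemma osclim_continuous th t x : 0 < t ->
  {for (t, x), continuous (fun p : R * 'rV[R]_d => osclim th p.1 p.2)}.
Proof.
move=> t0; apply/cvgrPdist_le => e e0.
(* The tail bound is uniform over t' >= t / 2 and coordinates bounded by |x| + 1, a neighbourhood of
   (t, x), so one truncation T0 serves all nearby points. *)
have t20 : 0 < t / 2 by rewrite divr_gt0.
have X0 : 0 <= `|x| + 1 by rewrite addr_ge0.
have e40 : 0 < e / 4 by rewrite divr_gt0.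
have [T0 T01 hT0] := osclim_tail t20 X0 e40.
have [C C0 hC] := oscint_lipschitz th T0.
(* The last entry makes the Lipschitz error at most e / 4; C + 1 avoids a zero denominator. *)
pose del := Num.min 1 (Num.min (t / 2) (e / 8 / (C + 1))).
have d0 : 0 < del by rewrite !lt_min ltr01 t20/= !divr_gt0//; lra.
have : \forall p \near (t, x), ball (t, x) del p by exact: nbhsx_ballx.
apply: filterS => -[t' x'] [/= bt bx].
have ht : `|t - t'| < del by [].
have hx : `|x - x'| < del by move: bx; rewrite -ball_normE.
have dl1 : del <= 1 by rewrite ge_min lexx.
have dl2 : del <= t / 2 by rewrite !ge_min lexx !orbT.
have dl3 : del <= e / 8 / (C + 1) by rewrite !ge_min lexx !orbT.
have tt' : t / 2 <= t' by move: ht; rewrite ltr_norml => /andP[]; lra.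
have xb i : `|x 0 i| <= `|x| + 1 by have := coord_le_norm x i; lra.
have x'b i : `|x' 0 i| <= `|x| + 1.
  have := coord_le_norm x' i.
  have : `|x'| <= `|x| + `|x - x'|.
    by rewrite -{1}(subKr x x') (le_trans (ler_normB _ _)).
  lra.
have tt : t / 2 <= t by lra.
have h1 := hT0 t x th T0 tt xb (lexx _).
have h2 := hT0 t' x' th T0 tt' x'b (lexx _).
have h3 : `|oscint th T0 t x - oscint th T0 t' x'| <= e / 4.
  apply: (le_trans (hC _ _ _ _)).
  apply: (@le_trans _ _ ((C + 1) * (2 * (e / 8 / (C + 1))))).
    by rewrite ler_pM//; lra.
  by rewrite le_eqVlt; apply/orP; left; apply/eqP; field; rewrite gt_eqF//; lra.
rewrite (_ : osclim th t x - _ = (osclim th t x - oscint th T0 t x) +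
  (oscint th T0 t x - oscint th T0 t' x') - (osclim th t' x' - oscint th T0 t' x')); last by rewrite /=; ring.
apply: (le_trans (ler_normB _ _)); have := ler_normD (osclim th t x - oscint th T0 t x)
  (oscint th T0 t x - oscint th T0 t' x'); lra.
Qed.

Lemma dotp_mulmx x y (A : 'M[R]_d) : dotp x (y *m A) = dotp (x *m A^T) y.
Proof.
rewrite /dotp; under eq_bigr do rewrite mxE mulr_sumr.
rewrite exchange_big/=; apply: eq_bigr => j _; rewrite mxE mulr_suml.
by apply: eq_bigr => i _; rewrite mxE; ring.
Qed.

(** The flow at time ln t turns t Q into Q and the threshold b into t b; the latter disappears in
    the limit. *)
Lemma oscint_scale th b t x : 0 < t ->
  oscint th b t x = t `^ (- mu) * oscint th (t * b) 1 (x *m (eflow F (- ln t))^T).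
Proof.
move=> t0; pose s := ln t; have es : expR s = t by rewrite lnK.
set x' := x *m _.
have mB := measurable_below (t * b).
have := @Rint_flow (below (t * b)) (fun y => cos (phase 1 x' th y)) s.
have ci := cos_phase_integrable 1 x' th mB (below_fin _).
rewrite -restrict_EFin; move/(integrable_mkcond _ mB) : (ci) => ci' /(_ ci').
rewrite -/(oscint th (t * b) 1 x') => <-.
rewrite mulrA (_ : t `^ (- mu) * expR (s * mu) = 1) ?mul1r; last first.
  by rewrite /powR gt_eqF// -/s -expRD mulNr [mu * s]mulrC addNr expR0.
have -> : [set y | below (t * b) (y *m eflow F s)] = below b.
  by apply/seteqP; split => y; rewrite /below/= P_flow es ltr_pM2l.
apply: eq_Rintegral => y _; congr cos; rewrite /phase Q_flow es mul1r; congr (_ + _ + _).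
rewrite dotp_mulmx /x' -mulmxA -trmx_mul.
by rewrite -/s eflowN trmx1 mulmx1.
Qed.

Lemma osclim_scale th t x : 0 < t ->
  osclim th t x = t `^ (- mu) * osclim th 1 (x *m (eflow F (- ln t))^T).
Proof.
move=> t0; apply: cvg_lim => //.
rewrite (_ : (fun b => _) = fun b => t `^ (- mu) * oscint th (t * b) 1 (x *m (eflow F (- ln t))^T)).
  apply: cvgMl_tmp.
  apply: (cvg_comp (fun b => t * b) (fun b => oscint th b 1 _)).
    apply: gt0_cvgMry => //.
  exact: oscint_cvg.
by apply/funext => b; exact: oscint_scale.
Qed.

(** The integrand is bounded and supported in a cube, so the iterated integral is the integral
    against [lebM]. *)
Lemma trunc_re_oscint b t x : trunc_re Q b t x = oscint 0 b t x.
Proof.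
have [r r0 hr] := below_sub_rbox b.
have OE : Oset Q b = below b.
  by apply/seteqP; split => y; rewrite /Oset /below/= QP.
have E : (fun y => (\1_(below b) y * cos (t * Q y + dotp x y))%:E) =
    (fun y => (((fun y => cos (phase t x 0 y)) \_ (below b)) y)%:E).
  apply/funext => y; congr EFin; rewrite patchE indicE /phase addr0.
  by case: ifPn => yb; rewrite ?mul1r ?mul0r.
rewrite /trunc_re OE E (leb_intE (C := 1) _ _ r0).
- by rewrite /oscint [RHS]Rintegral_mkcond.
- apply: (measurable_restrictT _ (measurable_below b)).1.
  apply: measurable_funTS; exact: measurable_cos_phase.
- move=> y; rewrite patchE; case: ifPn => _; rewrite ?normr0//.
  exact: cos_phase_bound.
- by move=> y yr; rewrite patchE memNset// => /hr.
Qed.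

Lemma trunc_im_oscint b t x : trunc_im Q b t x = oscint (pi / 2) b t x.
Proof.
have [r r0 hr] := below_sub_rbox b.
have OE : Oset Q b = below b.
  by apply/seteqP; split => y; rewrite /Oset /below/= QP.
have E : (fun y => (- (\1_(below b) y * sin (t * Q y + dotp x y)))%:E) =
    (fun y => (((fun y => cos (phase t x (pi / 2) y)) \_ (below b)) y)%:E).
  apply/funext => y; congr EFin; rewrite patchE indicE /phase cosDpihalf.
  by case: ifPn => yb; rewrite ?mul1r ?mul0r ?oppr0.
rewrite /trunc_im OE E (leb_intE (C := 1) _ _ r0).
- by rewrite /oscint [RHS]Rintegral_mkcond.
- apply: (measurable_restrictT _ (measurable_below b)).1.
  apply: measurable_funTS; exact: measurable_cos_phase.
- move=> y; rewrite patchE; case: ifPn => _; rewrite ?normr0//.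
  exact: cos_phase_bound.
- by move=> y yr; rewrite patchE memNset// => /hr.
Qed.

Lemma leb_measure_vol : fine (leb_measure [set y | `|Q y| < 1]) = vol.
Proof.
have -> : [set y | `|Q y| < 1] = below 1.
  by apply/seteqP; split => y; rewrite /below/= QP.
have mB := measurable_below 1.
rewrite /leb_measure ge0_leb_intE.
- by rewrite integral_indic// setIT.
- by apply/measurable_EFinP; exact: measurable_indic.
- by move=> y; rewrite lee_fin.
Qed.

(** {P < 1} is open and contains 0, hence contains a cube. *)
Lemma vol_gt0 : 0 < vol.
Proof.
have o1 : open (below 1).
  rewrite (_ : below 1 = P @^-1` [set r | r < 1])//.
  by apply: open_comp => [y _|]; [exact: cP|exact: open_lt].
have P0 : below 1 0 by rewrite /below/= (P_eq0 0).2.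
have [e e0 he] := open_rboxP o1 P0.
have := lebM_rbox d e0 => h.
apply: (@lt_le_trans _ _ ((2 * e) ^+ d)); first by rewrite exprn_gt0// mulr_gt0.
rewrite -lee_fin -h /vol fineK; last by rewrite ge0_fin_numE//; exact: below1_fin.
by apply: le_measure => //; rewrite inE; [exact: measurable_rbox|exact: measurable_below].
Qed.

(** * The value at the origin *)

Definition oscrad b : R := \int[M]_(y in below b) cos (P y).

(** The cosine is even, so the sign of Q disappears from the real part. *)
Lemma oscint_rad b : oscint 0 b 1 0 = oscrad b.
Proof.
apply: eq_Rintegral => y _; rewrite /phase addr0 mul1r -QP.
have -> : dotp 0 y = 0 by rewrite /dotp big1// => i _; rewrite mxE mul0r.
rewrite addr0; have [?|?] := leP 0 (Q y); first by rewrite ger0_norm.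
by rewrite ltr0_norm// cosN.
Qed.

Lemma measurable_cosP : measurable_fun setT (fun y => cos (P y)).
Proof.
by apply: measurableT_comp mP; apply: continuous_measurable_fun; exact: continuous_cos.
Qed.

Lemma cosP_integrable (D : set 'rV[R]_d) : measurable D -> (M D < +oo)%E ->
  M.-integrable D (EFin \o (fun y => cos (P y))).
Proof.
move=> mD Doo; apply: (fin_integrable (C := 1)) => //.
- exact: measurable_funTS measurable_cosP.
- by move=> y _; rewrite ler_norml cos_geN1 cos_le1.
Qed.

(** Freezing cos P at cos c costs at most b - a, by the Lipschitz bound, times the measure of the
    shell. *)
Lemma oscrad_shell a b c : 0 < a -> a <= b -> a <= c <= b ->
  `|oscrad b - oscrad a - cos c * vol * (b `^ mu - a `^ mu)|
    <= (b - a) * (vol * (b `^ mu - a `^ mu)).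
Proof.
move=> a0 ab /andP[ac cb].
have mS := measurable_shell a b.
have -> : oscrad b - oscrad a = \int[M]_(y in shell a b) cos (P y).
  rewrite /oscrad (below_shellU ab) Rintegral_setU.
  - by rewrite addrC addKr.
  - exact: measurable_below.
  - exact: measurable_shell.
  - rewrite -below_shellU//; apply: cosP_integrable; first exact: measurable_below.
    exact: below_fin.
  - exact: below_shell_disj.
have fS : fine (M (shell a b)) = vol * (b `^ mu - a `^ mu).
  by rewrite lebM_shellE//= mulrC.
have -> : cos c * vol * (b `^ mu - a `^ mu) = \int[M]_(y in shell a b) cos c.
  by rewrite Rintegral_cst// fS mulrA.
rewrite -RintegralB//; last 2 first.
- exact: cosP_integrable mS (shell_fin _ _).
- by apply: (fin_integrable (f := cst (cos c)) (C := `|cos c|)) => //; exact: shell_fin.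
rewrite -fS; apply: Rint_bound => //.
- exact: shell_fin.
- by apply: measurable_funTS; apply: measurable_funB => //; exact: measurable_cosP.
- move=> y /andP[ay yb]; apply: (le_trans (cos_lipschitz _ _)).
  by rewrite ler_norml; apply/andP; split; lra.
Qed.

Lemma oscrad_small b : 0 < b -> `|oscrad b - cos b * b `^ mu * vol| <= b * (b `^ mu * vol).
Proof.
move=> b0; have mB := measurable_below b.
have fB : fine (M (below b)) = b `^ mu * vol by rewrite lebM_belowE.
have -> : cos b * b `^ mu * vol = \int[M]_(y in below b) cos b.
  by rewrite Rintegral_cst// fB mulrA.
rewrite /oscrad -RintegralB//; last 2 first.
- exact: cosP_integrable mB (below_fin _).
- by apply: (fin_integrable (f := cst (cos b)) (C := `|cos b|)) => //; exact: below_fin.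
rewrite -fB; apply: Rint_bound => //.
- exact: below_fin.
- by apply: measurable_funTS; apply: measurable_funB => //; exact: measurable_cosP.
- move=> y yb; apply: (le_trans (cos_lipschitz _ _)).
  have := P_ge0 y; move: yb; rewrite /below/= => h1 h2.
  by rewrite ler_norml; apply/andP; split; lra.
Qed.

(** f subtracts the integral with the cosine frozen at cos b. Its increment is at most |z - b| times
    a factor tending to 0, so its slope at b vanishes and only b^mu is differentiated. *)
Lemma der_oscrad b : 0 < b ->
  is_derive b 1 oscrad (cos b * vol * (mu * b `^ (mu - 1))).
Proof.
move=> b0.
have dp : is_derive b 1 (fun z => z `^ mu) (mu * b `^ (mu - 1)) by exact: is_derive1_powR.
pose f z := oscrad z - cos b * vol * z `^ mu.
have hf z : 0 < z -> `|f z - f b| <= `|z - b| * (vol * `|z `^ mu - b `^ mu|).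
  move=> z0; have pm u v : 0 < u -> u <= v -> u `^ mu <= v `^ mu.
    by move=> u0 uv; apply: ge0_ler_powR => //; rewrite nnegrE ltW//; exact: lt_le_trans uv.
  have [zb|/ltW bz] := leP z b.
    have := oscrad_shell (c := b) z0 zb; rewrite zb lexx => /(_ isT).
    have -> : `|z - b| = b - z by rewrite distrC ger0_norm ?subr_ge0.
    have -> : `|z `^ mu - b `^ mu| = b `^ mu - z `^ mu.
      by rewrite distrC ger0_norm// subr_ge0 pm.
    apply: le_trans; rewrite -normrN le_eqVlt; apply/orP; left; apply/eqP.
    by rewrite /f; congr (`|_|); ring.
  have := oscrad_shell (c := b) b0 bz; rewrite bz lexx => /(_ isT).
  have -> : `|z - b| = z - b by rewrite ger0_norm ?subr_ge0.
  have -> : `|z `^ mu - b `^ mu| = z `^ mu - b `^ mu.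
    by rewrite ger0_norm// subr_ge0 pm.
  by rewrite /f; apply: le_trans; rewrite le_eqVlt; apply/orP; left; apply/eqP; congr (`|_|); ring.
have df : is_derive b 1 f 0.
  apply/is_derive1_caratheodory; exists (fun z => (f z - f b) / (z - b)); split.
  - move=> z; have [->|zb] := eqVneq z b; first by rewrite !subrr mulr0.
    by rewrite divfK// subr_eq0.
  - rewrite /= /prop_for/continuous_at subrr mul0r.
    have cv : (fun z => vol * `|z `^ mu - b `^ mu|) @ b --> (0 : R).
      have c1 : (fun z => z `^ mu - b `^ mu) @ b --> (0 : R).
        rewrite -(subrr (b `^ mu)); apply: cvgB; first exact: (der_continuous dp).
        exact: cvg_cst.
      rewrite -(mulr0 vol); apply: cvgMl_tmp.
      have c2 := cvg_norm c1; rewrite normr0 in c2; exact: c2.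
    have bpos : \forall z \near b, 0 < z by exact: lt_nbhsr.
    apply/cvgr0Pnorm_le => e e0.
    have := bpos; have /cvgr0Pnorm_le /(_ e e0) := cv.
    apply: filterS2 => z hz z0.
    have [->|zb] := eqVneq z b; first by rewrite subrr mul0r normr0 ltW.
    rewrite normrM normfV ler_pdivrMr ?normr_gt0 ?subr_eq0// mulrC.
    apply: (le_trans (hf _ z0)); rewrite ler_wpM2l//.
    by apply: le_trans hz; exact: ler_norm.
  - by rewrite subrr mul0r.
have dg : is_derive b 1 (fun z => f z + cos b * vol * z `^ mu)
    (0 + cos b * vol * (mu * b `^ (mu - 1))).
  exact: derD df (derZ _ dp).
rewrite add0r in dg; rewrite (_ : oscrad = fun z => f z + cos b * vol * z `^ mu)//.
by apply/funext => z; rewrite /f subrK.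
Qed.

(** Integration by parts: subtracting vol b^mu cos b from [oscrad b] leaves the derivative vol s^mu
    sin s. *)
Lemma oscrad_rot a T : 0 < a -> a < T ->
  oscrad T - oscrad a =
  vol * (T `^ mu * cos T + \int[@lebesgue_measure R]_(s in `[a, T]) (s `^ mu * sin s)
         - a `^ mu * cos a).
Proof.
move=> a0 aT.
have pos s : a <= s <= T -> 0 < s by move=> /andP[h _]; exact: lt_le_trans h.
have cf s : a <= s <= T -> {for s, continuous (fun s => vol * (s `^ mu * sin s))}.
  move=> /pos s0; exact: (der_continuous (derZ vol (derM (der_powR mu s0) (is_derive_sin s)))).
have cf1 s : a <= s <= T -> {for s, continuous (fun s => s `^ mu * sin s)}.
  move=> /pos s0; exact: (der_continuous (derM (der_powR mu s0) (is_derive_sin s))).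
have dF s : a <= s <= T -> is_derive s 1 (fun b => oscrad b - vol * (b `^ mu * cos b))
    (vol * (s `^ mu * sin s)).
  move=> /pos s0.
  apply: (der_eq (derB (der_oscrad s0) (derZ vol (derM (der_powR mu s0) (is_derive_cos s))))).
  by ring.
have := Rintegral_FTC aT cf dF.
rewrite RintegralZl; [|exact: measurable_itv|exact: continuous_itv_integrable].
move=> E; rewrite mulrBr mulrDr E; ring.
Qed.

(** The rotation error is added to the error of replacing [oscrad a] by its frozen value, which
    cancels the boundary term at a. *)
Lemma oscrad_near_Gamma a T : 0 < a -> a <= 1 -> 1 < T ->
  `|oscrad T - vol * (cos (mu * pi / 2) *
     (T `^ mu * expR (- T) + \int[@lebesgue_measure R]_(s in `[a, T]) (s `^ mu * expR (- s))))|
  <= vol * (2 * T `^ (mu - 1) + (T `^ mu * expR (- (T / 2)) + a) * (pi / 2) + a).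
Proof.
move=> a0 a1 T1.
have aT : a < T by exact: le_lt_trans T1.
have h1 := oscrad_rot a0 aT.
rewrite -(rot_pihalf mu a T) in h1.
rewrite -(rot_0 mu T a0).
have h2 := rot_bound mu0 mu1 a0 a1 T1.
have h3 := oscrad_small a0.
have v0 := vol_ge0.
have am : a `^ mu <= 1 by rewrite -[leRHS](powRr0 a) ger_powR// a0.
have h4 : a * (a `^ mu * vol) <= vol * a.
  by rewrite [vol * a]mulrC ler_wpM2l ?(ltW a0)// ler_piMl.
rewrite (_ : oscrad T - _ = vol * (rot mu a T (pi / 2) - rot mu a T 0) +
    (oscrad a - cos a * a `^ mu * vol)); last by move: h1; rewrite mulrBr; lra.
apply: (le_trans (ler_normD _ _)); rewrite [leRHS]mulrDr; apply: lerD.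
  by rewrite normrM (ger0_norm v0) ler_wpM2l.
exact: le_trans h3 h4.
Qed.

(** The quadratic term of the exponential gives e^{T/2} >= T^2 / 8. *)
Lemma expR_half_decay (T : R) : 0 < T -> T * expR (- (T / 2)) <= 8 / T.
Proof.
move=> T0; have T20 : 0 <= T / 2 by rewrite divr_ge0// ltW.
have h := expR_ge1Dxn 1 T20.
have e0 := expR_gt0 (T / 2).
rewrite expRN ler_pdivrMr// mulrAC ler_pdivlMr//.
have : T ^+ 2 / 8 <= expR (T / 2).
  apply: le_trans h; rewrite (_ : (T / 2) ^+ 2 / _ = T ^+ 2 / 8); first by rewrite lerDr.
  by rewrite (_ : 2`! = 2)//; field.
rewrite expr2; lra.
Qed.

Lemma osclim_Gamma : osclim 0 1 0 = vol * (cos (mu * pi / 2) * Gamma (1 + mu)).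
Proof.
(* The endpoints of [gamma_cvg]: the inner radius shrinks while the outer one grows, and every error
   tends to 0 because mu < 1. *)
pose T n : R := n.+2%:R; pose a n : R := n.+2%:R^-1.
have T1 n : 1 < T n by rewrite ltr1n.
have T0 n : 0 < T n by exact: lt_trans (T1 n).
have a0 n : 0 < a n by rewrite invr_gt0.
have a1 n : a n <= 1 by rewrite invf_le1; [exact: ltW (T1 n)|exact: T0 n].
have ac : a @ \oo --> (0 : R).
  have := @cvg_harmonic R; rewrite -(cvg_shiftS (@harmonic R)); exact.
have Tc : T @ \oo --> +oo.
  apply/cvgryPge => A; have /cvgryPge /(_ A) := @cvgr_idn R.
  by apply: filterS => n /le_trans; apply; rewrite ler_nat -addn2 leq_addr.
have c1 : (fun n => oscrad (T n)) @ \oo --> osclim 0 1 0.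
  rewrite (_ : (fun n => _) = (fun b => oscint 0 b 1 0) \o T); last first.
    by apply/funext => n /=; rewrite oscint_rad.
  have c0 : (fun b => oscint 0 b 1 0) @ +oo --> osclim 0 1 0 by exact: oscint_cvg.
  by apply: cvg_comp c0; exact: Tc.
pose g n := \int[@lebesgue_measure R]_(s in `[(n.+2%:R)^-1, n.+2%:R]) (s `^ mu * expR (- s)).
have gc : g @ \oo --> Gamma (1 + mu) := gamma_cvg mu0 mu1.
have Tm n p : 0 <= p -> T n `^ mu * p <= T n * p.
  by move=> p0; rewrite ler_wpM2r// -[leRHS](powRr1 (ltW (T0 n))) ler_powR// ltW.
have d1 n : T n `^ mu * expR (- (T n / 2)) <= 8 * a n.
  by apply: (le_trans (Tm _ _ (expR_ge0 _))); exact: expR_half_decay.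
have d2 n : T n `^ mu * expR (- T n) <= 8 * a n.
  apply: le_trans (d1 n); rewrite ler_wpM2l ?powR_ge0// ler_expR lerN2.
  have := T0 n; lra.
have c8 : (fun n => 8 * a n) @ \oo --> (0 : R).
  by rewrite -(mulr0 8); exact: cvgMl_tmp.
have c2 : (fun n => T n `^ mu * expR (- T n)) @ \oo --> (0 : R).
  apply: (squeeze_cvgr _ (cvg_cst _) c8); apply: nearW => n.
  by rewrite d2 mulr_ge0 ?powR_ge0 ?expR_ge0.
have c3 : (fun n => T n `^ (mu - 1)) @ \oo --> (0 : R).
  (* T^(mu-1) = a^(1-mu), a positive power of a sequence tending to 0 from the right. *)
  rewrite (_ : (fun n => _) = (fun z => z `^ (1 - mu)) \o a); last first.
    by apply/funext => n /=; rewrite /a -powR_inv1 ?ler0n// -powRrM; congr (_ `^ _); rewrite mulN1r opprB.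
  have m1 : 0 < 1 - mu by rewrite subr_gt0.
  exact: ((cvg_at_rightP _ _ _).1 (powR_cvg0 m1) a (conj a0 ac)).
pose err n := vol * (2 * T n `^ (mu - 1) + (T n `^ mu * expR (- (T n / 2)) + a n) * (pi / 2) + a n).
have c4 : (fun n => T n `^ mu * expR (- (T n / 2))) @ \oo --> (0 : R).
  apply: (squeeze_cvgr _ (cvg_cst _) c8); apply: nearW => n.
  by rewrite d1 mulr_ge0 ?powR_ge0 ?expR_ge0.
have ec : err @ \oo --> (0 : R).
  have -> : 0 = vol * (2 * 0 + (0 + 0) * (pi / 2) + 0) :> R by ring.
  apply: cvgMl_tmp; apply: cvgD => //; apply: cvgD; first exact: cvgMl_tmp.
  by apply: cvgMr_tmp; exact: cvgD.
pose l n := vol * (cos (mu * pi / 2) * (T n `^ mu * expR (- T n) + g n)).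
have lc : l @ \oo --> vol * (cos (mu * pi / 2) * Gamma (1 + mu)).
  rewrite -[Gamma _]add0r.
  by apply: cvgMl_tmp; apply: cvgMl_tmp; exact: cvgD.
have c5 : (fun n => oscrad (T n) - l n) @ \oo --> (0 : R).
  apply/cvgr0Pnorm_le => e e0; have /cvgr0Pnorm_le /(_ e e0) := ec.
  apply: filterS => n hn.
  apply: (le_trans (oscrad_near_Gamma (a0 n) (a1 n) (T1 n))).
  by apply: le_trans hn; exact: ler_norm.
have c6 : (fun n => oscrad (T n)) @ \oo --> vol * (cos (mu * pi / 2) * Gamma (1 + mu)).
  rewrite (_ : (fun n => _) = fun n => (oscrad (T n) - l n) + l n); last first.
    by apply/funext => n; rewrite subrK.
  by rewrite -[vol * _]add0r; exact: cvgD.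
exact: (cvg_unique _ c1 c6).
Qed.

(** * Transfer to the kernel H *)

Lemma trunc_re_lim t x : lim ((fun b => trunc_re Q b t x) @ +oo) = osclim 0 t x.
Proof.
rewrite (_ : (fun b => trunc_re Q b t x) = fun b => oscint 0 b t x)//.
by apply/funext => b; rewrite trunc_re_oscint.
Qed.

Lemma trunc_im_lim t x : lim ((fun b => trunc_im Q b t x) @ +oo) = osclim (pi / 2) t x.
Proof.
rewrite (_ : (fun b => trunc_im Q b t x) = fun b => oscint (pi / 2) b t x)//.
by apply/funext => b; rewrite trunc_im_oscint.
Qed.

Lemma trunc_cvg t x : 0 < t ->
  cvg ((fun b => trunc_re Q b t x) @ +oo) /\ cvg ((fun b => trunc_im Q b t x) @ +oo).
Proof.
move=> t0; split.
  rewrite (_ : (fun b => trunc_re Q b t x) = fun b => oscint 0 b t x).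
    exact: oscint_cvg.
  by apply/funext => b; rewrite trunc_re_oscint.
rewrite (_ : (fun b => trunc_im Q b t x) = fun b => oscint (pi / 2) b t x).
  exact: oscint_cvg.
by apply/funext => b; rewrite trunc_im_oscint.
Qed.

Lemma H_continuous t x : 0 < t ->
  {for (t, x), continuous (fun p : R * 'rV[R]_d => H_re Q p.1 p.2)} /\
  {for (t, x), continuous (fun p : R * 'rV[R]_d => H_im Q p.1 p.2)}.
Proof.
move=> t0; split.
  rewrite (_ : (fun p : R * 'rV[R]_d => H_re Q p.1 p.2) =
      fun p => ((2 * pi) ^+ d)^-1 * osclim 0 p.1 p.2).
    by apply: cvgMl_tmp; exact: osclim_continuous.
  by apply/funext => p; rewrite /H_re trunc_re_lim.
rewrite (_ : (fun p : R * 'rV[R]_d => H_im Q p.1 p.2) =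
    fun p => ((2 * pi) ^+ d)^-1 * osclim (pi / 2) p.1 p.2).
  by apply: cvgMl_tmp; exact: osclim_continuous.
by apply/funext => p; rewrite /H_im trunc_im_lim.
Qed.

Let pid_gt0 : 0 < (2 * pi) ^+ d :> R.
Proof. by rewrite exprn_gt0// mulr_gt0// pi_gt0. Qed.

(** The modulus is at most e / sqrt 2, which turns two weak bounds into a strict one. *)
Lemma cmod_lt (u v e : R) : 0 < e -> `|u| <= e / 2 -> `|v| <= e / 2 -> cmod u v < e.
Proof.
move=> e0 hu hv; rewrite /cmod -[ltRHS](ger0_norm (ltW e0)) -sqrtr_sqr ltr_sqrt ?exprn_gt0//.
move: hu hv; rewrite !ler_norml !expr2 => /andP[? ?] /andP[? ?]; nra.
Qed.

Lemma trunc_uniform (t0 : R) (K : set 'rV[R]_d) (e : R) : 0 < t0 -> compact K -> 0 < e ->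
  exists tau0 : R, forall (tau t : R) (x : 'rV[R]_d), tau0 <= tau -> t0 <= t -> K x ->
    cmod ((2 * pi) ^+ d * H_re Q t x - trunc_re Q tau t x)
         ((2 * pi) ^+ d * H_im Q t x - trunc_im Q tau t x) < e.
Proof.
move=> t00 cK e0; have [X X1 hX] := compact_norm_bound cK.
have X0 : 0 <= X by lra.
have [T0 _ hT0] := osclim_tail t00 X0 (divr_gt0 e0 (ltr0n R 2)).
exists T0 => tau t x Tt tt Kx.
have hx i : `|x 0 i| <= X by exact: le_trans (coord_le_norm x i) (hX _ Kx).
rewrite /H_re /H_im trunc_re_lim trunc_im_lim !mulVKf ?gt_eqF//.
rewrite trunc_re_oscint trunc_im_oscint.
by apply: cmod_lt => //; exact: hT0.
Qed.

Lemma H_scale t x : 0 < t ->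
  H_re Q t x = t `^ (- mu) * H_re Q 1 (x *m (eflow F (- ln t))^T) /\
  H_im Q t x = t `^ (- mu) * H_im Q 1 (x *m (eflow F (- ln t))^T).
Proof.
move=> t0; rewrite /H_re /H_im !trunc_re_lim !trunc_im_lim.
by split; rewrite [in LHS]osclim_scale// mulrCA.
Qed.

(** Scaling fixes x = 0 and reduces to t = 1. Positivity of the cosine holds because 0 <= mu < 1
    puts mu pi / 2 in [0, pi / 2). *)
Lemma H_re_origin t : 0 < t ->
  H_re Q t 0 = t `^ (- mu) / (2 * pi) ^+ d
    * fine (leb_measure [set xi | `|Q xi| < 1]) * Gamma (1 + mu) * cos (mu * pi / 2) /\
  0 < t `^ (- mu) / (2 * pi) ^+ d
    * fine (leb_measure [set xi | `|Q xi| < 1]) * Gamma (1 + mu) * cos (mu * pi / 2).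
Proof.
move=> t0; rewrite leb_measure_vol; split.
  have [-> _] := H_scale 0 t0; rewrite mul0mx /H_re trunc_re_lim osclim_Gamma.
  by field; rewrite gt_eqF.
rewrite mulr_gt0//; last first.
  have p0 := pi_gt0 R; have m0 := mu0; have m1 := mu1.
  apply: cos_gt0_pihalf; apply/andP; split; nra.
rewrite mulr_gt0// ?Gamma_gt0// mulr_gt0 ?vol_gt0// divr_gt0//.
exact: powR_gt0.
Qed.

End FlowIntegrals.

(** * From exponents of homogeneity to flows on rows *)

Section HomogeneousFlow.
Variables (R : realType) (d : nat).
Implicit Types (x : 'rV[R]_d) (E F : 'M[R]_d) (P Q : 'rV[R]_d -> R).

Lemma continuous_eflow F x : continuous (fun s : R => x *m eflow F s).
Proof.
move=> s; apply: cvg_mx => i j.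
rewrite (_ : (fun k => _) = fun u => \sum_l x i l * eflow F u l j); last first.
  by apply/funext => u; rewrite mxE.
rewrite [X in _ --> X]mxE.
apply: (@der_continuous R _ s (\sum_l x i l * (F *m eflow F s) l j)).
by apply: der_sum => l; apply: derZ; exact: der_eflowl.
Qed.

(** A matrix acts on rows through its transpose on the right, so the flow generator belonging to E
    is E^T. *)
Lemma hom_exp_flow P E x s : hom_exp P E -> P (x *m eflow E^T s) = expR s * P x.
Proof.
move=> hE; have := hE (expR s) (expR_gt0 s) x.
by rewrite /mact /mpow expRK -/(eflow E s) -eflow_tr.
Qed.

Lemma hom_exp_norm Q E : hom_exp Q E -> hom_exp (fun x => `|Q x|) E.
Proof. by move=> hE t t0 x; rewrite hE// normrM gtr0_norm. Qed.

(* Along an orbit |Q| never vanishes unless Q x = 0, so Q keeps its sign. *)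
Lemma flow_of_norm_flow Q F : continuous Q ->
  (forall x s, `|Q (x *m eflow F s)| = expR s * `|Q x|) ->
  forall x s, Q (x *m eflow F s) = expR s * Q x.
Proof.
move=> cQ h x s.
pose u (z : R) := Q (x *m eflow F z).
have cu : continuous u.
  by move=> z; apply: continuous_comp; [exact: continuous_eflow|exact: cQ].
have u0 : u 0 = Q x by rewrite /u eflow0 mulmx1.
have [Q0|Qn0] := eqVneq (Q x) 0.
  by rewrite Q0 mulr0; apply/eqP; rewrite -normr_eq0 h Q0 normr0 mulr0.
have un0 z : u z != 0.
  by rewrite -normr_gt0 /u h mulr_gt0 ?expR_gt0// normr_gt0.
have key a b : a <= b -> u a * u b < 0 -> False.
  move=> ab neg; have [||c _ c0] := @IVT R u a b 0 ab.
  - exact: continuous_subspaceT.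
  - rewrite ge_min le_max; have [a0|a0] := ltP (u a) 0.
      by move: neg; rewrite nmulr_rlt0// (ltW a0) => /ltW ->; rewrite orbT.
    have a0' : 0 < u a by rewrite lt_neqAle eq_sym un0.
    by move: neg; rewrite pmulr_rlt0// => /ltW ->; rewrite orbT.
  by have := un0 c; rewrite c0 eqxx.
have sgn : 0 < u s * u 0.
  rewrite lt_neqAle eq_sym mulf_neq0//= leNgt; apply/negP => neg.
  have [s0|/ltW s0] := leP s 0; first exact: key s0 neg.
  by apply: (key _ _ s0); rewrite mulrC.
have hs : `|u s| = expR s * `|u 0| by rewrite u0; exact: h.
rewrite -u0 -/(u s); have [p0|n0] := ltP 0 (u 0).
  have ps : 0 < u s by move: sgn; rewrite pmulr_lgt0.
  by move: hs; rewrite (gtr0_norm p0) (gtr0_norm ps).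
have n0' : u 0 < 0 by rewrite lt_neqAle un0.
have ns : u s < 0 by move: sgn; rewrite nmulr_lgt0.
by move: hs; rewrite (ltr0_norm n0') (ltr0_norm ns) mulrN => /oppr_inj.
Qed.

End HomogeneousFlow.

Unset Implicit Arguments.
Set Strict Implicit.

Theorem mainTheorem5 (R : realType) (d : nat) (Q : 'rV[R]_d -> R) (mu : R) :
  continuous Q ->
  pos_homogeneous (fun xi => `|Q xi|) ->
  (forall E, hom_exp (fun xi => `|Q xi|) E -> \tr E = mu) ->
  mu < 1 ->
  [/\
   (* (1) existence of the limit and continuity on (0,oo) x R^d *)
   (forall (t : R) (x : 'rV[R]_d), 0 < t ->
      cvg ((fun tau => trunc_re Q tau t x) @ +oo) /\
      cvg ((fun tau => trunc_im Q tau t x) @ +oo)),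
   (forall (t : R) (x : 'rV[R]_d), 0 < t ->
      {for (t, x), continuous (fun p : R * 'rV[R]_d => H_re Q p.1 p.2)} /\
      {for (t, x), continuous (fun p : R * 'rV[R]_d => H_im Q p.1 p.2)}),
   (* (2) uniformity of the limit for t >= t0, x in K *)
   (forall (t0 : R) (K : set 'rV[R]_d), 0 < t0 -> compact K ->
      forall eps : R, 0 < eps -> exists tau0 : R,
        forall (tau t : R) (x : 'rV[R]_d), tau0 <= tau -> t0 <= t -> K x ->
          cmod ((2 * pi) ^+ d * H_re Q t x - trunc_re Q tau t x)
               ((2 * pi) ^+ d * H_im Q t x - trunc_im Q tau t x) < eps),
   (* (3) scaling: H^t(x) = t^{-mu} H^1(t^{-E^*} x) for E in Exp(Q) *)
   (forall E : 'M[R]_d, hom_exp Q E ->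
      forall (t : R) (x : 'rV[R]_d), 0 < t ->
        H_re Q t x = t `^ (- mu) * H_re Q 1 (mact (mpow t (- E^T)) x) /\
        H_im Q t x = t `^ (- mu) * H_im Q 1 (mact (mpow t (- E^T)) x))
  & (* (4) value of Re H^t(0) *)
   (forall t : R, 0 < t ->
      H_re Q t 0 = t `^ (- mu) / (2 * pi) ^+ d
                   * fine (leb_measure [set xi | `|Q xi| < 1])
                   * Gamma (1 + mu) * cos (mu * pi / 2) /\
      0 < t `^ (- mu) / (2 * pi) ^+ d
                   * fine (leb_measure [set xi | `|Q xi| < 1])
                   * Gamma (1 + mu) * cos (mu * pi / 2))].
Proof.
move=> cQ [cP [P0 PE] [E0 hE0] cS] htr mu1.
have flowP E : hom_exp (fun xi => `|Q xi|) E ->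
    forall x s, `|Q (x *m eflow E^T s)| = expR s * `|Q x|.
  by move=> hE x s; exact: (hom_exp_flow x s hE).
have flowQ E (hE : hom_exp (fun xi => `|Q xi|) E) := flow_of_norm_flow cQ (flowP E hE).
have trE E : hom_exp (fun xi => `|Q xi|) E -> \tr E^T = mu.
  by move=> /htr; rewrite mxtrace_tr.
have muE0 : \tr E0^T < 1 by rewrite trE.
split.
- move=> t x t0.
  exact: (trunc_cvg cP P0 PE (flowP _ hE0) cS muE0 cQ (fun=> erefl) (flowQ _ hE0) x t0).
- move=> t x t0.
  exact: (H_continuous cP P0 PE (flowP _ hE0) cS muE0 cQ (fun=> erefl) (flowQ _ hE0) x t0).
- move=> t0 K t00 cK e e0.
  exact: (trunc_uniform cP P0 PE (flowP _ hE0) cS muE0 cQ (fun=> erefl) (flowQ _ hE0) t00 cK e0).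
(* Here the flow is that of the given E, whereas the other clauses fix one exponent E0; the kernels
   do not depend on this choice. *)
- move=> E /hom_exp_norm hE t x t0.
  have muE : \tr E^T < 1 by rewrite trE.
  have := H_scale cP P0 PE (flowP _ hE) cS muE cQ (fun=> erefl) (flowQ _ hE) x t0.
  by rewrite (trE _ hE) /mact /mpow /eflow scalerN scaleNr.
- move=> t t0.
  have := H_re_origin cP P0 PE (flowP _ hE0) cS muE0 cQ (fun=> erefl) (flowQ _ hE0) t0.
  by rewrite (trE _ hE0).
Qed.
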